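(* Let $a\neq\tfrac14$, $d=\tfrac14$ and $b=e=0$. Then $\mathcal L=\mathcal L_{a,b,d,e}$ is a real Lie algebra of dimension $6$ with basis \begin{align*} v_1&=2tx\,\partial_x+2ty\,\partial_y+t^2\partial_t+\big(2(x+y)-2(a+\tfrac14)t\big)u\,\partial_u,\\ v_2&=x\,\partial_x+y\,\partial_y+t\,\partial_t,\qquad v_3=\partial_t,\\ v_4&=t\sqrt y\,\partial_y+2\sqrt y\,u\,\partial_u,\qquad v_5=\sqrt y\,\partial_y,\qquad v_6=u\,\partial_u, \end{align*} and $\mathcal L\cong\mathcal M\cong\mathcal H_{0,0}$.
   Context: All Lie algebras are real. For real constants $a,b,d,e$ consider the PDE $$\Delta:=(a-bx)u_x+(d-ey)u_y+\tfrac x2u_{xx}+\tfrac y2u_{yy}+u_t=0$$ for $u=u(x,y,t)$, $x,y>0$, $t\in\mathbb R$. An infinitesimal symmetry of the PDE is a smooth vector field $v=\xi\partial_x+\gamma\partial_y+\tau\partial_t+\phi\partial_u$ on $\{(x,y,t,u):x>0,y>0,t\in\mathbb R,u\in\mathbb R\}$, with $\xi,\gamma,\tau,\phi$ functions of $(x,y,t,u)$, whose second prolongation $\mathrm{pr}^{(2)}v$ satisfies $\mathrm{pr}^{(2)}v(\Delta)=0$ at all points of the second jet space where $\Delta=0$. $\mathcal V_{a,b,d,e}$ is the Lie algebra of all infinitesimal symmetries, under the Lie bracket of vector fields. For every $v\in\mathcal V_{a,b,d,e}$ the coefficient $\phi$ is affine in $u$: $\phi=\lambda_v(x,y,t)u+\mu_v(x,y,t)$.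 Set $\mathcal L_{a,b,d,e}=\{v\in\mathcal V_{a,b,d,e}:\mu_v=0\}$. $\mathcal M$ is the 6-dimensional real Lie algebra with basis $E,F,H,X,Y,Z$ and nonzero brackets (up to antisymmetry) $[E,F]=H$, $[H,E]=2E$, $[H,F]=-2F$, $[X,Y]=Z$, $[E,Y]=X$, $[F,X]=Y$, $[H,X]=X$, $[H,Y]=-Y$; thus $\mathcal M\cong\mathfrak{sl}_2\ltimes\mathfrak h_3$ with $\mathfrak h_3=\langle X,Y,Z\rangle$ the Heisenberg algebra. $\mathcal H_{0,0}$ is the 6-dimensional Lie symmetry algebra of the heat equation $\frac{\partial u}{\partial t}=-\frac{\partial^2u}{\partial q^2}$ for $u=u(t,q)$ (the symmetries coming from linear superposition of solutions being left out).
   Formalization: The formal theorem also assumes a ≠ 3/4: at a = 3/4 the claim is false, since √x ∂_x − (u/(2√x)) ∂_u is a further symmetry in L outside the span of v_1,…,v_6, so the dimension exceeds 6. *)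

(* Defs.v *)
From HB Require Import structures.
From mathcomp Require Import all_boot all_order all_algebra.
From mathcomp Require Import all_classical all_reals all_analysis.

Set Implicit Arguments.
Unset Strict Implicit.
Unset Printing Implicit Defensive.

Import Order.TTheory GRing.Theory Num.Theory.
Import numFieldNormedType.Exports.

Local Open Scope classical_set_scope.
Local Open Scope ring_scope.

Section LieAlgebras.
Variables (R : realType) (V W : lmodType R).

Record lie_algebra_on (S : set V) (br : V -> V -> V) : Prop := {
  lie_zero : S 0;
  lie_add : forall u v, S u -> S v -> S (u + v);
  lie_scale : forall (c : R) u, S u -> S (c *: u);
  lie_bracket : forall u v, S u -> S v -> S (br u v);
  lie_linl : forall (c : R) u v w, S u -> S v -> S w ->
    br (c *: u + v) w = c *: br u w + br v w;
  lie_linr : forall (c : R) u v w, S u -> S v -> S w ->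
    br w (c *: u + v) = c *: br w u + br w v;
  lie_alt : forall u, S u -> br u u = 0;
  lie_jacobi : forall u v w, S u -> S v -> S w ->
    br u (br v w) + br v (br w u) + br w (br u v) = 0 }.

Record basis_of_set (m : nat) (S : set V) (b : m.-tuple V) : Prop := {
  basis_mem : forall i, S (tnth b i);
  basis_free : forall c : 'I_m -> R,
    \sum_(i < m) c i *: tnth b i = 0 -> forall i, c i = 0;
  basis_span : forall v, S v ->
    exists c : 'I_m -> R, v = \sum_(i < m) c i *: tnth b i }.

Definition lie_isomorphic (S : set V) (brV : V -> V -> V)
    (T : set W) (brW : W -> W -> W) : Prop :=
  exists f : V -> W,
    [/\ set_bij S T f,
        forall (c : R) u v, S u -> S v -> f (c *: u + v) = c *: f u + f v
      & forall u v, S u -> S v -> f (brV u v) = brW (f u) (f v)].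

End LieAlgebras.

(* sl_2 semidirect h_3 on R^6; the basis vectors of index 0, 1, 2, 3, 4, 5 are
   E, F, H, X, Y, Z. Each pair of brackets [A, B] = - [B, A] <> 0 is listed
   once in [M_table]. *)
Section AlgebraM.
Variable R : realType.

Definition M_basis (k : nat) : 'rV[R]_6 := delta_mx 0 (inord k).

Definition M_table (i j : nat) : 'rV[R]_6 :=
  match i, j with
  | 0, 1 => M_basis 2              (* [E, F] = H *)
  | 2, 0 => 2%:R *: M_basis 0      (* [H, E] = 2 E *)
  | 2, 1 => - (2%:R *: M_basis 1)  (* [H, F] = - 2 F *)
  | 3, 4 => M_basis 5              (* [X, Y] = Z *)
  | 0, 4 => M_basis 3              (* [E, Y] = X *)
  | 1, 3 => M_basis 4              (* [F, X] = Y *)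
  | 2, 3 => M_basis 3              (* [H, X] = X *)
  | 2, 4 => - M_basis 4            (* [H, Y] = - Y *)
  | _, _ => 0
  end.

Definition M_bracket (x y : 'rV[R]_6) : 'rV[R]_6 :=
  \sum_(i < 6) \sum_(j < 6)
    (x 0 i * y 0 j) *: (M_table i j - M_table j i).

End AlgebraM.

Section Smooth.
Variables (R : realType) (E F : normedModType R).

Fixpoint iter_derive (s : seq E) (f : E -> F) : E -> F :=
  if s is e :: s' then 'D_e (iter_derive s' f) else f.

(* C^oo on the open subset [O] of the finite-dimensional space [E]: the iterated
   directional derivatives of all orders exist and are continuous on [O]. At a
   point of [O] they only depend on the values of [f] on [O]. *)
Definition smooth_on (O : set E) (f : E -> F) : Prop :=
  forall (s : seq E) (p : E), O p ->
    {for p, continuous (iter_derive s f)} /\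
    (forall e : E, derivable (iter_derive s f) p e).

End Smooth.

(* One dependent variable u, n independent variables x. *)
Section Symmetries.
Variables (R : realType) (n : nat).

(* Points (x, u). *)
Definition base : normedModType R := ('rV[R]_n * R)%type.
(* Points (x, u, p) with p_i standing for u_i. *)
Definition jet1 : normedModType R := (base * 'rV[R]_n)%type.
(* Points (x, u, p, h) with h_ij standing for u_ij; the second jet space is the
   subspace of those with h symmetric. *)
Definition jet2 : normedModType R := (jet1 * 'M[R]_n)%type.

(* A vector field on the open set [O] is represented by the map sending a point
   to (coefficients of the d/dx_i, coefficient of d/du), extended by 0 outside
   [O]: equality of fields on [O] is then equality of functions. *)
Definition vfield : lmodType R := base -> base.

Definition on_domain (O : set base) (v : vfield) : vfield :=
  patch (fun=> 0) O v.

Definition smooth_vfield (O : set base) (v : vfield) : Prop :=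
  smooth_on O v /\ forall p, ~ O p -> v p = 0.

Definition vbracket (O : set base) (v w : vfield) : vfield :=
  on_domain O (fun p => 'D_(v p) w p - 'D_(w p) v p).

Definition xi (v : vfield) (k : 'I_n) : base -> R := fun p => (v p).1 0 k.
Definition phi (v : vfield) : base -> R := fun p => (v p).2.

Definition dx0 (i : 'I_n) : base := (delta_mx 0 i, 0).
Definition du0 : base := (0, 1).
Definition dx1 (i : 'I_n) : jet1 := (dx0 i, 0).
Definition du1 : jet1 := (du0, 0).
Definition dp1 (j : 'I_n) : jet1 := (0, delta_mx 0 j).

(* Total derivatives: D_i f = f_{x_i} + u_i f_u for f a function of (x, u), and
   D_i g = g_{x_i} + u_i g_u + sum_j u_ij g_{u_j} for g a function of
   (x, u, u_1, ..., u_n). *)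
Definition totalD0 (i : 'I_n) (f : base -> R) (z : jet1) : R :=
  'D_(dx0 i) f z.1 + z.2 0 i * 'D_du0 f z.1.

Definition totalD1 (i : 'I_n) (g : jet1 -> R) (z : jet2) : R :=
  'D_(dx1 i) g z.1 + z.1.2 0 i * 'D_du1 g z.1
  + \sum_(j < n) z.2 i j * 'D_(dp1 j) g z.1.

(* Prolongation formula, in recursive form:
   phi^i = D_i phi - sum_k (D_i xi^k) u_k,
   phi^ij = D_j phi^i - sum_k (D_j xi^k) u_ik. *)
Definition phi1 (v : vfield) (i : 'I_n) (z : jet1) : R :=
  totalD0 i (phi v) z - \sum_(k < n) totalD0 i (xi v k) z * z.2 0 k.

Definition phi2 (v : vfield) (i j : 'I_n) (z : jet2) : R :=
  totalD1 j (phi1 v i) z - \sum_(k < n) totalD0 j (xi v k) z.1 * z.2 i k.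

Definition pr2 (v : vfield) (z : jet2) : jet2 :=
  (v z.1.1, \row_i phi1 v i z.1, \matrix_(i, j) phi2 v i j z).

(* A vector field acts on a function by differentiating it along the field. *)
Definition infinitesimal_symmetry (O : set base) (Delta : jet2 -> R)
    (v : vfield) : Prop :=
  smooth_vfield O v /\
  forall z : jet2, O z.1.1 -> z.2^T = z.2 -> Delta z = 0 ->
    'D_(pr2 v z) Delta z = 0.

(* The symmetries with phi = lambda(x) u + mu(x) and mu = 0. *)
Definition linear_symmetries (O : set base) (Delta : jet2 -> R) : set vfield :=
  [set v | infinitesimal_symmetry O Delta v /\
    exists lambda : 'rV[R]_n -> R,
      forall p : base, O p -> phi v p = lambda p.1 * p.2].

End Symmetries.

(* Independent variables (x, y, t). *)
Section AffineEquation.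
Variable R : realType.

Definition ix : 'I_3 := @Ordinal 3 0 isT.
Definition iy : 'I_3 := @Ordinal 3 1 isT.
Definition it : 'I_3 := @Ordinal 3 2 isT.

Definition quadrant : set (base R 3) :=
  [set p : base R 3 | 0 < p.1 0 ix /\ 0 < p.1 0 iy].

Definition Delta (a b d e : R) (z : jet2 R 3) : R :=
  let x := z.1.1.1 0 ix in
  let y := z.1.1.1 0 iy in
  let p := z.1.2 in
  let h := z.2 in
  (a - b * x) * p 0 ix + (d - e * y) * p 0 iy
  + x / 2%:R * h ix ix + y / 2%:R * h iy iy + p 0 it.

Definition L (a b d e : R) : set (vfield R 3) :=
  linear_symmetries quadrant (Delta a b d e).

Definition L_bracket : vfield R 3 -> vfield R 3 -> vfield R 3 :=
  vbracket quadrant.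

(* cx d/dx + cy d/dy + ct d/dt + cu d/du, the coefficients being given as
   functions of x, y, t and u. *)
Definition mkfield (c : R -> R -> R -> R -> R * R * R * R) : vfield R 3 :=
  on_domain quadrant (fun p : base R 3 =>
    let: (cx, cy, ct, cu) := c (p.1 0 ix) (p.1 0 iy) (p.1 0 it) p.2 in
    (\row_(i < 3) nth 0 [:: cx; cy; ct] i, cu)).

Definition v1 (a : R) : vfield R 3 := mkfield (fun x y t u =>
  (2%:R * t * x, 2%:R * t * y, t ^+ 2,
   (2%:R * (x + y) - 2%:R * (a + 4%:R^-1) * t) * u)).
Definition v2 : vfield R 3 := mkfield (fun x y t u => (x, y, t, 0)).
Definition v3 : vfield R 3 := mkfield (fun x y t u => (0, 0, 1, 0)).
Definition v4 : vfield R 3 := mkfield (fun x y t u =>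
  (0, t * Num.sqrt y, 0, 2%:R * Num.sqrt y * u)).
Definition v5 : vfield R 3 := mkfield (fun x y t u => (0, Num.sqrt y, 0, 0)).
Definition v6 : vfield R 3 := mkfield (fun x y t u => (0, 0, 0, u)).

End AffineEquation.

(* u_t = - u_qq for u = u(t, q), on the whole plane. *)
Section HeatEquation.
Variable R : realType.

Definition heat_t : 'I_2 := @Ordinal 2 0 isT.
Definition heat_q : 'I_2 := @Ordinal 2 1 isT.

Definition heat_Delta (z : jet2 R 2) : R :=
  z.1.2 0 heat_t + z.2 heat_q heat_q.

Definition H00 : set (vfield R 2) := linear_symmetries setT heat_Delta.

Definition H00_bracket : vfield R 2 -> vfield R 2 -> vfield R 2 :=
  vbracket setT.

End HeatEquation.

(* Main.v *)
(** A field with [phi = lambda u] is a symmetry iff the coefficients of the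
    jet variables in the prolonged equation vanish. The mixed second derivatives,
    which do not occur in the equation, force [tau = tau(t)] and make xi and eta
    independent of u. What remains is
      xi - 2 x xi_x + x tau' = 0,   eta - 2 y eta_y + y tau' = 0,
      x eta_x + y xi_y = 0,
      x lambda_x = A xi - a tau',   y lambda_y = A eta - d tau',   A lambda = 0
    with [A = dt + a dx + d dy + (x/2) dxx + (y/2) dyy]. With [d = 1/4] the first
    equation gives xi = x tau' + sqrt x P(y, t), the fourth then lambda as a function of
    x, and the terms in x^(-3/2) of [A lambda = 0] say that
    (a - 1/4) (a - 3/4) P = 0. With P = 0 the rest is integrated directly:
    tau''' = 0, eta = y tau' + sqrt y G(t) with G'' = 0 and
    lambda = tau'' (x + y) + 2 G' sqrt y - (a + 1/4) tau' + constant.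
    The heat equation is treated in the same way. *)

(* In w = sqrt x the x-part a dx + (x/2) dxx of the operator is 1/8 of dww + ((4 a - 1) / w) dw.
   Conjugation by a power of w turns this into dww minus a multiple of (a - 1/4) (a - 3/4) / w^2.
   Translations and boosts in w, which is what P encodes, exist only without this inverse-square
   potential. For y the value d = 1/4 gives exactly 1/8 of the second derivative in sqrt y, and the
   corresponding translation and boost are v5 and v4. The obstacle is that P and the integration
   constant of lambda still depend on (y, t), so the terms of A lambda = 0 cannot be separated at
   once. A finite difference in sqrt x, which commutes with the y- and t-derivatives, isolates the
   decisive one. Each of the two symmetry algebras is the image of R^6 under a linear injection
   carrying the bracket of M to that of vector fields. The Lie algebra axioms and the isomorphisms
   are then read off in coordinates. *)
Require Import Defs.
From HB Require Import structures.
From mathcomp Require Import all_boot all_order all_algebra.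
From mathcomp Require Import all_classical all_reals all_analysis.
From mathcomp Require Import ring lra.

Set Implicit Arguments.
Unset Strict Implicit.
Unset Printing Implicit Defensive.

Import Order.TTheory GRing.Theory Num.Theory.
Import numFieldNormedType.Exports.

Local Open Scope classical_set_scope.
Local Open Scope ring_scope.

(** * Directional derivatives *)

Section Calculus.
Variable R : realType.
Implicit Types U V W : normedModType R.

(** Directional derivatives on products of vector spaces become derivatives of functions of one real
    variable, and functions that agree along a line have the same derivative there. *)
Lemma derive_line V W (f : V -> W) v a :
  'D_v f a = 'D_1 (fun h : R => f (h *: v + a)) 0.
Proof.
rewrite /derive; set g1 := fun h => h^-1 *: _; set g2 := fun h => h^-1 *: _.
suff -> : g1 = g2 by [].
by apply/funext => h; rewrite /g1 /g2 /= addr0 scale0r add0r [_%:A]mulr1.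
Qed.

Lemma is_derive_line V W (f : V -> W) v a df :
  is_derive a v f df <-> is_derive (0 : R) 1 (fun h : R => f (h *: v + a)) df.
Proof.
split=> -[h1 h2]; apply: DeriveDef.
- exact: (derivable1P _ _ _).1 h1.
- by rewrite -derive_line.
- exact: (derivable1P _ _ _).2 h1.
- by rewrite derive_line.
Qed.

Lemma is_derive_line_at V W (f : V -> W) v a (s : R) df :
  is_derive (s *: v + a) v f df <->
  is_derive s 1 (fun h : R => f (h *: v + a)) df.
Proof.
split=> /is_derive_line H; apply/is_derive_line; move: H;
congr (is_derive _ _ _ _); apply/funext => h;
by rewrite addrA -scalerDl [_ *: 1]mulr1.
Qed.

(* The library states these rules for the operations of the ring of functions;
   the pointwise forms unify with the derivatives computed below. *)
Lemma is_derive_add V W (f g : V -> W) p e df dg : is_derive p e f df ->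
  is_derive p e g dg -> is_derive p e (fun q => f q + g q) (df + dg).
Proof. exact: is_deriveD. Qed.

Lemma is_derive_opp V W (f : V -> W) p e df : is_derive p e f df ->
  is_derive p e (fun q => - f q) (- df).
Proof. exact: is_deriveN. Qed.

Lemma is_derive_sub V W (f g : V -> W) p e df dg : is_derive p e f df ->
  is_derive p e g dg -> is_derive p e (fun q => f q - g q) (df - dg).
Proof. exact: is_deriveB. Qed.

Lemma is_derive_mul V (f g : V -> R) p e df dg : is_derive p e f df ->
  is_derive p e g dg ->
  is_derive p e (fun q => f q * g q) (df * g p + f p * dg).
Proof.
move=> h1 h2; apply: (is_derive_eq (is_deriveM h1 h2)).
by rewrite addrC /GRing.scale /= mulrC.
Qed.

Lemma is_derive_const V W (w : W) (p e : V) : is_derive p e (fun=> w) 0.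
Proof. exact: is_derive_cst. Qed.

Lemma is_derive_big V W n (f : 'I_n -> V -> W) p e df :
  (forall i, is_derive p e (f i) (df i)) ->
  is_derive p e (fun q => \sum_i f i q) (\sum_i df i).
Proof.
move=> h; have := is_derive_sum h; congr (is_derive _ _ _ _).
by apply/funext => q; rewrite fct_sumE.
Qed.

Lemma is_derive_pow V (f : V -> R) n p e df : is_derive p e f df ->
  is_derive p e (fun q => f q ^+ n) (n%:R * f p ^+ n.-1 * df).
Proof.
move=> h; have := is_deriveX n h; congr (is_derive _ _ _ _).
by apply/funext => q; rewrite exprfctE.
Qed.

Lemma is_derive_comp V (f : V -> R) (g : R -> R) p e df dg :
  is_derive p e f df -> is_derive (f p) 1 g dg ->
  is_derive p e (fun q => g (f q)) (dg * df).
Proof.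
move=> /is_derive_line h1 h2; apply/is_derive_line.
apply: (@is_derive1_comp _ g (fun h : R => f (h *: e + p))) => //.
by rewrite scale0r add0r.
Qed.

Lemma is_derive_scalel V W (f : V -> R) (w : W) p e df : is_derive p e f df ->
  is_derive p e (fun q => f q *: w) (df *: w).
Proof.
move=> [h1 h2].
have H : (fun h : R => h^-1 *: (f (h *: e + p) *: w - f p *: w))
    @ 0^' --> df *: w.
  have -> : (fun h : R => h^-1 *: (f (h *: e + p) *: w - f p *: w)) =
     (fun h : R => (h^-1 *: (f (h *: e + p) - f p)) *: w).
    by apply/funext => h; rewrite -scalerBl scalerA.
  apply: cvgZr_tmp; rewrite -h2; exact: h1.
apply: DeriveDef; first by apply/cvg_ex; exists (df *: w).
exact: cvg_lim.
Qed.

Lemma is_derive_linear V W (l : V -> W) p e :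
  (forall (c : R) x y, l (c *: x + y) = c *: l x + l y) ->
  is_derive p e l (l e).
Proof.
move=> hl; apply/is_derive_line.
have -> : (fun h : R => l (h *: e + p)) = (fun h : R => h *: l e + l p).
  by apply/funext => h; rewrite hl.
have h := is_derive_scalel (l e) (is_derive_id (0 : R) 1).
apply: (is_derive_eq (is_derive_add h (is_derive_const (l p) (0 : R) 1))).
by rewrite scale1r addr0.
Qed.

Lemma is_derive_clinear U V W (l : V -> W) (f : U -> V) p e df :
  (forall (c : R) x y, l (c *: x + y) = c *: l x + l y) -> continuous l ->
  is_derive p e f df -> is_derive p e (fun q => l (f q)) (l df).
Proof.
move=> hl cl [h1 h2].
have l0 : l 0 = 0 by have := hl (-1) 0 0; rewrite scaler0 addr0 scaleN1r addNr.
have lZ c x : l (c *: x) = c *: l x by rewrite -[c *: x]addr0 hl l0 addr0.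
have lB x y : l (x - y) = l x - l y.
  by rewrite -[in LHS]scaleN1r addrC hl scaleN1r addrC.
have H : (fun h : R => h^-1 *: (l (f (h *: e + p)) - l (f p)))
    @ 0^' --> l df.
  have -> : (fun h : R => h^-1 *: (l (f (h *: e + p)) - l (f p))) =
     l \o (fun h : R => h^-1 *: (f (h *: e + p) - f p)).
    by apply/funext => h /=; rewrite lZ lB.
  have h3 : (fun h : R => h^-1 *: (f (h *: e + p) - f p)) @ 0^' --> df.
    by rewrite -h2; exact: h1.
  exact: (cvg_comp _ _ h3 (cl df)).
apply: DeriveDef; first by apply/cvg_ex; exists (l df).
exact: cvg_lim.
Qed.

Lemma is_derive_unique V W (f : V -> W) p e d d' :
  is_derive p e f d -> is_derive p e f d' -> d = d'.
Proof. by move=> [_ <-] [_ <-]. Qed.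

Lemma is_derive_near V W (f g : V -> W) (O : set V) p e d :
  open O -> O p -> (forall q, O q -> f q = g q) ->
  is_derive p e f d -> is_derive p e g d.
Proof.
move=> oO Op fg; apply: near_eq_is_derive.
by near=> q; apply: fg; near: q; exact: open_nbhs_nbhs.
Unshelve. all: by end_near. Qed.

Lemma derive_near V W (f g : V -> W) (O : set V) p e :
  open O -> O p -> (forall q, O q -> f q = g q) -> 'D_e f p = 'D_e g p.
Proof.
move=> oO Op fg; apply: near_eq_derive.
by near=> q; apply: fg; near: q; exact: open_nbhs_nbhs.
Unshelve. all: by end_near. Qed.

Lemma is_derive_pos (f g : R -> R) (x d : R) : 0 < x ->
  (forall s : R, 0 < s -> f s = g s) -> is_derive x 1 f d -> is_derive x 1 g d.
Proof.
move=> x0 fg; apply: (@is_derive_near _ _ f g [set s | 0 < s]) => //; exact: open_gt.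
Qed.

(** Mean value theorem on segments inside the half-line. The values at s <= 0 are arbitrary, so the
    version for functions on the whole line does not apply. *)
Lemma is_derive_0_is_cst_pos (f : R -> R) :
  (forall s : R, 0 < s -> is_derive s 1 f 0) ->
  forall x y : R, 0 < x -> 0 < y -> f x = f y.
Proof.
move=> df.
suff H (x y : R) : 0 < x -> x < y -> f x = f y.
  move=> x y x0 y0; case: (ltgtP x y) => [xy|yx|->//]; first exact: H.
  by apply/esym/H.
move=> x0 xy.
have := @MVT_segment _ f (fun=> 0) _ _ (ltW xy).
case=> [z|z|c _].
- by rewrite in_itv => /andP[xz _]; apply: df; apply: lt_trans xz.
- apply: derivable_within_continuous => {}z; rewrite in_itv /= => /andP[xz _].
  by have [] := df z (lt_le_trans x0 xz).
- by rewrite mul0r => /eqP; rewrite subr_eq0 => /eqP.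
Qed.

Lemma is_derive_sqrt (x : R) : 0 < x ->
  is_derive x 1 Num.sqrt (2^-1 * (Num.sqrt x)^-1).
Proof. by move=> x0; rewrite -invfM; exact: is_derive1_sqrt. Qed.

Lemma is_derive_sqrtV (x : R) : 0 < x ->
  is_derive x 1 (fun s => (Num.sqrt s)^-1) (- 2^-1 * (Num.sqrt x)^-1 ^+ 3).
Proof.
move=> x0; have s0 : Num.sqrt x != 0 by rewrite gt_eqF // sqrtr_gt0.
apply: is_derive_eq.
  by apply: is_deriveV => //; exact: is_derive_sqrt.
rewrite /GRing.scale /=; field.
by rewrite s0.
Qed.

End Calculus.

(* [apply:] would first look for an [is_derive] instance, which is slow. *)
Ltac is_derive_step :=
  first [ exact: is_derive_const
        | notypeclasses refine (is_derive_add _ _)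
        | notypeclasses refine (is_derive_sub _ _)
        | notypeclasses refine (is_derive_mul _ _)
        | notypeclasses refine (is_derive_opp _)
        | notypeclasses refine (is_derive_pow _ _) ].

(** Leaves the value of the derivative open: the rules synthesize it, and a second goal, usually for
    [ring] or [field], identifies it with the expected expression. *)
Ltac is_derive_calc := notypeclasses refine (is_derive_eq _ _).

(** * Smooth functions *)

Section SmoothOn.
Variable R : realType.
Implicit Types E F G : normedModType R.

(** The last direction of the list is the first one differentiated; peeling it off shows that
    derivatives of smooth functions are smooth. *)
Lemma iter_derive_rcons E F (s : seq E) e (f : E -> F) :
  iter_derive (rcons s e) f = iter_derive s ('D_e f).
Proof. by elim: s => [//|e' s ihs] /=; rewrite ihs. Qed.

Lemma smooth_on_derive E F (O : set E) (f : E -> F) e :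
  smooth_on O f -> smooth_on O ('D_e f).
Proof. by move=> sf s p Op; rewrite -iter_derive_rcons; exact: sf. Qed.

Lemma smooth_on_is_derive E F (O : set E) (f : E -> F) p e :
  smooth_on O f -> O p -> is_derive p e f ('D_e f p).
Proof. by move=> sf Op; apply: DeriveDef => //; have [_] := sf [::] p Op. Qed.

(** Coinduction: a class of functions continuous on [O] and closed under directional derivatives
    consists of smooth functions. The derivative only has to agree with a member of [C] on [O],
    which is enough because [O] is open. *)
Lemma smooth_on_coind E F (O : set E) (C : set (E -> F)) : open O ->
  (forall f p, C f -> O p -> {for p, continuous f}) ->
  (forall f e, C f -> exists2 g, C g & forall p, O p -> is_derive p e f (g p)) ->
  forall f, C f -> smooth_on O f.
Proof.
move=> oO Cc Cd f Cf.
have H (s : seq E) : exists2 g, C g & forall p, O p -> g p = iter_derive s f p.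
  elim: s => [|e s [g Cg gE]] /=; first by exists f.
  have [g' Cg' g'E] := Cd g e Cg; exists g' => // p Op.
  rewrite -(@derive_near _ _ _ g _ O) //.
  by have [_ ->] := g'E p Op.
move=> s p Op; have [g Cg gE] := H s.
have ngE : \near p, g p = iter_derive s f p.
  by near=> q; apply: gE; near: q; exact: open_nbhs_nbhs.
split.
  suff : iter_derive s f @ p --> iter_derive s f p by [].
  rewrite -(gE _ Op).
  apply: cvg_trans (Cc _ _ Cg Op); apply: near_eq_cvg.
  by near=> q; rewrite (near ngE).
move=> e; have [g' Cg' g'E] := Cd g e Cg.
have [h _] := g'E p Op; exact: near_eq_derivable h.
Unshelve. all: by end_near. Qed.

(** Here [j] is affine with linear part [J]. The class of all l (D^s v (j q)) is stable, since
    differentiating along [e] only prepends [J e] to [s]. This covers both components of a field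
    ([j] the identity) and restrictions to a fixed value of u. *)
Lemma smooth_on_slice E F E' G (O : set E) (Q : set E') (v : E -> F)
    (l : F -> G) (j : E' -> E) (J : E' -> E) :
  open Q -> (forall (c : R) x y, l (c *: x + y) = c *: l x + l y) ->
  continuous l -> continuous j ->
  (forall (h : R) e q, j (h *: e + q) = h *: J e + j q) ->
  (forall q, Q q -> O (j q)) ->
  smooth_on O v -> smooth_on Q (fun q => l (v (j q))).
Proof.
move=> oQ hl cl cj hj QO sv.
pose C : set (E' -> G) := [set f | exists s : seq E,
  f = (fun q => l (iter_derive s v (j q)))].
apply: (@smooth_on_coind _ _ Q C) => //; last by exists [::].
  move=> f p [s ->] Qp; have [cv _] := sv s _ (QO _ Qp).
  apply: (@continuous_comp _ _ _ (fun q => iter_derive s v (j q))); last exact: cl.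
  exact: (@continuous_comp _ _ _ j (iter_derive s v) p (cj p) cv).
move=> f e [s ->]; exists (fun q => l (iter_derive (J e :: s) v (j q))).
  by exists (J e :: s).
move=> p Qp; apply: is_derive_clinear => //=.
have [_ dv] := sv s _ (QO _ Qp).
apply/is_derive_line.
have -> : (fun h : R => iter_derive s v (j (h *: e + p))) =
  (fun h : R => iter_derive s v (h *: J e + j p)).
  by apply/funext => h; rewrite hj.
by apply: (is_derive_line _ _ _ _).1; apply: DeriveDef.
Qed.

End SmoothOn.

(** * Prolongation *)

Section Prolongation.
Variables (R : realType) (n : nat).
Implicit Types (v : vfield R n) (F : 'rV[R]_n -> R) (Q : set 'rV[R]_n).

Lemma derive_dx0_fst F i (p : base R n) :
  'D_(dx0 R i) (fun q : base R n => F q.1) p = 'D_(delta_mx 0 i) F p.1.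
Proof. by rewrite derive_line [RHS]derive_line. Qed.

Lemma derive_du0_fst F (p : base R n) : 'D_(du0 R n) (fun q : base R n => F q.1) p = 0.
Proof.
rewrite derive_line; apply: derive_val.
have -> : (fun h : R => F (h *: du0 R n + p).1) = fun=> F p.1.
  by apply/funext => h; rewrite /= scaler0 add0r.
exact: is_derive_const.
Qed.

Lemma is_derive_jet_fst (f : base R n -> R) (e : base R n) (z : jet1 R n) d :
  is_derive z.1 e f d ->
  is_derive z ((e, 0) : jet1 R n) (fun y : jet1 R n => f y.1) d.
Proof.
move=> h; apply: (is_derive_line _ _ _ _).2.
exact: ((is_derive_line _ _ _ _).1 h).
Qed.

Lemma is_derive_jet_dp (f : base R n -> R) j (z : jet1 R n) :
  is_derive z (dp1 R j) (fun y : jet1 R n => f y.1) 0.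
Proof.
apply: (is_derive_line _ _ _ _).2.
have -> : (fun h : R => f (h *: dp1 R j + z).1) = fun=> f z.1.
  by apply/funext => h; rewrite /= scaler0 add0r.
exact: is_derive_const.
Qed.

Lemma is_derive_jet_p k (e z : jet1 R n) :
  is_derive z e (fun y : jet1 R n => y.2 0 k) (e.2 0 k).
Proof.
by apply: (@is_derive_linear _ _ _ (fun y : jet1 R n => y.2 0 k)) => c x y;
  rewrite !mxE.
Qed.

(** This is the factor of u_ij in the total derivative D_i phi^i, through which second-order jet
    variables enter the prolongation. *)
Lemma derive_dp1_phi1 v i j z : 'D_(dp1 R j) (phi1 v i) z =
  (i == j)%:R *
    ('D_(du0 R n) (phi v) z.1
     - \sum_k 'D_(du0 R n) (xi v k) z.1 * z.2 0 k)
  - totalD0 i (xi v j) z.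
Proof.
apply: derive_val.
apply: (@is_derive_eq _ _ _ _ _ _ _
  (0 + (((dp1 R j).2 0 i) * 'D_(du0 R n) (phi v) z.1 + z.2 0 i * 0)
   - \sum_k ((0 + ((dp1 R j).2 0 i * 'D_(du0 R n) (xi v k) z.1 + z.2 0 i * 0))
              * z.2 0 k + totalD0 i (xi v k) z * (dp1 R j).2 0 k))).
  rewrite /phi1 /totalD0.
  apply: is_derive_sub.
    apply: is_derive_add; first exact: (is_derive_jet_dp ('D_(dx0 R i) (phi v))).
    apply: is_derive_mul; first exact: is_derive_jet_p.
    exact: (is_derive_jet_dp ('D_(du0 R n) (phi v))).
  apply: is_derive_big => k; apply: is_derive_mul; last exact: is_derive_jet_p.
  apply: is_derive_add; first exact: (is_derive_jet_dp ('D_(dx0 R i) (xi v k))).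
  apply: is_derive_mul; first exact: is_derive_jet_p.
  exact: (is_derive_jet_dp ('D_(du0 R n) (xi v k))).
rewrite /= mxE eqxx /= mulr0 addr0 add0r mulrBr -addrA; congr (_ + _).
rewrite -opprD; congr (- _).
rewrite big_split /= mulr_sumr; congr (_ + _).
  by apply: eq_bigr => k _; rewrite addr0 add0r mulrA.
rewrite (bigD1 j) //= mxE !eqxx mulr1 big1 ?addr0 // => k kj.
by rewrite mxE (negPf kj) andbF mulr0.
Qed.

(** Both equations contain pure second derivatives only, so the diagonal suffices. The sum of the
    (D_i xi^k) u_ik arises once from the prolongation formula and once from differentiating phi^i in
    the p_j, whence the factor 2. *)
Lemma phi2_diag v i z : phi2 v i i z =
  'D_(dx1 R i) (phi1 v i) z.1 + z.1.2 0 i * 'D_(du1 R n) (phi1 v i) z.1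
  + z.2 i i * ('D_(du0 R n) (phi v) z.1.1
     - \sum_k 'D_(du0 R n) (xi v k) z.1.1 * z.1.2 0 k)
  - 2%:R * \sum_k totalD0 i (xi v k) z.1 * z.2 i k.
Proof.
rewrite /phi2 /totalD1.
under [X in _ + X - _]eq_bigr => j _ do rewrite derive_dp1_phi1 mulrBr.
rewrite big_split /= [X in _ + (X + _)](bigD1 i) //= eqxx mul1r.
rewrite [X in _ + (_ + X + _)]big1; last first.
  by move=> j /negPf ji; rewrite eq_sym ji mul0r mulr0.
rewrite sumrN.
under [X in _ + (_ - X)]eq_bigr => j _ do rewrite mulrC.
set a := 'D_(dx1 R i) _ _ + _; set b := z.2 i i * _; set c := \sum_k _.
ring.
Qed.

Variables (Q : set 'rV[R]_n) (F : 'I_n -> 'rV[R]_n -> R) (L : 'rV[R]_n -> R).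
Variable v : vfield R n.
Hypotheses (oQ : open Q) (sF : forall k, smooth_on Q (F k)) (sL : smooth_on Q L).
Hypothesis vE : forall p : base R n, Q p.1 -> v p = (\row_k F k p.1, L p.1 * p.2).

Let open_base : open [set p : base R n | Q p.1].
Proof. by apply: (open_comp (f := fst)) => // p _; exact: cvg_fst. Qed.

Let open_jet1 : open [set z : jet1 R n | Q z.1.1].
Proof.
apply: (open_comp (f := fst)) open_base => p _; exact: cvg_fst.
Qed.

Lemma xi_red k (p : base R n) : Q p.1 -> xi v k p = F k p.1.
Proof. by move=> Qp; rewrite /xi vE // mxE. Qed.

Lemma phi_red (p : base R n) : Q p.1 -> phi v p = L p.1 * p.2.
Proof. by move=> Qp; rewrite /phi vE. Qed.

Lemma derive_xi_red k e (p : base R n) : Q p.1 ->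
  'D_e (xi v k) p = 'D_e (fun q : base R n => F k q.1) p.
Proof.
by move=> Qp; apply: (@derive_near _ _ _ _ _ _ _ _ open_base) => // q; exact: xi_red.
Qed.

Lemma derive_phi_red e (p : base R n) : Q p.1 ->
  'D_e (phi v) p = 'D_e (fun q : base R n => L q.1 * q.2) p.
Proof.
by move=> Qp; apply: (@derive_near _ _ _ _ _ _ _ _ open_base) => // q; exact: phi_red.
Qed.

Lemma is_derive_dx0_fst (G : 'rV[R]_n -> R) i (p : base R n) : smooth_on Q G -> Q p.1 ->
  is_derive p (dx0 R i) (fun q : base R n => G q.1) ('D_(delta_mx 0 i) G p.1).
Proof.
move=> sG Qp; apply: (is_derive_line _ _ _ _).2.
exact: ((is_derive_line _ _ _ _).1 (smooth_on_is_derive _ sG Qp)).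
Qed.

Lemma is_derive_du0_fst (G : 'rV[R]_n -> R) (p : base R n) :
  is_derive p (du0 R n) (fun q : base R n => G q.1) (0 : R).
Proof.
apply: (is_derive_line _ _ _ _).2.
have -> : (fun h : R => G (h *: du0 R n + p).1) = fun=> G p.1.
  by apply/funext => h; rewrite /= scaler0 add0r.
exact: is_derive_const.
Qed.

Lemma is_derive_base_u (e p : base R n) :
  is_derive p e (fun q : base R n => q.2) e.2.
Proof. exact: (@is_derive_linear _ _ _ (fun q : base R n => q.2)). Qed.

Lemma derive_dx0_phi i (p : base R n) : Q p.1 ->
  'D_(dx0 R i) (phi v) p = 'D_(delta_mx 0 i) L p.1 * p.2.
Proof.
move=> Qp; rewrite derive_phi_red //; apply: derive_val.
is_derive_calc.
  apply: is_derive_mul; first exact: (is_derive_dx0_fst _ sL Qp).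
  exact: is_derive_base_u.
by rewrite mulr0 addr0.
Qed.

Lemma derive_du0_phi (p : base R n) : Q p.1 -> 'D_(du0 R n) (phi v) p = L p.1.
Proof.
move=> Qp; rewrite derive_phi_red //; apply: derive_val.
is_derive_calc.
  apply: is_derive_mul; first exact: (is_derive_du0_fst L _).
  exact: is_derive_base_u.
by rewrite mul0r add0r mulr1.
Qed.

Lemma totalD0_xi i k (z : jet1 R n) : Q z.1.1 ->
  totalD0 i (xi v k) z = 'D_(delta_mx 0 i) (F k) z.1.1.
Proof.
move=> Qz; rewrite /totalD0 !derive_xi_red // derive_dx0_fst derive_du0_fst.
by rewrite mulr0 addr0.
Qed.

Lemma phi1_red i (z : jet1 R n) : Q z.1.1 -> phi1 v i z =
  'D_(delta_mx 0 i) L z.1.1 * z.1.2 + z.2 0 i * L z.1.1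
  - \sum_k 'D_(delta_mx 0 i) (F k) z.1.1 * z.2 0 k.
Proof.
move=> Qz; rewrite /phi1 {1}/totalD0 derive_dx0_phi // derive_du0_phi //.
by under eq_bigr do rewrite totalD0_xi //.
Qed.

(** With xi free of u and phi = L u all terms quadratic in the first derivatives disappear, which
    makes the symmetry condition linear in the jet variables apart from the equation itself. *)
Lemma phi2_red i (z : jet2 R n) : Q z.1.1.1 -> phi2 v i i z =
  'D_(delta_mx 0 i) ('D_(delta_mx 0 i) L) z.1.1.1 * z.1.1.2
  + 2%:R * z.1.2 0 i * 'D_(delta_mx 0 i) L z.1.1.1
  - \sum_k 'D_(delta_mx 0 i) ('D_(delta_mx 0 i) (F k)) z.1.1.1 * z.1.2 0 k
  + z.2 i i * L z.1.1.1
  - 2%:R * \sum_k 'D_(delta_mx 0 i) (F k) z.1.1.1 * z.2 i k.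
Proof.
move=> Qz; rewrite phi2_diag derive_du0_phi //.
rewrite [X in _ * (_ - X)]big1 => [|k _]; last first.
  by rewrite derive_xi_red // derive_du0_fst mul0r.
under [X in _ - _ * X]eq_bigr do rewrite totalD0_xi //.
rewrite subr0.
(* The reduced form of [phi1] holds on an open set of jets, so it may be differentiated. *)
have E (e : jet1 R n) : 'D_e (phi1 v i) z.1 = 'D_e (fun z : jet1 R n =>
  'D_(delta_mx 0 i) L z.1.1 * z.1.2 + z.2 0 i * L z.1.1
  - \sum_k 'D_(delta_mx 0 i) (F k) z.1.1 * z.2 0 k) z.1.
  by apply: (@derive_near _ _ _ _ _ _ _ _ open_jet1) => // y; exact: phi1_red.
rewrite !E {E}.
have -> : 'D_(dx1 R i) (fun z : jet1 R n =>
  'D_(delta_mx 0 i) L z.1.1 * z.1.2 + z.2 0 i * L z.1.1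
  - \sum_k 'D_(delta_mx 0 i) (F k) z.1.1 * z.2 0 k) z.1 =
  'D_(delta_mx 0 i) ('D_(delta_mx 0 i) L) z.1.1.1 * z.1.1.2 +
   z.1.2 0 i * 'D_(delta_mx 0 i) L z.1.1.1
  - \sum_k 'D_(delta_mx 0 i) ('D_(delta_mx 0 i) (F k)) z.1.1.1 * z.1.2 0 k.
  apply: derive_val.
  is_derive_calc.
    apply: is_derive_sub.
      apply: is_derive_add.
        apply: is_derive_mul.
          apply: (is_derive_jet_fst (f := fun y => 'D_(delta_mx 0 i) L y.1)).
          exact: (is_derive_dx0_fst _ (smooth_on_derive _ sL) Qz).
        apply: (is_derive_jet_fst (f := snd)); exact: is_derive_base_u.
      apply: is_derive_mul; first exact: is_derive_jet_p.
      apply: (is_derive_jet_fst (f := fun y => L y.1)).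
      exact: (is_derive_dx0_fst _ sL Qz).
    apply: is_derive_big => k; apply: is_derive_mul; last exact: is_derive_jet_p.
    apply: (is_derive_jet_fst (f := fun y => 'D_(delta_mx 0 i) (F k) y.1)).
    exact: (is_derive_dx0_fst _ (smooth_on_derive _ (sF k)) Qz).
  rewrite /= !mxE mulr0 addr0 mul0r add0r; congr (_ - _).
  by apply: eq_bigr => k _; rewrite mxE mulr0 addr0.
have -> : 'D_(du1 R n) (fun z : jet1 R n =>
  'D_(delta_mx 0 i) L z.1.1 * z.1.2 + z.2 0 i * L z.1.1
  - \sum_k 'D_(delta_mx 0 i) (F k) z.1.1 * z.2 0 k) z.1 =
  'D_(delta_mx 0 i) L z.1.1.1.
  apply: derive_val.
  is_derive_calc.
    apply: is_derive_sub.
      apply: is_derive_add.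
        apply: is_derive_mul.
          apply: (is_derive_jet_fst (f := fun y => 'D_(delta_mx 0 i) L y.1)).
          exact: (is_derive_du0_fst ('D_(delta_mx 0 i) L) _).
        apply: (is_derive_jet_fst (f := snd)); exact: is_derive_base_u.
      apply: is_derive_mul; first exact: is_derive_jet_p.
      apply: (is_derive_jet_fst (f := fun y => L y.1)).
      exact: (is_derive_du0_fst (L) _).
    apply: is_derive_big => k; apply: is_derive_mul; last exact: is_derive_jet_p.
    apply: (is_derive_jet_fst (f := fun y => 'D_(delta_mx 0 i) (F k) y.1)).
    exact: (is_derive_du0_fst ('D_(delta_mx 0 i) (F k)) _).
  rewrite /= !mxE mul0r mulr0 addr0 mul0r add0r mulr1.
  by rewrite big1 ?subr0 ?addr0 // => k _; rewrite mxE mul0r mulr0 addr0.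
ring.
Qed.

End Prolongation.

(** * Symmetries as functions of the independent variables *)

Section Reduction.
Variables (R : realType) (n : nat).
Implicit Types (v : vfield R n).

Lemma xi_linear k (c : R) (x y : base R n) :
  (c *: x + y).1 0 k = c *: x.1 0 k + y.1 0 k.
Proof. by rewrite !mxE. Qed.

Lemma xi_continuous (k : 'I_n) : continuous (fun p : base R n => p.1 0 k).
Proof.
move=> p; apply: (@continuous_comp _ _ _ fst (fun q : 'rV[R]_n => q 0 k)).
  exact: cvg_fst.
exact: coord_continuous.
Qed.

Lemma smooth_slice (O : set (base R n)) (Q : set 'rV[R]_n) v
    (l : base R n -> R) (u : R) :
  open Q -> (forall (c : R) x y, l (c *: x + y) = c *: l x + l y) ->
  continuous l -> (forall q, Q q -> O (q, u)) ->
  smooth_on O v -> smooth_on Q (fun q => l (v (q, u))).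
Proof.
move=> oQ hl cl QO sv.
apply: (@smooth_on_slice _ _ _ _ _ O Q v l (fun q => (q, u)) (fun e => (e, 0))) => //.
  move=> q; exact: (@cvg_pair _ _ _ (nbhs q) (nbhs q) (nbhs u) _ _ _ id (fun=> u)
    cvg_id (cvg_cst u)).
by move=> h e q; congr (_, _); rewrite /= scaler0 add0r.
Qed.

(** [O] is a cylinder over [Q], so each fibre is a whole u-line and a vanishing u-derivative makes
    xi constant on it. The given [lambda] carries no regularity; its smoothness comes from that of
    [v]. *)
Lemma symmetry_reduction (O : set (base R n)) (Q : set 'rV[R]_n) v :
  open Q -> (forall p, O p = Q p.1) -> smooth_vfield O v ->
  (exists lambda : 'rV[R]_n -> R, forall p, O p -> phi v p = lambda p.1 * p.2) ->
  (forall k p, O p -> 'D_(du0 R n) (xi v k) p = 0) ->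
  exists (F : 'I_n -> 'rV[R]_n -> R) (L : 'rV[R]_n -> R),
    [/\ forall k, smooth_on Q (F k), smooth_on Q L
      & forall p : base R n, Q p.1 -> v p = (\row_k F k p.1, L p.1 * p.2)].
Proof.
move=> oQ OQ [sv _] [lam lamE] Du.
(* The slice u = 0 serves for xi, where any u would do; the slice u = 1 reads [lambda] off from phi
   = lambda u. *)
exists (fun k q => xi v k (q, 0)), (fun q => phi v (q, 1)).
have sxi k : smooth_on O (xi v k).
  have oO : open O.
    have -> : O = [set p | Q p.1] by apply/funext => p; rewrite OQ.
    by apply: (open_comp (f := fst)) => // p _; exact: cvg_fst.
  apply: (@smooth_on_slice _ _ _ _ _ O O v (fun p : base R n => p.1 0 k)
    idfun idfun) => //.
  - exact: xi_linear.
  - exact: xi_continuous.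
  - by move=> q; exact: cvg_id.
split.
- move=> k; apply: (@smooth_slice O Q v (fun p : base R n => p.1 0 k)) => //.
  + exact: xi_linear.
  + exact: xi_continuous.
  + by move=> q; rewrite OQ.
- apply: (@smooth_slice O Q v snd) => //.
  + by move=> q; exact: cvg_snd.
  + by move=> q; rewrite OQ.
- move=> [q u] /= Qq.
  have -> : phi v (q, 1) = lam q by rewrite lamE ?OQ //= mulr1.
  rewrite [LHS]surjective_pairing; congr (_, _); last first.
    by rewrite -/(phi v (q, u)) lamE // OQ.
  apply/rowP => k; rewrite mxE -/(xi v k (q, u)).
  apply: (@is_derive_0_is_cst _ (fun s : R => xi v k (q, s))) => s.
  have Oqs : O (q, s) by rewrite OQ.
  have h := smooth_on_is_derive (du0 R n) (sxi k) Oqs.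
  rewrite Du // in h.
  have h' : is_derive (s *: du0 R n + (q, 0)) (du0 R n) (xi v k) 0.
    move: h; congr (is_derive _ _ _ _).
    by congr (_, _); rewrite /= ?scaler0 ?add0r // addr0 [_ *: _]mulr1.
  move: ((is_derive_line_at _ _ _ _ _).1 h'); congr (is_derive _ _ _ _).
  apply/funext => r; congr (xi v k _).
  by congr (_, _); rewrite /= ?scaler0 ?add0r // addr0 [_ *: _]mulr1.
Qed.

End Reduction.

(** * The determining system of the affine equation *)

Section DeterminingEquations.
Variables (R : realType) (a d : R).
Implicit Types (v : vfield R 3).

Lemma sum3 (f : 'I_3 -> R) : \sum_k f k = f ix + f iy + f it.
Proof.
rewrite !big_ord_recl big_ord0 addr0 addrA.
by congr (f _ + f _ + f _); apply: val_inj.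
Qed.

Lemma is_derive_jet2_x n k (e z : jet2 R n) :
  is_derive z e (fun y : jet2 R n => y.1.1.1 0 k) (e.1.1.1 0 k).
Proof.
by apply: (@is_derive_linear _ _ _ (fun y : jet2 R n => y.1.1.1 0 k)) => c x y;
  rewrite !mxE.
Qed.

Lemma is_derive_jet2_p n k (e z : jet2 R n) :
  is_derive z e (fun y : jet2 R n => y.1.2 0 k) (e.1.2 0 k).
Proof.
by apply: (@is_derive_linear _ _ _ (fun y : jet2 R n => y.1.2 0 k)) => c x y;
  rewrite !mxE.
Qed.

Lemma is_derive_jet2_h n j k (e z : jet2 R n) :
  is_derive z e (fun y : jet2 R n => y.2 j k) (e.2 j k).
Proof.
by apply: (@is_derive_linear _ _ _ (fun y : jet2 R n => y.2 j k)) => c x y;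
  rewrite !mxE.
Qed.

Lemma derive_Delta (w z : jet2 R 3) :
  'D_w (Delta a 0 d 0) z =
  a * w.1.2 0 ix + d * w.1.2 0 iy
  + w.1.1.1 0 ix / 2%:R * z.2 ix ix + z.1.1.1 0 ix / 2%:R * w.2 ix ix
  + w.1.1.1 0 iy / 2%:R * z.2 iy iy + z.1.1.1 0 iy / 2%:R * w.2 iy iy
  + w.1.2 0 it.
Proof.
apply: derive_val; rewrite /Delta.
is_derive_calc.
  by repeat first [exact: is_derive_jet2_x | exact: is_derive_jet2_p
    | exact: is_derive_jet2_h | is_derive_step].
rewrite /=; ring.
Qed.

Definition sym_pair (i j : 'I_3) : 'M[R]_3 := delta_mx i j + delta_mx j i.

Lemma sym_pair_tr i j : (sym_pair i j)^T = sym_pair i j.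
Proof. by rewrite /sym_pair linearD /= !trmx_delta addrC. Qed.

(* On symmetric jets with vanishing diagonal second derivatives the condition
   is affine in the mixed ones, which do not occur in Delta: their coefficients
   vanish. *)
Lemma mixed_coefficients v i j (p : base R 3) (P : 'rV[R]_3) : i != j ->
  (forall z : jet2 R 3, z.1.1 = p -> z.2^T = z.2 -> Delta a 0 d 0 z = 0 ->
     'D_(pr2 v z) (Delta a 0 d 0) z = 0) ->
  a * P 0 ix + d * P 0 iy + P 0 it = 0 ->
  p.1 0 ix * \sum_k totalD0 ix (xi v k) (p, P) * sym_pair i j ix k
  + p.1 0 iy * \sum_k totalD0 iy (xi v k) (p, P) * sym_pair i j iy k = 0.
Proof.
move=> ij sym P0.
have diag0 k : sym_pair i j k k = 0.
  rewrite !mxE; have [->|ki] := eqVneq k i.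
    by rewrite (negPf ij) addr0.
  by rewrite andbF addr0.
have D0 : Delta a 0 d 0 (p, P, 0) = 0.
  by rewrite /Delta /= !mxE -[RHS]P0; ring.
have D1 : Delta a 0 d 0 (p, P, sym_pair i j) = 0.
  by rewrite /Delta /= !diag0 -[RHS]P0; ring.
have := sym (p, P, 0) erefl (trmx0 _ _ _) D0.
have := sym (p, P, sym_pair i j) erefl (sym_pair_tr i j) D1.
rewrite !derive_Delta /= ![(\matrix_(_, _) _) _ _]mxE !phi2_diag /= !diag0.
rewrite ![(0 : 'M[R]_3) _ _]mxE.
have Z k : \sum_(l < 3) totalD0 k (xi v l) (p, P) * (0 : 'M[R]_3) k l = 0.
  by rewrite big1 // => l _; rewrite mxE mulr0.
rewrite !Z !mul0r.
move: (\sum_k totalD0 ix _ _ * _) (\sum_k totalD0 iy _ _ * _).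
move: ('D_(dx1 R ix) _ _ + _) ('D_(dx1 R iy) _ _ + _).
move: (a * phi1 _ _ _ + _) (phi1 v it _) (p.1 0 ix) (p.1 0 iy).
by move=> A B x y C D s t e1 e2; lra.
Qed.

Lemma ord3P (P : 'I_3 -> Prop) : P ix -> P iy -> P it -> forall k, P k.
Proof.
move=> hx hy ht [[|[|[|//]]] lt_k].
- by rewrite (_ : Ordinal _ = ix) //; exact: val_inj.
- by rewrite (_ : Ordinal _ = iy) //; exact: val_inj.
- by rewrite (_ : Ordinal _ = it) //; exact: val_inj.
Qed.

Lemma sum_sym_pair (f : 'I_3 -> R) i j k :
  \sum_l f l * sym_pair i j k l = (k == i)%:R * f j + (k == j)%:R * f i.
Proof.
rewrite /sym_pair; under eq_bigr do rewrite !mxE mulrDr.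
rewrite big_split /= (bigD1 j) //= big1 => [|l /negPf lj].
  rewrite (bigD1 i) //= big1 => [|l /negPf li].
    by rewrite !eqxx !andbT !addr0 ![f _ * _]mulrC.
  by rewrite li andbF mulr0.
by rewrite lj andbF mulr0.
Qed.

(** The coefficients of u_xt, u_yt and u_xy are affine in (u_x, u_y). Their constant terms give the
    x- and y-derivatives, their slopes the u-derivatives. *)
Lemma sym_first_order v (p : base R 3) : quadrant p ->
  (forall z : jet2 R 3, z.1.1 = p -> z.2^T = z.2 -> Delta a 0 d 0 z = 0 ->
     'D_(pr2 v z) (Delta a 0 d 0) z = 0) ->
  [/\ forall k, 'D_(du0 R 3) (xi v k) p = 0,
      'D_(dx0 R ix) (xi v it) p = 0, 'D_(dx0 R iy) (xi v it) p = 0 &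
      p.1 0 ix * 'D_(dx0 R ix) (xi v iy) p
      + p.1 0 iy * 'D_(dx0 R iy) (xi v ix) p = 0].
Proof.
move=> [x0 y0] sym.
(* When the pure second derivatives vanish the equation determines u_t, and u_x = r, u_y = s stay
   free. *)
pose P (r s : R) : 'rV[R]_3 := \row_k nth 0 [:: r; s; - (a * r + d * s)] k.
have Pt r s : a * P r s 0 ix + d * P r s 0 iy + P r s 0 it = 0.
  by rewrite !mxE /= subrr.
have Px r s : P r s 0 ix = r by rewrite mxE.
have Py r s : P r s 0 iy = s by rewrite mxE.
have E i j r s ij := @mixed_coefficients v i j p (P r s) ij sym (Pt r s).
have := E ix it 0 0 isT; have := E ix it 1 0 isT; have := E iy it 0 0 isT.
have := E iy it 0 1 isT; have := E ix iy 0 0 isT; have := E ix iy 1 0 isT.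
have := E ix iy 0 1 isT.
rewrite !sum_sym_pair /totalD0 ![(p, _).1]/= ![(p, _).2]/= !Px !Py.
have -> : (ix == iy) = false by []. have -> : (ix == it) = false by [].
have -> : (iy == it) = false by []. have -> : (iy == ix) = false by [].
rewrite !eqxx.
suff H : forall Xx Xy Xu Yx Yy Yu Tx Ty Tu x y : R, 0 < x -> 0 < y ->
  x * (1 * (Tx + 0 * Tu) + 0 * (Xx + 0 * Xu))
    + y * (0 * (Ty + 0 * Tu) + 0 * (Xy + 0 * Xu)) = 0 ->
  x * (1 * (Tx + 1 * Tu) + 0 * (Xx + 1 * Xu))
    + y * (0 * (Ty + 0 * Tu) + 0 * (Xy + 0 * Xu)) = 0 ->
  x * (0 * (Tx + 0 * Tu) + 0 * (Yx + 0 * Yu))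
    + y * (1 * (Ty + 0 * Tu) + 0 * (Yy + 0 * Yu)) = 0 ->
  x * (1 * (Yx + 0 * Yu) + 0 * (Xx + 0 * Xu))
    + y * (0 * (Yy + 0 * Yu) + 1 * (Xy + 0 * Xu)) = 0 ->
  x * (1 * (Yx + 1 * Yu) + 0 * (Xx + 1 * Xu))
    + y * (0 * (Yy + 0 * Yu) + 1 * (Xy + 0 * Xu)) = 0 ->
  x * (1 * (Yx + 0 * Yu) + 0 * (Xx + 0 * Xu))
    + y * (0 * (Yy + 1 * Yu) + 1 * (Xy + 1 * Xu)) = 0 ->
  [/\ Xu = 0, Yu = 0, Tu = 0, Tx = 0 & Ty = 0 /\ x * Yx + y * Xy = 0].
  move=> e1 e2 e3 e4 e5 e6 e7.
  have [hX hY hT hTx [hTy h]] := H _ _ _ _ _ _ _ _ _ _ _ x0 y0 e7 e6 e5 e3 e2 e1.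
  by split=> //; apply: ord3P.
move=> Xx Xy Xu Yx Yy Yu Tx Ty Tu x y {}x0 {}y0 {E sym Px Py Pt P}.
rewrite !mul0r !mul1r !addr0 !mulr0 !add0r !addr0.
move=> e1 e2 e3 e4 e5 e6.
have kx z : x * z = 0 -> z = 0.
  by move=> /eqP; rewrite mulf_eq0 gt_eqF //= => /eqP.
have ky z : y * z = 0 -> z = 0.
  by move=> /eqP; rewrite mulf_eq0 gt_eqF //= => /eqP.
have {}e1 := kx _ e1; have {}e2 := kx _ e2; have {}e3 := ky _ e3.
have hu : x * Yu = 0 by rewrite -[RHS]e5 -[LHS]addr0 -[X in _ + X]e4; ring.
have hv : y * Xu = 0 by rewrite -[RHS]e6 -[LHS]addr0 -[X in _ + X]e4; ring.
split=> //; [exact: ky|exact: kx|].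
by move: e2; rewrite e1 add0r.
Qed.

End DeterminingEquations.

Section DeterminingSystem.
Variables (R : realType) (a d : R).

Definition positive_xy : set 'rV[R]_3 := [set q | 0 < q 0 ix /\ 0 < q 0 iy].

Lemma open_positive_xy : open positive_xy.
Proof.
have h k : open [set q : 'rV[R]_3 | 0 < q 0 k].
  apply: (@open_comp _ _ (fun q : 'rV[R]_3 => q 0 k) [set s : R | 0 < s]).
    by move=> q _; exact: coord_continuous.
  exact: open_gt.
exact: (openI (h ix) (h iy)).
Qed.

Notation dx f := ('D_(delta_mx 0 ix) f).
Notation dy f := ('D_(delta_mx 0 iy) f).
Notation dt f := ('D_(delta_mx 0 it) f).

(** Each field is named after the jet variable whose coefficient it is, up to a constant factor,
    once u_t has been eliminated by the equation. *)
Record determining_eqs (F : 'I_3 -> 'rV[R]_3 -> R) (L : 'rV[R]_3 -> R)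
    (q : 'rV[R]_3) : Prop := DeterminingEqs {
  det_hxx : F ix q - 2%:R * q 0 ix * dx (F ix) q + q 0 ix * dt (F it) q = 0;
  det_hyy : F iy q - 2%:R * q 0 iy * dy (F iy) q + q 0 iy * dt (F it) q = 0;
  det_hxy : q 0 ix * dx (F iy) q + q 0 iy * dy (F ix) q = 0;
  det_px : q 0 ix * dx L q = dt (F ix) q + a * dx (F ix) q + d * dy (F ix) q
    + q 0 ix / 2%:R * dx (dx (F ix)) q + q 0 iy / 2%:R * dy (dy (F ix)) q
    - a * dt (F it) q;
  det_py : q 0 iy * dy L q = dt (F iy) q + a * dx (F iy) q + d * dy (F iy) q
    + q 0 ix / 2%:R * dx (dx (F iy)) q + q 0 iy / 2%:R * dy (dy (F iy)) q
    - d * dt (F it) q;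
  det_u : dt L q + a * dx L q + d * dy L q
    + q 0 ix / 2%:R * dx (dx L) q + q 0 iy / 2%:R * dy (dy L) q = 0 }.

Lemma symmetry_condition (F : 'I_3 -> 'rV[R]_3 -> R) (L : 'rV[R]_3 -> R)
    (v : vfield R 3) (z : jet2 R 3) :
  (forall k, smooth_on positive_xy (F k)) -> smooth_on positive_xy L ->
  (forall p : base R 3, positive_xy p.1 -> v p = (\row_k F k p.1, L p.1 * p.2)) ->
  positive_xy z.1.1.1 ->
  let q := z.1.1.1 in let u := z.1.1.2 in
  let p i := z.1.2 0 i in let h := z.2 in
  let phi1 k := 'D_(delta_mx 0 k) L q * u + p k * L q
    - ('D_(delta_mx 0 k) (F ix) q * p ix + 'D_(delta_mx 0 k) (F iy) q * p iy
       + 'D_(delta_mx 0 k) (F it) q * p it) in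
  let phi2 k := 'D_(delta_mx 0 k) ('D_(delta_mx 0 k) L) q * u
    + 2%:R * p k * 'D_(delta_mx 0 k) L q
    - ('D_(delta_mx 0 k) ('D_(delta_mx 0 k) (F ix)) q * p ix
       + 'D_(delta_mx 0 k) ('D_(delta_mx 0 k) (F iy)) q * p iy
       + 'D_(delta_mx 0 k) ('D_(delta_mx 0 k) (F it)) q * p it)
    + h k k * L q
    - 2%:R * ('D_(delta_mx 0 k) (F ix) q * h k ix
       + 'D_(delta_mx 0 k) (F iy) q * h k iy
       + 'D_(delta_mx 0 k) (F it) q * h k it) in
  'D_(pr2 v z) (Delta a 0 d 0) z =
    a * phi1 ix + d * phi1 iy
    + F ix q / 2%:R * h ix ix + q 0 ix / 2%:R * phi2 ix
    + F iy q / 2%:R * h iy iy + q 0 iy / 2%:R * phi2 iy + phi1 it.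
Proof.
move=> sF sL vE Qz /=; rewrite derive_Delta /= ![(\row__ _) _ _]mxE.
rewrite ![(\matrix_(_, _) _) _ _]mxE.
rewrite !(phi1_red open_positive_xy sL vE) //.
rewrite !(phi2_red open_positive_xy sF sL vE) //.
have vx k : (v z.1.1).1 0 k = F k z.1.1.1 by rewrite vE // mxE.
rewrite !vx [X in a * (_ - X)]sum3 [X in d * (_ - X)]sum3.
rewrite [X in _ + (_ - X) = _]sum3.
rewrite [X in z.1.1.1 0 ix / 2%:R * (_ - 2%:R * X)]sum3.
rewrite [X in z.1.1.1 0 ix / 2%:R * (_ - X + _ - _)]sum3.
rewrite [X in z.1.1.1 0 iy / 2%:R * (_ - 2%:R * X)]sum3.
by rewrite [X in z.1.1.1 0 iy / 2%:R * (_ - X + _ - _)]sum3.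
Qed.

(** Pure algebra: a linear form in the jet variables vanishes on the hyperplane given by the
    equation iff its coefficients do after elimination of u_t. The zeros stand for the x- and
    y-derivatives of tau. *)
Lemma determining_alg (x y X Y l lx ly lt lxx lyy Xx Xy Xt Xxx Xyy
    Yx Yy Yt Yxx Yyy Tt : R) :
  (forall u px py pt hxx hxy hxt hyy hyt : R,
    a * px + d * py + x / 2%:R * hxx + y / 2%:R * hyy + pt = 0 ->
    a * (lx * u + px * l - (Xx * px + Yx * py + 0 * pt))
    + d * (ly * u + py * l - (Xy * px + Yy * py + 0 * pt))
    + X / 2%:R * hxx
    + x / 2%:R * (lxx * u + 2%:R * px * lx - (Xxx * px + Yxx * py + 0 * pt)
       + hxx * l - 2%:R * (Xx * hxx + Yx * hxy + 0 * hxt))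
    + Y / 2%:R * hyy
    + y / 2%:R * (lyy * u + 2%:R * py * ly - (Xyy * px + Yyy * py + 0 * pt)
       + hyy * l - 2%:R * (Xy * hxy + Yy * hyy + 0 * hyt))
    + (lt * u + pt * l - (Xt * px + Yt * py + Tt * pt)) = 0) <->
  [/\ X - 2%:R * x * Xx + x * Tt = 0, Y - 2%:R * y * Yy + y * Tt = 0,
      x * Yx + y * Xy = 0,
      x * lx = Xt + a * Xx + d * Xy + x / 2%:R * Xxx + y / 2%:R * Xyy - a * Tt &
      y * ly = Yt + a * Yx + d * Yy + x / 2%:R * Yxx + y / 2%:R * Yyy - d * Tt
      /\ lt + a * lx + d * ly + x / 2%:R * lxx + y / 2%:R * lyy = 0].
Proof.
split=> [H|[e1 e2 e3 e4 [e5 e6]] u px py pt hxx hxy hxt hyy hyt].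
  (* Each test jet switches on one of u, u_x, u_y, u_xy, u_xx, u_yy and takes u_t from the
     equation. *)
  have h1 := H 1 0 0 0 0 0 0 0 0; have h2 := H 0 1 0 (- a) 0 0 0 0 0.
  have h3 := H 0 0 1 (- d) 0 0 0 0 0; have h4 := H 0 0 0 0 0 1 0 0 0.
  have h5 := H 0 0 0 (- (x / 2%:R)) 1 0 0 0 0.
  have h6 := H 0 0 0 (- (y / 2%:R)) 0 0 0 1 0.
  by split; first [lra | split; lra].
move=> e0.
have -> : pt = - (a * px + d * py + x / 2%:R * hxx + y / 2%:R * hyy).
  by rewrite -[LHS]addr0 -oppr0 -e0; ring.
set E := (X in X = 0).
have -> : E = u * (lt + a * lx + d * ly + x / 2%:R * lxx + y / 2%:R * lyy)
  + px * (x * lx - (Xt + a * Xx + d * Xy + x / 2%:R * Xxx + y / 2%:R * Xyy - a * Tt))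
  + py * (y * ly - (Yt + a * Yx + d * Yy + x / 2%:R * Yxx + y / 2%:R * Yyy - d * Tt))
  + hxx / 2%:R * (X - 2%:R * x * Xx + x * Tt)
  + hyy / 2%:R * (Y - 2%:R * y * Yy + y * Tt) - hxy * (x * Yx + y * Xy).
  by rewrite /E; field.
by rewrite e1 e2 e3 e4 e5 e6 !subrr !mulr0 !addr0 subr0.
Qed.

Section Reduced.
Variables (F : 'I_3 -> 'rV[R]_3 -> R) (L : 'rV[R]_3 -> R) (v : vfield R 3).
Variable q : 'rV[R]_3.
Hypotheses (sF : forall k, smooth_on positive_xy (F k)).
Hypothesis (sL : smooth_on positive_xy L).
Hypothesis vE : forall p : base R 3, positive_xy p.1 ->
  v p = (\row_k F k p.1, L p.1 * p.2).
Hypothesis Qq : positive_xy q.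
Hypotheses (Tx : dx (F it) q = 0) (Ty : dy (F it) q = 0).
Hypotheses (Txx : dx (dx (F it)) q = 0) (Tyy : dy (dy (F it)) q = 0).

Lemma determining_of_symmetry :
  (forall z : jet2 R 3, z.1.1.1 = q -> z.2^T = z.2 -> Delta a 0 d 0 z = 0 ->
     'D_(pr2 v z) (Delta a 0 d 0) z = 0) -> determining_eqs F L q.
Proof.
move=> sym.
suff /determining_alg[e1 e2 e3 e4 [e5 e6]] :
    forall u px py pt hxx hxy hxt hyy hyt : R,
    a * px + d * py + q 0 ix / 2%:R * hxx + q 0 iy / 2%:R * hyy + pt = 0 ->
    a * (dx L q * u + px * L q - (dx (F ix) q * px + dx (F iy) q * py + 0 * pt))
    + d * (dy L q * u + py * L q - (dy (F ix) q * px + dy (F iy) q * py + 0 * pt))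
    + F ix q / 2%:R * hxx
    + q 0 ix / 2%:R * (dx (dx L) q * u + 2%:R * px * dx L q
       - (dx (dx (F ix)) q * px + dx (dx (F iy)) q * py + 0 * pt)
       + hxx * L q - 2%:R * (dx (F ix) q * hxx + dx (F iy) q * hxy + 0 * hxt))
    + F iy q / 2%:R * hyy
    + q 0 iy / 2%:R * (dy (dy L) q * u + 2%:R * py * dy L q
       - (dy (dy (F ix)) q * px + dy (dy (F iy)) q * py + 0 * pt)
       + hyy * L q - 2%:R * (dy (F ix) q * hxy + dy (F iy) q * hyy + 0 * hyt))
    + (dt L q * u + pt * L q
       - (dt (F ix) q * px + dt (F iy) q * py + dt (F it) q * pt)) = 0.
  by split.
move=> u px py pt hxx hxy hxt hyy hyt e0.
pose P : 'rV[R]_3 := \row_k nth 0 [:: px; py; pt] k.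
(* The entry u_tt occurs in no term of the condition and is set to 0. *)
pose h : 'M[R]_3 := \matrix_(i, j) nth 0 (nth [::] [:: [:: hxx; hxy; hxt];
  [:: hxy; hyy; hyt]; [:: hxt; hyt; 0]] i) j.
pose z : jet2 R 3 := (((q, u), P), h).
have hT : h^T = h.
  by apply/matrixP; apply: ord3P; apply: ord3P; rewrite !mxE.
have Px : P 0 ix = px by rewrite mxE.
have Py : P 0 iy = py by rewrite mxE.
have Pt : P 0 it = pt by rewrite mxE.
have Hxx : h ix ix = hxx by rewrite mxE.
have Hxy : h ix iy = hxy by rewrite mxE.
have Hyx : h iy ix = hxy by rewrite mxE.
have Hxt : h ix it = hxt by rewrite mxE.
have Hyt : h iy it = hyt by rewrite mxE.
have Hyy : h iy iy = hyy by rewrite mxE.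
have Dz : Delta a 0 d 0 z = 0.
  by rewrite /Delta /= Px Py Pt Hxx Hyy -[RHS]e0; ring.
have := sym z erefl hT Dz.
rewrite (@symmetry_condition F L v z) //=.
by rewrite Px Py Pt Hxx Hxy Hyx Hxt Hyt Hyy Tx Ty Txx Tyy.
Qed.

Lemma symmetry_of_determining (z : jet2 R 3) :
  determining_eqs F L q -> z.1.1.1 = q -> z.2^T = z.2 -> Delta a 0 d 0 z = 0 ->
  'D_(pr2 v z) (Delta a 0 d 0) z = 0.
Proof.
move=> [e1 e2 e3 e4 e5 e6] zq zT Dz.
have Hyx : z.2 iy ix = z.2 ix iy by rewrite -[in LHS]zT mxE.
rewrite (@symmetry_condition F L v z) ?zq //= Hyx Tx Ty Txx Tyy.
apply: (determining_alg _ _ _ _ _ _ _ _ _ _ _ _ _ _ _ _ _ _ _ _ _).2 => //.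
by rewrite -[RHS]Dz /Delta zq; ring.
Qed.

End Reduced.

End DeterminingSystem.

(** * Solution of the determining system *)

Section HalfLine.
Variable R : realType.

Lemma is_derive_halfpow (A B C s : R) : 0 < s ->
  is_derive s 1 (fun s => A * s + B * Num.sqrt s + C * (Num.sqrt s)^-1)
    (A + B / 2%:R / Num.sqrt s - C / 2%:R * (Num.sqrt s)^-1 ^+ 3).
Proof.
move=> s0; is_derive_calc.
  by repeat first [exact: is_derive_id | exact: is_derive_sqrt
    | exact: is_derive_sqrtV | is_derive_step].
by rewrite /GRing.scale /=; field; rewrite gt_eqF // sqrtr_gt0.
Qed.

(** The difference from the evident primitive is constant on the half-line, and its value is taken
    at s = 1. *)
Lemma halfpow_primitive (f : R -> R) (A B C : R) :
  (forall s : R, 0 < s -> is_derive s 1 f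
    (A + B / Num.sqrt s + C * (Num.sqrt s)^-1 ^+ 3)) ->
  forall s : R, 0 < s -> f s = A * s + 2%:R * B * Num.sqrt s
    - 2%:R * C * (Num.sqrt s)^-1 + (f 1 - A - 2%:R * B + 2%:R * C).
Proof.
move=> df s s0.
pose g (r : R) := f r - (A * r + 2%:R * B * Num.sqrt r + - 2%:R * C * (Num.sqrt r)^-1).
have dg (r : R) : 0 < r -> is_derive r 1 g 0.
  move=> r0; apply: (is_derive_eq (is_derive_sub (df r r0)
    (is_derive_halfpow A (2%:R * B) (- 2%:R * C) r0))).
  by field; rewrite gt_eqF // sqrtr_gt0.
have := is_derive_0_is_cst_pos dg s0 ltr01; rewrite /g sqrtr1 invr1 !mulr1 => e.
by rewrite -[LHS](subrK (A * s + 2%:R * B * Num.sqrt s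
  + - 2%:R * C * (Num.sqrt s)^-1)) e; ring.
Qed.

(** A s is a particular solution and sqrt s solves the homogeneous equation, so f / sqrt s - A sqrt
    s has derivative 0. *)
Lemma euler_ode (f f' : R -> R) (A : R) :
  (forall s : R, 0 < s -> is_derive s 1 f (f' s)) ->
  (forall s : R, 0 < s -> f s - 2%:R * s * f' s + s * A = 0) ->
  forall s : R, 0 < s -> f s = A * s + (f 1 - A) * Num.sqrt s.
Proof.
move=> df ode s s0.
pose g (r : R) := f r * (Num.sqrt r)^-1 - A * Num.sqrt r.
have dg (r : R) : 0 < r -> is_derive r 1 g 0.
  move=> r0.
  have sr0 : Num.sqrt r != 0 by rewrite gt_eqF // sqrtr_gt0.
  is_derive_calc.
    by repeat first [exact: df | exact: is_derive_sqrt | exact: is_derive_sqrtV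
      | is_derive_step].
  have rE : r = Num.sqrt r ^+ 2 by rewrite sqr_sqrtr // ltW.
  have fE : f r = 2%:R * r * f' r - r * A.
    by rewrite -[LHS]subr0 -(ode r r0); ring.
  rewrite fE; move: (f' r) sr0 rE => z.
  by move: (Num.sqrt r) => w w0 ->; field.
have s1 : Num.sqrt s != 0 by rewrite gt_eqF // sqrtr_gt0.
have := is_derive_0_is_cst_pos dg s0 ltr01; rewrite /g sqrtr1 invr1 !mulr1 => <-.
have sE : s = Num.sqrt s ^+ 2 by rewrite sqr_sqrtr // ltW.
move: (f s) s1 sE => z; move: (Num.sqrt s) => w w0 ->.
by field.
Qed.

End HalfLine.

(** * Partial derivatives along the coordinate axes of the quadrant *)

Section Points.
Variable R : realType.

Definition pt (x y t : R) : 'rV[R]_3 := \row_k nth 0 [:: x; y; t] k.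

Lemma ptx x y t : pt x y t 0 ix = x. Proof. by rewrite mxE. Qed.
Lemma pty x y t : pt x y t 0 iy = y. Proof. by rewrite mxE. Qed.
Lemma ptt x y t : pt x y t 0 it = t. Proof. by rewrite mxE. Qed.

Lemma pt_coord (q : 'rV[R]_3) : pt (q 0 ix) (q 0 iy) (q 0 it) = q.
Proof. by apply/rowP; apply: ord3P; rewrite !mxE. Qed.

Lemma positive_pt (x y t : R) : 0 < x -> 0 < y -> positive_xy (pt x y t).
Proof. by rewrite /positive_xy /= ptx pty. Qed.

Lemma positive_coord q : positive_xy q ->
  exists x y t, [/\ 0 < x, 0 < y & q = pt x y t].
Proof.
by move=> [x0 y0]; exists (q 0 ix), (q 0 iy), (q 0 it); rewrite pt_coord.
Qed.

Variables (f : 'rV[R]_3 -> R) (sf : smooth_on (@positive_xy R) f).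

Lemma is_derive_ptx (x y t : R) : 0 < x -> 0 < y ->
  is_derive x 1 (fun s => f (pt s y t)) ('D_(delta_mx 0 ix) f (pt x y t)).
Proof.
move=> x0 y0.
have E s : s *: delta_mx 0 ix + pt 0 y t = pt s y t.
  by apply/rowP; apply: ord3P; rewrite !mxE /= ?mulr1 ?mulr0 ?addr0 ?add0r.
have h := smooth_on_is_derive (delta_mx 0 ix) sf (positive_pt t x0 y0).
rewrite -[in X in is_derive X]E in h.
move: ((is_derive_line_at _ _ _ _ _).1 h).
by congr (is_derive _ _ _ _); apply/funext => s; rewrite E.
Qed.

Lemma is_derive_pty (x y t : R) : 0 < x -> 0 < y ->
  is_derive y 1 (fun s => f (pt x s t)) ('D_(delta_mx 0 iy) f (pt x y t)).
Proof.
move=> x0 y0.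
have E s : s *: delta_mx 0 iy + pt x 0 t = pt x s t.
  by apply/rowP; apply: ord3P; rewrite !mxE /= ?mulr1 ?mulr0 ?addr0 ?add0r.
have h := smooth_on_is_derive (delta_mx 0 iy) sf (positive_pt t x0 y0).
rewrite -[in X in is_derive X]E in h.
move: ((is_derive_line_at _ _ _ _ _).1 h).
by congr (is_derive _ _ _ _); apply/funext => s; rewrite E.
Qed.

Lemma is_derive_ptt (x y t : R) : 0 < x -> 0 < y ->
  is_derive t 1 (fun s => f (pt x y s)) ('D_(delta_mx 0 it) f (pt x y t)).
Proof.
move=> x0 y0.
have E s : s *: delta_mx 0 it + pt x y 0 = pt x y s.
  by apply/rowP; apply: ord3P; rewrite !mxE /= ?mulr1 ?mulr0 ?addr0 ?add0r.
have h := smooth_on_is_derive (delta_mx 0 it) sf (positive_pt t x0 y0).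
rewrite -[in X in is_derive X]E in h.
move: ((is_derive_line_at _ _ _ _ _).1 h).
by congr (is_derive _ _ _ _); apply/funext => s; rewrite E.
Qed.

Lemma derive_ptx (x y t : R) g d : 0 < x -> 0 < y ->
  (forall s : R, 0 < s -> f (pt s y t) = g s) -> is_derive x 1 g d ->
  'D_(delta_mx 0 ix) f (pt x y t) = d.
Proof.
move=> x0 y0 fg dg; apply: is_derive_unique (is_derive_ptx t x0 y0) _.
by apply: is_derive_pos dg => // s s0; rewrite fg.
Qed.

Lemma derive_pty (x y t : R) g d : 0 < x -> 0 < y ->
  (forall s : R, 0 < s -> f (pt x s t) = g s) -> is_derive y 1 g d ->
  'D_(delta_mx 0 iy) f (pt x y t) = d.
Proof.
move=> x0 y0 fg dg; apply: is_derive_unique (is_derive_pty t x0 y0) _.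
by apply: is_derive_pos dg => // s s0; rewrite fg.
Qed.

Lemma derive_ptt (x y t : R) g d : 0 < x -> 0 < y ->
  (forall s : R, f (pt x y s) = g s) -> is_derive t 1 g d ->
  'D_(delta_mx 0 it) f (pt x y t) = d.
Proof.
move=> x0 y0 fg dg; apply: is_derive_unique (is_derive_ptt t x0 y0) _.
by rewrite (_ : (fun s => _) = g) //; apply/funext.
Qed.

End Points.

Section TimeComponent.
Variables (R : realType) (T : 'rV[R]_3 -> R).
Hypothesis sT : smooth_on (@positive_xy R) T.
Hypothesis Tx : forall q, positive_xy q -> 'D_(delta_mx 0 ix) T q = 0.
Hypothesis Ty : forall q, positive_xy q -> 'D_(delta_mx 0 iy) T q = 0.

(** Any point of the quadrant is joined to (1, 1) by two segments parallel to the axes, and T is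
    constant along both. *)
Lemma time_component (x y s : R) : 0 < x -> 0 < y -> T (pt x y s) = T (pt 1 1 s).
Proof.
move=> x0 y0; transitivity (T (pt 1 y s)).
  apply: (@is_derive_0_is_cst_pos _ (fun r => T (pt r y s))) => // r r0.
  by rewrite -(Tx (positive_pt s r0 y0)); exact: is_derive_ptx.
apply: (@is_derive_0_is_cst_pos _ (fun r => T (pt 1 r s))) => // r r0.
by rewrite -(Ty (positive_pt s ltr01 r0)); exact: is_derive_pty.
Qed.

Lemma derive_time_component (x y s : R) : 0 < x -> 0 < y ->
  'D_(delta_mx 0 it) T (pt x y s) = 'D_(delta_mx 0 it) T (pt 1 1 s).
Proof.
move=> x0 y0.
apply: (@derive_ptt _ _ sT x y s (fun r => T (pt 1 1 r)) _ x0 y0).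
  by move=> r; exact: time_component.
exact: (is_derive_ptt sT s ltr01 ltr01).
Qed.

End TimeComponent.

(** * The sqrt x term of xi vanishes *)

Section Solution.
Variables (R : realType) (a : R).
Hypotheses (ha : a <> 1 / 4%:R) (ha' : a <> 3%:R / 4%:R).
Let d : R := 1 / 4%:R.
Variables (F : 'I_3 -> 'rV[R]_3 -> R) (L : 'rV[R]_3 -> R).
Hypotheses (sF : forall k, smooth_on (@positive_xy R) (F k)).
Hypothesis (sL : smooth_on (@positive_xy R) L).

Notation dx f := ('D_(delta_mx 0 ix) f).
Notation dy f := ('D_(delta_mx 0 iy) f).
Notation dt f := ('D_(delta_mx 0 it) f).

Hypothesis Tx : forall q, positive_xy q -> dx (F it) q = 0.
Hypothesis Ty : forall q, positive_xy q -> dy (F it) q = 0.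
Hypothesis det : forall q, positive_xy q -> determining_eqs a d F L q.

Let tau1 (s : R) : R := dt (F it) (pt 1 1 s).
Let tau2 (s : R) : R := dt (dt (F it)) (pt 1 1 s).

Let sD (f : 'rV[R]_3 -> R) e :
  smooth_on (@positive_xy R) f -> smooth_on (@positive_xy R) ('D_e f).
Proof. exact: smooth_on_derive. Qed.

Let is_derive_tau1 (s : R) : is_derive s 1 tau1 (tau2 s).
Proof. exact: (is_derive_ptt (sD _ (sF it)) s ltr01 ltr01). Qed.

Let dt_tau (x y s : R) : 0 < x -> 0 < y -> dt (F it) (pt x y s) = tau1 s.
Proof. by move=> x0 y0; exact: derive_time_component. Qed.

(* [F ix] solves an Euler equation in x, so it is determined by its trace on
   x = 1. *)
Let P (y s : R) : R := F ix (pt 1 y s) - tau1 s.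

Let xiE (x y s : R) : 0 < x -> 0 < y ->
  F ix (pt x y s) = tau1 s * x + P y s * Num.sqrt x.
Proof.
move=> x0 y0.
apply: (euler_ode (f := fun r => F ix (pt r y s))
  (f' := fun r => dx (F ix) (pt r y s))) => // r r0.
  exact: is_derive_ptx.
have := det_hxx (det (positive_pt s r0 y0)).
by rewrite ptx dt_tau.
Qed.

Let Py (y s : R) : R := dy (F ix) (pt 1 y s).
Let Pyy (y s : R) : R := dy (dy (F ix)) (pt 1 y s).
Let Pt (y s : R) : R := dt (F ix) (pt 1 y s) - tau2 s.
(** The (y, t)-part of the operator applied to P. It becomes the coefficient of x^(-1/2) in
    lambda_x. *)
Let B (y s : R) : R := Pt y s + d * Py y s + y / 2%:R * Pyy y s.

Let is_derive_P (y s : R) : 0 < y -> is_derive y 1 (P^~ s) (Py y s).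
Proof.
move=> y0; rewrite -[Py y s]subr0.
exact: (is_derive_sub (is_derive_pty (sF ix) s ltr01 y0) (is_derive_const _ _ _)).
Qed.

Let is_derive_Py (y s : R) : 0 < y -> is_derive y 1 (Py^~ s) (Pyy y s).
Proof. by move=> y0; exact: (is_derive_pty (sD _ (sF ix)) s ltr01 y0). Qed.

Let is_derive_Pt (y s : R) : 0 < y -> is_derive s 1 (P y) (Pt y s).
Proof. move=> y0.
exact: (is_derive_sub (is_derive_ptt (sF ix) s ltr01 y0) (is_derive_tau1 s)).
 Qed.

Let dx_xi (x y s : R) : 0 < x -> 0 < y ->
  dx (F ix) (pt x y s) = tau1 s + P y s / 2%:R / Num.sqrt x.
Proof.
move=> x0 y0; apply: (@derive_ptx _ _ (sF ix) x y s
  (fun r => tau1 s * r + P y s * Num.sqrt r) _ x0 y0).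
  by move=> r r0; exact: xiE.
have := is_derive_halfpow (tau1 s) (P y s) 0 x0.
rewrite !mul0r subr0; congr (is_derive _ _ _ _).
by apply/funext => r; rewrite mul0r addr0.
Qed.

Let dxx_xi (x y s : R) : 0 < x -> 0 < y ->
  dx (dx (F ix)) (pt x y s) = - (P y s / 4%:R) * (Num.sqrt x)^-1 ^+ 3.
Proof.
move=> x0 y0; apply: (@derive_ptx _ _ (sD _ (sF ix)) x y s
    (fun r => tau1 s + P y s / 2%:R / Num.sqrt r) _ x0 y0).
  by move=> r r0; exact: dx_xi.
is_derive_calc.
  by repeat first [exact: is_derive_sqrtV | is_derive_step].
by cbv beta; field; rewrite gt_eqF // sqrtr_gt0.
Qed.

Let dy_xi (x y s : R) : 0 < x -> 0 < y ->
  dy (F ix) (pt x y s) = Py y s * Num.sqrt x.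
Proof.
move=> x0 y0; apply: (@derive_pty _ _ (sF ix) x y s
    (fun r => tau1 s * x + P r s * Num.sqrt x) _ x0 y0).
  by move=> r r0; exact: xiE.
is_derive_calc.
  by repeat first [exact: is_derive_P | is_derive_step].
by cbv beta; ring.
Qed.

Let dyy_xi (x y s : R) : 0 < x -> 0 < y ->
  dy (dy (F ix)) (pt x y s) = Pyy y s * Num.sqrt x.
Proof.
move=> x0 y0; apply: (@derive_pty _ _ (sD _ (sF ix)) x y s
    (fun r => Py r s * Num.sqrt x) _ x0 y0).
  by move=> r r0; exact: dy_xi.
is_derive_calc.
  by repeat first [exact: is_derive_Py | is_derive_step].
by cbv beta; ring.
Qed.

Let dt_xi (x y s : R) : 0 < x -> 0 < y ->
  dt (F ix) (pt x y s) = tau2 s * x + Pt y s * Num.sqrt x.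
Proof.
move=> x0 y0; apply: (@derive_ptt _ _ (sF ix) x y s
    (fun r => tau1 r * x + P y r * Num.sqrt x) _ x0 y0).
  by move=> r; exact: xiE.
is_derive_calc.
  by repeat first [exact: is_derive_Pt | exact: is_derive_tau1 | is_derive_step].
by cbv beta; ring.
Qed.

(** Coefficient of P x^(-3/2) in lambda_x: a/2 comes from a xi_x and -1/8 from (x/2) xi_xx, both
    applied to P sqrt x. It is zero exactly for a = 1/4. *)
Let c : R := a / 2%:R - 8%:R^-1.

Let dx_L (x y s : R) : 0 < x -> 0 < y -> dx L (pt x y s) =
  tau2 s + B y s / Num.sqrt x + c * P y s * (Num.sqrt x)^-1 ^+ 3.
Proof.
move=> x0 y0; have := det_px (det (positive_pt s x0 y0)).
rewrite ptx pty dt_xi // dx_xi // dy_xi // dxx_xi // dyy_xi // dt_tau // => e.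
have xE : x = Num.sqrt x ^+ 2 by rewrite sqr_sqrtr // ltW.
have w0 : Num.sqrt x != 0 by rewrite gt_eqF // sqrtr_gt0.
have xn0 : x != 0 by rewrite gt_eqF.
apply: (mulfI xn0); rewrite e /B /c.
move: (P y s) (Pt y s) (Py y s) (Pyy y s) (tau1 s) (tau2 s) w0.
move: (Num.sqrt x) xE => w -> p pt' py pyy t1 t2 w0.
by field.
Qed.

Let dxx_L (x y s : R) : 0 < x -> 0 < y -> dx (dx L) (pt x y s) =
  - (B y s / 2%:R) * (Num.sqrt x)^-1 ^+ 3
  - 3%:R / 2%:R * c * P y s * (Num.sqrt x)^-1 ^+ 5.
Proof.
move=> x0 y0; apply: (@derive_ptx _ _ (sD _ sL) x y s
  (fun r => tau2 s + B y s / Num.sqrt r + c * P y s * (Num.sqrt r)^-1 ^+ 3) _ x0 y0).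
  by move=> r r0; exact: dx_L.
is_derive_calc.
  by repeat first [exact: is_derive_sqrtV | is_derive_step].
by cbv beta; rewrite /=; field; rewrite gt_eqF // sqrtr_gt0.
Qed.

Let LE (r y s : R) : 0 < r -> 0 < y -> L (pt (r ^+ 2) y s) =
  tau2 s * r ^+ 2 + 2%:R * B y s * r - 2%:R * (c * P y s) / r
  + (L (pt 1 y s) - tau2 s - 2%:R * B y s + 2%:R * (c * P y s)).
Proof.
move=> r0 y0; have rr0 : 0 < r ^+ 2 by rewrite exprn_gt0.
have := @halfpow_primitive _ (fun r => L (pt r y s)) (tau2 s) (B y s) (c * P y s)
  _ _ rr0.
rewrite sqrtr_sqr gtr0_norm //; apply=> x x0.
by rewrite -dx_L //; exact: is_derive_ptx.
Qed.

(* In r = sqrt x the solution is a combination of r^2, r, 1 and 1/r; these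
   weights at r = 1, ..., 5 annihilate all four (fourth differences of the cubic
   polynomials r^3, r^2, r, 1). *)
Let W (f : 'rV[R]_3 -> R) (y s : R) : R :=
  f (pt (1%:R ^+ 2) y s) - 8%:R * f (pt (2%:R ^+ 2) y s)
  + 18%:R * f (pt (3%:R ^+ 2) y s) - 16%:R * f (pt (4%:R ^+ 2) y s)
  + 5%:R * f (pt (5%:R ^+ 2) y s).

Let sq0 n : 0 < (n.+1%:R : R) ^+ 2. Proof. by rewrite exprn_gt0. Qed.

(** [W] combines values at fixed abscissas, so it commutes with the t-derivative, and likewise with
    the y-derivative below. *)
Let W_dt f : smooth_on (@positive_xy R) f ->
  (forall y s : R, 0 < y -> W f y s = 0) ->
  forall y s : R, 0 < y -> W (dt f) y s = 0.
Proof.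
move=> sf Wf y s y0.
have h x (x0 : 0 < x) := is_derive_ptt sf s x0 y0.
apply: (@is_derive_unique _ _ _ (W f y) s 1); last first.
  rewrite (_ : W f y = fun=> 0); first exact: is_derive_const.
  by apply/funext => r; exact: Wf.
rewrite /W; is_derive_calc.
  by repeat first [apply: h; exact: sq0 | is_derive_step].
by cbv beta; ring.
Qed.

Let W_dy f : smooth_on (@positive_xy R) f ->
  (forall y s : R, 0 < y -> W f y s = 0) ->
  forall y s : R, 0 < y -> W (dy f) y s = 0.
Proof.
move=> sf Wf y s y0.
have h x (x0 : 0 < x) := is_derive_pty sf s x0 y0.
apply: (@is_derive_unique _ _ _ (fun r => W f r s) y 1); last first.
  apply: (@is_derive_pos _ (fun=> 0) _ y 0 y0 _ (is_derive_const _ _ _)) => r r0.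
  by rewrite Wf.
rewrite /W; is_derive_calc.
  by repeat first [apply: h; exact: sq0 | is_derive_step].
by cbv beta; ring.
Qed.

Let c_neq0 : c != 0.
Proof. by apply/eqP => c0; apply: ha; move: c0; rewrite /c => ?; lra. Qed.

(** [W] annihilates L, hence also its t- and y-derivatives in A L = 0. Of the remaining x-part, a
    combination of 1, 1/r and 1/r^3, it annihilates the first two. Thus P is isolated without
    differentiating [B] or the integration constant. *)
Let P0 (y s : R) : 0 < y -> P y s = 0.
Proof.
move=> y0.
have WL z r : 0 < z -> W L z r = 0.
  by move=> z0; rewrite /W !LE //; field.
have Wt := W_dt sL WL; have Wy := W_dy sL WL; have Wyy := W_dy (sD _ sL) Wy.
(* The equation A L = 0 at x = (n + 1)^2, with the x-derivatives moved to the right and made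
   explicit. The factor a - 3/4 is a from a dx and -3/4 from (x/2) dxx, applied to the x^(-3/2) term
   of lambda_x. *)
have e n : dt L (pt (n.+1%:R ^+ 2) y s) + d * dy L (pt (n.+1%:R ^+ 2) y s)
    + y / 2%:R * dy (dy L) (pt (n.+1%:R ^+ 2) y s)
  = - (a * tau2 s + (a - 4%:R^-1) * B y s / n.+1%:R
       + c * P y s * (a - 3%:R / 4%:R) / n.+1%:R ^+ 3).
  have n0 : 0 < n.+1%:R ^+ 2 :> R by exact: sq0.
  have := det_u (det (positive_pt s n0 y0)).
  rewrite ptx pty dx_L // dxx_L // sqrtr_sqr gtr0_norm //.
  have : n.+1%:R != 0 :> R by [].
  move: (pt (n.+1%:R ^+ 2) y s) (n.+1%:R : R) => q z.
  move: (dt L q) (dy L q) (dy (dy L) q) => l1 l2 l3 z0 E.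
  apply/eqP; rewrite -subr_eq0; apply/eqP; rewrite -[RHS]E; field.
  by rewrite z0.
(* The constant is the value of [W] on 1/r^3, namely 1 - 4/4 + 6/9 - 4/16 + 1/25. *)
have {}e : 137%:R / 300%:R * (c * P y s * (a - 3%:R / 4%:R)) = 0 :> R.
  have := Wt y s y0; have := Wy y s y0; have := Wyy y s y0; rewrite /W.
  have := e 0%N; have := e 1%N; have := e 2%N; have := e 3%N; have := e 4%N.
  move: (P y s) (B y s) (tau2 s) (c) => p b t2 k.
  move: (pt (1%:R ^+ 2) y s) (pt (2%:R ^+ 2) y s) (pt (3%:R ^+ 2) y s)
    (pt (4%:R ^+ 2) y s) (pt (5%:R ^+ 2) y s) => q1 q2 q3 q4 q5.
  move: (dt L q1) (dt L q2) (dt L q3) (dt L q4) (dt L q5) => t11 t12 t13 t14 t15.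
  move: (dy L q1) (dy L q2) (dy L q3) (dy L q4) (dy L q5) => l1 l2 l3 l4 l5.
  move: (dy (dy L) q1) (dy (dy L) q2) (dy (dy L) q3) (dy (dy L) q4)
    (dy (dy L) q5) => m1 m2 m3 m4 m5.
  move=> e5 e4 e3 e2 e1 w3 w2 w1.
  have w3' : y / 2%:R * (m1 - 8%:R * m2 + 18%:R * m3 - 16%:R * m4 + 5%:R * m5) = 0.
    by rewrite w3 mulr0.
  have w2' : d * (l1 - 8%:R * l2 + 18%:R * l3 - 16%:R * l4 + 5%:R * l5) = 0.
    by rewrite w2 mulr0.
  clear w2 w3; move: d w2' e1 e2 e3 e4 e5 => dd w2' e1 e2 e3 e4 e5.
  lra.
have a34 : a - 3%:R / 4%:R != 0 by rewrite subr_eq0; apply/eqP.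
have c0 : (137%:R / 300%:R : R) != 0 by rewrite mulf_neq0 // invr_eq0.
move/eqP: e; rewrite mulf_eq0 (negPf c0) /= mulf_eq0 (negPf a34) orbF.
by rewrite mulf_eq0 (negPf c_neq0) /= => /eqP.
Qed.

Lemma xi_solution (x y s : R) : 0 < x -> 0 < y ->
  F ix (pt x y s) = tau1 s * x.
Proof. by move=> x0 y0; rewrite xiE // P0 // mul0r addr0. Qed.

End Solution.

(** * Integration of the determining system when P = 0 *)

Section Solution2.
Variables (R : realType) (a : R).
Hypotheses (ha : a <> 1 / 4%:R) (ha' : a <> 3%:R / 4%:R).
Let d : R := 1 / 4%:R.
Variables (F : 'I_3 -> 'rV[R]_3 -> R) (L : 'rV[R]_3 -> R).
Hypotheses (sF : forall k, smooth_on (@positive_xy R) (F k)).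
Hypothesis (sL : smooth_on (@positive_xy R) L).

Notation dx f := ('D_(delta_mx 0 ix) f).
Notation dy f := ('D_(delta_mx 0 iy) f).
Notation dt f := ('D_(delta_mx 0 it) f).

Hypothesis Tx : forall q, positive_xy q -> dx (F it) q = 0.
Hypothesis Ty : forall q, positive_xy q -> dy (F it) q = 0.
Hypothesis det : forall q, positive_xy q -> determining_eqs a d F L q.

Let tau (s : R) : R := F it (pt 1 1 s).
Let tau1 (s : R) : R := dt (F it) (pt 1 1 s).
Let tau2 (s : R) : R := dt (dt (F it)) (pt 1 1 s).
Let tau3 (s : R) : R := dt (dt (dt (F it))) (pt 1 1 s).

Let sD (f : 'rV[R]_3 -> R) e :
  smooth_on (@positive_xy R) f -> smooth_on (@positive_xy R) ('D_e f).
Proof. exact: smooth_on_derive. Qed.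

Let is_derive_tau (s : R) : is_derive s 1 tau (tau1 s).
Proof. exact: (is_derive_ptt (sF it) s ltr01 ltr01). Qed.

Let is_derive_tau1 (s : R) : is_derive s 1 tau1 (tau2 s).
Proof. exact: (is_derive_ptt (sD _ (sF it)) s ltr01 ltr01). Qed.

Let is_derive_tau2 (s : R) : is_derive s 1 tau2 (tau3 s).
Proof. exact: (is_derive_ptt (sD _ (sD _ (sF it))) s ltr01 ltr01). Qed.

Let dt_tau (x y s : R) : 0 < x -> 0 < y -> dt (F it) (pt x y s) = tau1 s.
Proof. by move=> x0 y0; exact: derive_time_component. Qed.

Let xiE (x y s : R) : 0 < x -> 0 < y -> F ix (pt x y s) = tau1 s * x.
Proof. by move=> x0 y0; exact: (@xi_solution R a ha ha' F L). Qed.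

Let dx_xi (x y s : R) : 0 < x -> 0 < y -> dx (F ix) (pt x y s) = tau1 s.
Proof.
move=> x0 y0; apply: (@derive_ptx _ _ (sF ix) x y s (fun r => tau1 s * r) _ x0 y0).
  by move=> r r0; exact: xiE.
is_derive_calc; first by repeat first [exact: is_derive_id | is_derive_step].
by cbv beta; ring.
Qed.

Let dxx_xi (x y s : R) : 0 < x -> 0 < y -> dx (dx (F ix)) (pt x y s) = 0.
Proof.
move=> x0 y0; apply: (@derive_ptx _ _ (sD _ (sF ix)) x y s (fun=> tau1 s) _ x0 y0).
by move=> r r0; exact: dx_xi.
Qed.

Let dy_xi (x y s : R) : 0 < x -> 0 < y -> dy (F ix) (pt x y s) = 0.
Proof.
move=> x0 y0; apply: (@derive_pty _ _ (sF ix) x y s (fun=> tau1 s * x) _ x0 y0).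
by move=> r r0; exact: xiE.
Qed.

Let dyy_xi (x y s : R) : 0 < x -> 0 < y -> dy (dy (F ix)) (pt x y s) = 0.
Proof.
move=> x0 y0; apply: (@derive_pty _ _ (sD _ (sF ix)) x y s (fun=> 0) _ x0 y0).
by move=> r r0; exact: dy_xi.
Qed.

Let dt_xi (x y s : R) : 0 < x -> 0 < y -> dt (F ix) (pt x y s) = tau2 s * x.
Proof.
move=> x0 y0; apply: (@derive_ptt _ _ (sF ix) x y s (fun r => tau1 r * x) _ x0 y0).
  by move=> r; exact: xiE.
is_derive_calc.
  by repeat first [exact: is_derive_tau1 | is_derive_step].
by cbv beta; ring.
Qed.

Let G (s : R) : R := F iy (pt 1 1 s) - tau1 s.
Let G1 (s : R) : R := dt (F iy) (pt 1 1 s) - tau2 s.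
Let G2 (s : R) : R := dt (dt (F iy)) (pt 1 1 s) - tau3 s.

Let is_derive_G (s : R) : is_derive s 1 G (G1 s).
Proof.
exact: (is_derive_sub (is_derive_ptt (sF iy) s ltr01 ltr01) (is_derive_tau1 s)).
Qed.

Let is_derive_G1 (s : R) : is_derive s 1 G1 (G2 s).
Proof.
exact: (is_derive_sub (is_derive_ptt (sD _ (sF iy)) s ltr01 ltr01)
  (is_derive_tau2 s)).
Qed.

Let dx_eta (x y s : R) : 0 < x -> 0 < y -> dx (F iy) (pt x y s) = 0.
Proof.
move=> x0 y0; have := det_hxy (det (positive_pt s x0 y0)).
rewrite ptx dy_xi // mulr0 addr0 => /eqP.
by rewrite mulf_eq0 gt_eqF //= => /eqP.
Qed.

Let dxx_eta (x y s : R) : 0 < x -> 0 < y -> dx (dx (F iy)) (pt x y s) = 0.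
Proof.
move=> x0 y0; apply: (@derive_ptx _ _ (sD _ (sF iy)) x y s (fun=> 0) _ x0 y0).
by move=> r r0; exact: dx_eta.
Qed.

(** Since xi_y = 0, the u_xy equation makes eta independent of x; on x = 1 it solves the same Euler
    equation in y as xi does in x. *)
Let etaE (x y s : R) : 0 < x -> 0 < y ->
  F iy (pt x y s) = tau1 s * y + G s * Num.sqrt y.
Proof.
move=> x0 y0; transitivity (F iy (pt 1 y s)).
  apply: (@is_derive_0_is_cst_pos _ (fun r => F iy (pt r y s))) => // r r0.
  by rewrite -(dx_eta s r0 y0); exact: is_derive_ptx.
apply: (euler_ode (f := fun r => F iy (pt 1 r s))
  (f' := fun r => dy (F iy) (pt 1 r s))) => // r r0.
  exact: is_derive_pty.
have := det_hyy (det (positive_pt s ltr01 r0)).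
by rewrite pty dt_tau.
Qed.

Let dy_eta (x y s : R) : 0 < x -> 0 < y ->
  dy (F iy) (pt x y s) = tau1 s + G s / 2%:R / Num.sqrt y.
Proof.
move=> x0 y0; apply: (@derive_pty _ _ (sF iy) x y s
  (fun r => tau1 s * r + G s * Num.sqrt r) _ x0 y0).
  by move=> r r0; exact: etaE.
is_derive_calc.
  by repeat first [exact: is_derive_id | exact: is_derive_sqrt | is_derive_step].
by cbv beta; field; rewrite gt_eqF // sqrtr_gt0.
Qed.

Let dyy_eta (x y s : R) : 0 < x -> 0 < y ->
  dy (dy (F iy)) (pt x y s) = - (G s / 4%:R) * (Num.sqrt y)^-1 ^+ 3.
Proof.
move=> x0 y0; apply: (@derive_pty _ _ (sD _ (sF iy)) x y s
  (fun r => tau1 s + G s / 2%:R / Num.sqrt r) _ x0 y0).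
  by move=> r r0; exact: dy_eta.
is_derive_calc.
  by repeat first [exact: is_derive_sqrtV | is_derive_step].
by cbv beta; field; rewrite gt_eqF // sqrtr_gt0.
Qed.

Let dt_eta (x y s : R) : 0 < x -> 0 < y ->
  dt (F iy) (pt x y s) = tau2 s * y + G1 s * Num.sqrt y.
Proof.
move=> x0 y0; apply: (@derive_ptt _ _ (sF iy) x y s
  (fun r => tau1 r * y + G r * Num.sqrt y) _ x0 y0).
  by move=> r; exact: etaE.
is_derive_calc.
  by repeat first [exact: is_derive_tau1 | exact: is_derive_G | is_derive_step].
by cbv beta; ring.
Qed.

Let dx_L (x y s : R) : 0 < x -> 0 < y -> dx L (pt x y s) = tau2 s.
Proof.
move=> x0 y0; have := det_px (det (positive_pt s x0 y0)).
rewrite ptx pty dt_xi // dx_xi // dy_xi // dxx_xi // dyy_xi // dt_tau // => e.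
have xn0 : x != 0 by rewrite gt_eqF.
by apply: (mulfI xn0); rewrite e; ring.
Qed.

(** The terms in G from d eta_y and (y/2) eta_yy cancel because d = 1/4: the analogue for y of the
    constant [c] is d/2 - 1/8 = 0. Hence G is not forced to vanish. *)
Let dy_L (x y s : R) : 0 < x -> 0 < y ->
  dy L (pt x y s) = tau2 s + G1 s / Num.sqrt y.
Proof.
move=> x0 y0; have := det_py (det (positive_pt s x0 y0)).
rewrite ptx pty dt_eta // dx_eta // dy_eta // dxx_eta // dyy_eta // dt_tau // => e.
have yE : y = Num.sqrt y ^+ 2 by rewrite sqr_sqrtr // ltW.
have w0 : Num.sqrt y != 0 by rewrite gt_eqF // sqrtr_gt0.
have yn0 : y != 0 by rewrite gt_eqF.
apply: (mulfI yn0); rewrite e /d.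
move: (G s) (G1 s) (tau1 s) (tau2 s) w0.
move: (Num.sqrt y) yE => w -> g g1 t1 t2 w0.
by field.
Qed.

(** The integration constant of lambda with respect to x and y, normalized at x = y = 1. *)
Let m (s : R) : R := L (pt 1 1 s) - 2%:R * tau2 s - 2%:R * G1 s.
Let m1 (s : R) : R := dt L (pt 1 1 s) - 2%:R * tau3 s - 2%:R * G2 s.

Let is_derive_m (s : R) : is_derive s 1 m (m1 s).
Proof.
is_derive_calc.
  by repeat first [exact: (is_derive_ptt sL s ltr01 ltr01)
    | exact: is_derive_tau2 | exact: is_derive_G1 | is_derive_step].
by cbv beta; rewrite /m1; ring.
Qed.

Let LE (x y s : R) : 0 < x -> 0 < y -> L (pt x y s) =
  tau2 s * (x + y) + 2%:R * G1 s * Num.sqrt y + m s.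
Proof.
move=> x0 y0.
have h1 : L (pt x y s) - tau2 s * x = L (pt 1 y s) - tau2 s * 1.
  apply: (@is_derive_0_is_cst_pos _ (fun r => L (pt r y s) - tau2 s * r)) => // r r0.
  is_derive_calc.
    by repeat first [exact: (is_derive_ptx sL s r0 y0) | exact: is_derive_id
      | is_derive_step].
  by cbv beta; rewrite dx_L //; ring.
have h2 : L (pt 1 y s) = tau2 s * y + 2%:R * G1 s * Num.sqrt y
    - 2%:R * 0 * (Num.sqrt y)^-1
    + (L (pt 1 1 s) - tau2 s - 2%:R * G1 s + 2%:R * 0).
  apply: (@halfpow_primitive _ (fun r => L (pt 1 r s))) => // r r0.
  by rewrite mul0r addr0 -(dy_L s ltr01 r0); exact: is_derive_pty.
rewrite -[LHS](subrK (tau2 s * x)) h1 h2 /m.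
by ring.
Qed.

Let dxx_L (x y s : R) : 0 < x -> 0 < y -> dx (dx L) (pt x y s) = 0.
Proof.
move=> x0 y0; apply: (@derive_ptx _ _ (sD _ sL) x y s (fun=> tau2 s) _ x0 y0).
by move=> r r0; exact: dx_L.
Qed.

Let dyy_L (x y s : R) : 0 < x -> 0 < y ->
  dy (dy L) (pt x y s) = - (G1 s / 2%:R) * (Num.sqrt y)^-1 ^+ 3.
Proof.
move=> x0 y0; apply: (@derive_pty _ _ (sD _ sL) x y s
  (fun r => tau2 s + G1 s / Num.sqrt r) _ x0 y0).
  by move=> r r0; exact: dy_L.
is_derive_calc.
  by repeat first [exact: is_derive_sqrtV | is_derive_step].
by cbv beta; field; rewrite gt_eqF // sqrtr_gt0.
Qed.

Let dt_L (x y s : R) : 0 < x -> 0 < y ->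
  dt L (pt x y s) = tau3 s * (x + y) + 2%:R * G2 s * Num.sqrt y + m1 s.
Proof.
move=> x0 y0; apply: (@derive_ptt _ _ sL x y s
  (fun r => tau2 r * (x + y) + 2%:R * G1 r * Num.sqrt y + m r) _ x0 y0).
  by move=> r; exact: LE.
is_derive_calc.
  by repeat first [exact: is_derive_tau2 | exact: is_derive_G1
    | exact: is_derive_m | is_derive_step].
by cbv beta; ring.
Qed.

(** At y = r^2 the equation is polynomial in x and r: the terms in G1 / r cancel, again because d =
    1/4. The constant a + 1/4 is a + d. *)
Let last_eq (x r s : R) : 0 < x -> 0 < r ->
  tau3 s * (x + r ^+ 2) + 2%:R * G2 s * r + m1 s + (a + 4%:R^-1) * tau2 s = 0.
Proof.
move=> x0 r0; have rr0 : 0 < r ^+ 2 by rewrite exprn_gt0.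
have := det_u (det (positive_pt s x0 rr0)).
rewrite ptx pty (dt_L s x0 rr0) (dx_L s x0 rr0) (dy_L s x0 rr0) (dxx_L s x0 rr0).
rewrite (dyy_L s x0 rr0) sqrtr_sqr (gtr0_norm r0).
have : r != 0 by rewrite gt_eqF.
move: (tau3 s) (G2 s) (G1 s) (m1 s) (tau2 s) => t3 g2 g1 mm t2 rn0 e.
by rewrite -[RHS]e /d; field; rewrite rn0.
Qed.

Let constants (s : R) : [/\ tau3 s = 0, G2 s = 0 & m1 s = - (a + 4%:R^-1) * tau2 s].
Proof.
have lt02 : 0 < 2%:R :> R by [].
(* Comparing (x, r) = (1, 1) with (2, 1) isolates [tau3]; comparing it with (1, 2) then isolates
   [G2]. *)
have e1 := @last_eq 1 1 s ltr01 ltr01; have e2 := @last_eq 2%:R 1 s lt02 ltr01.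
have e3 := @last_eq 1 2%:R s ltr01 lt02.
move: (tau3 s) (G2 s) (m1 s) (tau2 s) e1 e2 e3 => t3 g2 mm t2 e1 e2 e3.
have t0 : t3 = 0 by lra.
have g0 : g2 = 0 by move: e1 e3; rewrite t0; lra.
by split=> //; move: e1; rewrite t0 g0; lra.
Qed.

Lemma affine_solution : exists c0 c1 c2 c3 c4 c5 : R,
  forall x y s : R, 0 < x -> 0 < y ->
  let t1 := 2%:R * c0 * s + 2%:R * c2 in
  [/\ F ix (pt x y s) = t1 * x,
      F iy (pt x y s) = t1 * y + (c4 - c3 * s) * Num.sqrt y,
      F it (pt x y s) = c0 * s ^+ 2 + 2%:R * c2 * s - c1 &
      L (pt x y s) = 2%:R * c0 * (x + y) - 2%:R * c3 * Num.sqrt y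
        - (a + 4%:R^-1) * t1 + c5].
Proof.
have t2E s : tau2 s = tau2 0.
  by apply: is_derive_0_is_cst => r; have [<- _ _] := constants r.
have g1E s : G1 s = G1 0.
  by apply: is_derive_0_is_cst => r; have [_ <- _] := constants r.
have t1E s : tau1 s = tau2 0 * s + tau1 0.
  have : tau1 s - tau2 0 * s = tau1 0 - tau2 0 * 0.
    apply: (@is_derive_0_is_cst _ (fun r => tau1 r - tau2 0 * r)) => r.
    is_derive_calc.
      by repeat first [exact: is_derive_tau1 | exact: is_derive_id | is_derive_step].
    by cbv beta; rewrite t2E; ring.
  by rewrite mulr0 subr0 => <-; rewrite addrC subrK.
have gE s : G s = G1 0 * s + G 0.
  have : G s - G1 0 * s = G 0 - G1 0 * 0.
    apply: (@is_derive_0_is_cst _ (fun r => G r - G1 0 * r)) => r.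
    is_derive_calc.
      by repeat first [exact: is_derive_G | exact: is_derive_id | is_derive_step].
    by cbv beta; rewrite g1E; ring.
  by rewrite mulr0 subr0 => <-; rewrite addrC subrK.
have tE s : tau s = tau2 0 / 2%:R * s ^+ 2 + tau1 0 * s + tau 0.
  have : tau s - (tau2 0 / 2%:R * s ^+ 2 + tau1 0 * s) =
      tau 0 - (tau2 0 / 2%:R * 0 ^+ 2 + tau1 0 * 0).
    apply: (@is_derive_0_is_cst _
      (fun r => tau r - (tau2 0 / 2%:R * r ^+ 2 + tau1 0 * r))) => r.
    is_derive_calc.
      by repeat first [exact: is_derive_tau | exact: is_derive_id | is_derive_step].
    by cbv beta; rewrite t1E /=; field.
  by rewrite expr0n /= !mulr0 addr0 subr0 => <-; rewrite addrC subrK.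
have mE s : m s = m 0 + (a + 4%:R^-1) * tau1 0 - (a + 4%:R^-1) * tau1 s.
  have : m s + (a + 4%:R^-1) * tau1 s = m 0 + (a + 4%:R^-1) * tau1 0.
    apply: (@is_derive_0_is_cst _ (fun r => m r + (a + 4%:R^-1) * tau1 r)) => r.
    is_derive_calc.
      by repeat first [exact: is_derive_m | exact: is_derive_tau1 | is_derive_step].
    by cbv beta; have [_ _ ->] := constants r; ring.
  by move=> <-; rewrite addrK.
(* These will be the coordinates on E, F, H, X, Y, Z. The halves and signs reflect that E, F, H have
   time components t^2, -1, 2 t and that X, Y have the parts - t sqrt y d/dy and sqrt y d/dy. *)
exists (tau2 0 / 2%:R), (- tau 0), (tau1 0 / 2%:R), (- G1 0), (G 0),
  (m 0 + (a + 4%:R^-1) * tau1 0) => x y s x0 y0 /=.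
rewrite xiE // etaE // LE // (time_component (sF it) Tx Ty) // -/(tau s).
rewrite (tE s) (mE s) (gE s) (g1E s) (t2E s) (t1E s).
move: (tau 0) (tau1 0) (tau2 0) (G 0) (G1 0) (m 0) => k1 k2 k3 k4 k5 k6.
by split; field.
Qed.

End Solution2.

(** * Converse: the explicit coefficients satisfy the determining system *)

Section ExplicitSolution.
Variables (R : realType) (a c0 c1 c2 c3 c4 c5 : R).
Variables (F : 'I_3 -> 'rV[R]_3 -> R) (L : 'rV[R]_3 -> R).
Hypotheses (sF : forall k, smooth_on (@positive_xy R) (F k)).
Hypothesis (sL : smooth_on (@positive_xy R) L).

Notation dx f := ('D_(delta_mx 0 ix) f).
Notation dy f := ('D_(delta_mx 0 iy) f).
Notation dt f := ('D_(delta_mx 0 it) f).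

Let t1 (s : R) : R := 2%:R * c0 * s + 2%:R * c2.
Let g (s : R) : R := c4 - c3 * s.

Hypothesis xiE : forall x y s : R, 0 < x -> 0 < y -> F ix (pt x y s) = t1 s * x.
Hypothesis etaE : forall x y s : R, 0 < x -> 0 < y ->
  F iy (pt x y s) = t1 s * y + g s * Num.sqrt y.
Hypothesis tauE : forall x y s : R, 0 < x -> 0 < y ->
  F it (pt x y s) = c0 * s ^+ 2 + 2%:R * c2 * s - c1.
Hypothesis LE : forall x y s : R, 0 < x -> 0 < y ->
  L (pt x y s) = 2%:R * c0 * (x + y) - 2%:R * c3 * Num.sqrt y
    - (a + 4%:R^-1) * t1 s + c5.

Let sD (f : 'rV[R]_3 -> R) e :
  smooth_on (@positive_xy R) f -> smooth_on (@positive_xy R) ('D_e f).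
Proof. exact: smooth_on_derive. Qed.

Variables (x y s : R).
Hypotheses (x0 : 0 < x) (y0 : 0 < y).

Let dx_tau (z : R) : 0 < z -> dx (F it) (pt z y s) = 0.
Proof.
move=> z0; apply: (@derive_ptx _ _ (sF it) z y s
  (fun=> c0 * s ^+ 2 + 2%:R * c2 * s - c1) _ z0 y0).
by move=> r r0; exact: tauE.
Qed.

Let dy_tau (z : R) : 0 < z -> dy (F it) (pt x z s) = 0.
Proof.
move=> z0; apply: (@derive_pty _ _ (sF it) x z s
  (fun=> c0 * s ^+ 2 + 2%:R * c2 * s - c1) _ x0 z0).
by move=> r r0; exact: tauE.
Qed.

Let dxx_tau : dx (dx (F it)) (pt x y s) = 0.
Proof. by apply: (@derive_ptx _ _ (sD _ (sF it)) x y s (fun=> 0) _ x0 y0). Qed.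

Let dyy_tau : dy (dy (F it)) (pt x y s) = 0.
Proof. by apply: (@derive_pty _ _ (sD _ (sF it)) x y s (fun=> 0) _ x0 y0). Qed.

Let dt_tau : dt (F it) (pt x y s) = t1 s.
Proof.
apply: (@derive_ptt _ _ (sF it) x y s
  (fun r => c0 * r ^+ 2 + 2%:R * c2 * r - c1) _ x0 y0).
  by move=> r; exact: tauE.
is_derive_calc; first by repeat first [exact: is_derive_id | is_derive_step].
by cbv beta; rewrite /= /t1; ring.
Qed.

Let dx_xi (z : R) : 0 < z -> dx (F ix) (pt z y s) = t1 s.
Proof.
move=> z0; apply: (@derive_ptx _ _ (sF ix) z y s (fun r => t1 s * r) _ z0 y0).
  by move=> r r0; exact: xiE.
is_derive_calc; first by repeat first [exact: is_derive_id | is_derive_step].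
by cbv beta; ring.
Qed.

Let dxx_xi : dx (dx (F ix)) (pt x y s) = 0.
Proof. by apply: (@derive_ptx _ _ (sD _ (sF ix)) x y s (fun=> t1 s) _ x0 y0). Qed.

Let dy_xi (z : R) : 0 < z -> dy (F ix) (pt x z s) = 0.
Proof.
move=> z0; apply: (@derive_pty _ _ (sF ix) x z s (fun=> t1 s * x) _ x0 z0).
by move=> r r0; exact: xiE.
Qed.

Let dyy_xi : dy (dy (F ix)) (pt x y s) = 0.
Proof. by apply: (@derive_pty _ _ (sD _ (sF ix)) x y s (fun=> 0) _ x0 y0). Qed.

Let is_derive_t1 (r : R) : is_derive r 1 t1 (2%:R * c0).
Proof.
is_derive_calc; first by repeat first [exact: is_derive_id | is_derive_step].
by cbv beta; ring.
Qed.

Let is_derive_g (r : R) : is_derive r 1 g (- c3).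
Proof.
is_derive_calc; first by repeat first [exact: is_derive_id | is_derive_step].
by cbv beta; ring.
Qed.

Let dt_xi : dt (F ix) (pt x y s) = 2%:R * c0 * x.
Proof.
apply: (@derive_ptt _ _ (sF ix) x y s (fun r => t1 r * x) _ x0 y0).
  by move=> r; exact: xiE.
is_derive_calc; first by repeat first [exact: is_derive_t1 | is_derive_step].
by cbv beta; ring.
Qed.

Let dx_eta (z : R) : 0 < z -> dx (F iy) (pt z y s) = 0.
Proof.
move=> z0; apply: (@derive_ptx _ _ (sF iy) z y s
  (fun=> t1 s * y + g s * Num.sqrt y) _ z0 y0).
by move=> r r0; exact: etaE.
Qed.

Let dxx_eta : dx (dx (F iy)) (pt x y s) = 0.
Proof. by apply: (@derive_ptx _ _ (sD _ (sF iy)) x y s (fun=> 0) _ x0 y0). Qed.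

Let dy_eta (z : R) : 0 < z ->
  dy (F iy) (pt x z s) = t1 s + g s / 2%:R / Num.sqrt z.
Proof.
move=> z0; apply: (@derive_pty _ _ (sF iy) x z s
  (fun r => t1 s * r + g s * Num.sqrt r) _ x0 z0).
  by move=> r r0; exact: etaE.
is_derive_calc.
  by repeat first [exact: is_derive_id | exact: is_derive_sqrt | is_derive_step].
by cbv beta; field; rewrite gt_eqF // sqrtr_gt0.
Qed.

Let dyy_eta :
  dy (dy (F iy)) (pt x y s) = - (g s / 4%:R) * (Num.sqrt y)^-1 ^+ 3.
Proof.
apply: (@derive_pty _ _ (sD _ (sF iy)) x y s
  (fun r => t1 s + g s / 2%:R / Num.sqrt r) _ x0 y0).
  exact: dy_eta.
is_derive_calc.
  by repeat first [exact: is_derive_sqrtV | is_derive_step].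
by cbv beta; field; rewrite gt_eqF // sqrtr_gt0.
Qed.

Let dt_eta : dt (F iy) (pt x y s) = 2%:R * c0 * y - c3 * Num.sqrt y.
Proof.
apply: (@derive_ptt _ _ (sF iy) x y s
  (fun r => t1 r * y + g r * Num.sqrt y) _ x0 y0).
  by move=> r; exact: etaE.
is_derive_calc.
  by repeat first [exact: is_derive_t1 | exact: is_derive_g | is_derive_step].
by cbv beta; ring.
Qed.

Let dx_L (z : R) : 0 < z -> dx L (pt z y s) = 2%:R * c0.
Proof.
move=> z0; apply: (@derive_ptx _ _ sL z y s
  (fun r => 2%:R * c0 * (r + y) - 2%:R * c3 * Num.sqrt y
    - (a + 4%:R^-1) * t1 s + c5) _ z0 y0).
  by move=> r r0; exact: LE.
is_derive_calc; first by repeat first [exact: is_derive_id | is_derive_step].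
by cbv beta; ring.
Qed.

Let dxx_L : dx (dx L) (pt x y s) = 0.
Proof. by apply: (@derive_ptx _ _ (sD _ sL) x y s (fun=> 2%:R * c0) _ x0 y0). Qed.

Let dy_L (z : R) : 0 < z -> dy L (pt x z s) = 2%:R * c0 - c3 / Num.sqrt z.
Proof.
move=> z0; apply: (@derive_pty _ _ sL x z s
  (fun r => 2%:R * c0 * (x + r) - 2%:R * c3 * Num.sqrt r
    - (a + 4%:R^-1) * t1 s + c5) _ x0 z0).
  by move=> r r0; exact: LE.
is_derive_calc.
  by repeat first [exact: is_derive_id | exact: is_derive_sqrt | is_derive_step].
by cbv beta; field; rewrite gt_eqF // sqrtr_gt0.
Qed.

Let dyy_L : dy (dy L) (pt x y s) = c3 / 2%:R * (Num.sqrt y)^-1 ^+ 3.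
Proof.
apply: (@derive_pty _ _ (sD _ sL) x y s
  (fun r => 2%:R * c0 - c3 / Num.sqrt r) _ x0 y0).
  exact: dy_L.
is_derive_calc.
  by repeat first [exact: is_derive_sqrtV | is_derive_step].
by cbv beta; field; rewrite gt_eqF // sqrtr_gt0.
Qed.

Let dt_L : dt L (pt x y s) = - (a + 4%:R^-1) * (2%:R * c0).
Proof.
apply: (@derive_ptt _ _ sL x y s
  (fun r => 2%:R * c0 * (x + y) - 2%:R * c3 * Num.sqrt y
    - (a + 4%:R^-1) * t1 r + c5) _ x0 y0).
  by move=> r; exact: LE.
is_derive_calc.
  by repeat first [exact: is_derive_t1 | is_derive_step].
by cbv beta; ring.
Qed.

Lemma explicit_determining :
  [/\ dx (F it) (pt x y s) = 0, dy (F it) (pt x y s) = 0,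
      dx (dx (F it)) (pt x y s) = 0, dy (dy (F it)) (pt x y s) = 0 &
      determining_eqs a (1 / 4%:R) F L (pt x y s)].
Proof.
split; [exact: dx_tau|exact: dy_tau|exact: dxx_tau|exact: dyy_tau|].
have yE : y = Num.sqrt y ^+ 2 by rewrite sqr_sqrtr // ltW.
have w0 : Num.sqrt y != 0 by rewrite gt_eqF // sqrtr_gt0.
split; rewrite ?ptx ?pty.
- by rewrite xiE // (dx_xi x0) dt_tau; ring.
- rewrite etaE // (dy_eta y0) dt_tau; move: (t1 s) (g s) => t k.
  by move: (Num.sqrt y) yE w0 => w -> w0; field.
- by rewrite (dx_eta x0) (dy_xi y0); ring.
- by rewrite (dx_L x0) dt_xi (dx_xi x0) (dy_xi y0) dxx_xi dyy_xi dt_tau; ring.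
- rewrite (dy_L y0) dt_eta (dx_eta x0) (dy_eta y0) dxx_eta dyy_eta dt_tau.
  move: (t1 s) (g s) => t k.
  by move: (Num.sqrt y) yE w0 => w -> w0; field.
- rewrite dt_L (dx_L x0) (dy_L y0) dxx_L dyy_L.
  by move: (Num.sqrt y) yE w0 => w -> w0; field.
Qed.

End ExplicitSolution.

(** * Elementary functions are smooth *)

Section ElementaryFunctions.
Variables (R : realType) (E : normedModType R) (O : set E).

Definition clinear (l : E -> R) : Prop :=
  (forall (c : R) x y, l (c *: x + y) = c *: l x + l y) /\ continuous l.

(** A class just large enough for the coefficients and closed under derivatives: differentiating
    sqrt produces 1/sqrt, whose derivative is again a product of such factors. There is no
    constructor for opposites, so the coefficients below use sums and products with signed
    constants. *)
Inductive elementary : (E -> R) -> Prop :=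
| elementary_const k : elementary (fun=> k)
| elementary_linear l : clinear l -> elementary l
| elementary_add f g : elementary f -> elementary g ->
    elementary (fun p => f p + g p)
| elementary_mul f g : elementary f -> elementary g ->
    elementary (fun p => f p * g p)
| elementary_sqrt l : clinear l -> (forall p, O p -> 0 < l p) ->
    elementary (fun p => Num.sqrt (l p))
| elementary_sqrtV l : clinear l -> (forall p, O p -> 0 < l p) ->
    elementary (fun p => (Num.sqrt (l p))^-1).

Lemma elementary_continuous f p : elementary f -> O p -> {for p, continuous f}.
Proof.
move=> + Op; elim=> {f}.
- by move=> k; exact: cvg_cst.
- by move=> l [_ cl]; exact: cl.
- by move=> f g _ cf _ cg; exact: cvgD.
- by move=> f g _ cf _ cg; exact: cvgM.
- move=> l [_ cl] _.
  exact: (@continuous_comp _ _ _ l Num.sqrt p (cl p) (@sqrt_continuous _ _)).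
- move=> l [_ cl] l0; apply: cvgV; first by rewrite gt_eqF // sqrtr_gt0 l0.
  exact: (@continuous_comp _ _ _ l Num.sqrt p (cl p) (@sqrt_continuous _ _)).
Qed.

Lemma elementary_derive f e : elementary f ->
  exists2 g, elementary g & forall p, O p -> is_derive p e f (g p).
Proof.
elim=> {f}.
- move=> k; exists (fun=> 0); first exact: elementary_const.
  by move=> p _; exact: is_derive_const.
- move=> l [hl cl]; exists (fun=> l e); first exact: elementary_const.
  by move=> p _; exact: is_derive_linear.
- move=> f g _ [f' ef' f'E] _ [g' eg' g'E].
  exists (fun p => f' p + g' p); first exact: elementary_add.
  by move=> p Op; apply: is_derive_add; [exact: f'E|exact: g'E].
- move=> f g ef [f' ef' f'E] eg [g' eg' g'E].
  exists (fun p => f' p * g p + f p * g' p).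
    by apply: elementary_add; exact: elementary_mul.
  by move=> p Op; apply: is_derive_mul; [exact: f'E|exact: g'E].
- move=> l [hl cl] l0.
  exists (fun p => 2%:R^-1 * (Num.sqrt (l p))^-1 * l e).
    apply: elementary_mul; last exact: elementary_const.
    apply: elementary_mul; first exact: elementary_const.
    exact: elementary_sqrtV.
  move=> p Op; apply: (is_derive_comp (is_derive_linear p e hl)).
  exact: is_derive_sqrt (l0 p Op).
- move=> l [hl cl] l0.
  exists (fun p => - 2%:R^-1 * ((Num.sqrt (l p))^-1 *
    ((Num.sqrt (l p))^-1 * (Num.sqrt (l p))^-1)) * l e).
    have ev := elementary_sqrtV (conj hl cl) l0.
    apply: elementary_mul; last exact: elementary_const.
    apply: elementary_mul; first exact: elementary_const.
    by do 2 apply: elementary_mul => //.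
  move=> p Op.
  have := is_derive_comp (g := fun s => (Num.sqrt s)^-1)
    (is_derive_linear p e hl) (is_derive_sqrtV (l0 p Op)).
  by rewrite exprS expr2.
Qed.

Hypothesis oO : open O.

(** Coinduction on the class of functions that agree on [O] with a smooth one; needed because fields
    are cut off to 0 outside [O]. *)
Lemma smooth_on_eq (F : normedModType R) (f g : E -> F) :
  (forall p, O p -> f p = g p) -> smooth_on O f -> smooth_on O g.
Proof.
move=> fg sf.
pose C : set (E -> F) := [set h | exists2 k, smooth_on O k &
  forall p, O p -> k p = h p].
apply: (@smooth_on_coind _ _ _ O C oO); last by exists f.
  move=> h p [k sk kh] Op; have [ck _] := sk [::] p Op.
  suff : h @ p --> h p by [].
  rewrite -kh //; apply: cvg_trans ck; apply: near_eq_cvg.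
  by near=> q; rewrite /= kh //; near: q; exact: open_nbhs_nbhs.
move=> h e [k sk kh]; exists ('D_e k).
  by exists ('D_e k) => //; exact: smooth_on_derive.
move=> p Op; apply: (is_derive_near oO Op kh).
exact: smooth_on_is_derive sk Op.
Unshelve. all: by end_near. Qed.

End ElementaryFunctions.

(** * Vector fields with elementary coefficients *)

Section ElementaryFields.
Variables (R : realType) (n : nat) (O : set (base R n)).
Hypothesis oO : open O.

Lemma clinear_x (k : 'I_n) : clinear (fun p : base R n => p.1 0 k).
Proof. by split; [exact: xi_linear|exact: xi_continuous]. Qed.

Lemma clinear_u : clinear (fun p : base R n => p.2).
Proof. by split=> // p; exact: cvg_snd. Qed.

Lemma base_sum (w : 'I_n -> R) (u : R) : ((\row_k w k, u) : base R n) =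
  \sum_k w k *: ((delta_mx 0 k, 0) : base R n) + u *: ((0, 1) : base R n).
Proof.
have -> : \sum_k w k *: ((delta_mx 0 k, 0) : base R n) =
    ((\sum_k w k *: delta_mx 0 k, 0) : base R n).
  rewrite (big_morph (fun M : 'rV[R]_n => (M, 0) : base R n)
    (id1 := 0) (op1 := +%R)) //; last first.
    by move=> M N; congr (_, _); rewrite /= addr0.
  by apply: eq_bigr => k _; congr (_, _); rewrite /= scaler0.
congr (_, _); last by rewrite /= add0r [RHS]mulr1.
rewrite /= scaler0 addr0 [LHS]row_sum_delta.
by apply: eq_bigr => k _; rewrite mxE.
Qed.

(** Writing a field with constant vectors and scalar coefficients reduces its derivatives and limits
    to those of the coefficients. *)
Lemma vfield_sum (v : vfield R n) : v = fun q =>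
  \sum_k xi v k q *: ((delta_mx 0 k, 0) : base R n)
  + phi v q *: ((0, 1) : base R n).
Proof.
apply/funext => q; rewrite -base_sum [LHS]surjective_pairing; congr (_, _).
by apply/rowP => k; rewrite mxE.
Qed.

Lemma is_derive_vfield (v : vfield R n) p e (d : 'I_n -> R) (du : R) :
  (forall k, is_derive p e (xi v k) (d k)) -> is_derive p e (phi v) du ->
  is_derive p e v ((\row_k d k, du) : base R n).
Proof.
move=> hd hu; rewrite base_sum [X in is_derive _ _ X]vfield_sum.
apply: is_derive_add; last exact: is_derive_scalel.
by apply: is_derive_big => k; exact: is_derive_scalel.
Qed.

Definition elementary_field (v : vfield R n) : Prop :=
  (forall k, elementary O (xi v k)) /\ elementary O (phi v).

Lemma elementary_field_smooth v : elementary_field v -> smooth_on O v.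
Proof.
apply: (smooth_on_coind oO) => {v}.
  move=> v p [ev evu] Op.
  have c : (fun q => \sum_k xi v k q *: ((delta_mx 0 k, 0) : base R n)
      + phi v q *: ((0, 1) : base R n)) @ p -->
      \sum_k xi v k p *: ((delta_mx 0 k, 0) : base R n)
      + phi v p *: ((0, 1) : base R n).
    apply: cvgD; last by apply: cvgZr_tmp; exact: elementary_continuous evu Op.
    apply: cvg_big => [|k _]; first exact: add_continuous.
    by apply: cvgZr_tmp; exact: elementary_continuous (ev k) Op.
  have vp := congr1 (@^~ p) (vfield_sum v).
  suff : v @ p --> v p by [].
  by rewrite -vfield_sum -vp in c.
move=> v e [ev evu].
have /choice[g gP] : forall k, exists g, elementary O g /\
    forall p, O p -> is_derive p e (xi v k) (g p).
  by move=> k; have [g eg gE] := elementary_derive e (ev k); exists g.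
have [h eh hE] := elementary_derive e evu.
exists (fun p => (\row_k g k p, h p)).
  split; last exact: eh.
  move=> k; have [egk _] := gP k.
  by rewrite (_ : xi _ k = g k) //; apply/funext => p; rewrite /xi mxE.
move=> p Op; apply: is_derive_vfield; last exact: hE.
by move=> k; have [_] := gP k; apply.
Qed.

End ElementaryFields.

(** * The symmetry algebra of the affine equation *)

Section AffineFields.
Variable R : realType.

Definition coef6 (c : 'rV[R]_6) (k : nat) : R := c 0 (inord k).

Lemma coef6_0 k : coef6 0 k = 0.
Proof. by rewrite /coef6 mxE. Qed.

Definition row6 (c0 c1 c2 c3 c4 c5 : R) : 'rV[R]_6 :=
  \row_j nth 0 [:: c0; c1; c2; c3; c4; c5] j.

Lemma coef6_row c0 c1 c2 c3 c4 c5 k : (k < 6)%N ->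
  coef6 (row6 c0 c1 c2 c3 c4 c5) k = nth 0 [:: c0; c1; c2; c3; c4; c5] k.
Proof. by move=> k6; rewrite /coef6 mxE inordK. Qed.

Variables (a : R) (c : 'rV[R]_6).

Definition L_tau1 (t : R) : R := 2%:R * coef6 c 0 * t + 2%:R * coef6 c 2.

(* The coefficients of the combination of E, F, H, X, Y, Z with coordinates c,
   under E |-> t^2 d/dt + ..., F |-> - d/dt, H |-> 2 t d/dt + ...,
   X |-> - t sqrt y d/dy + ..., Y |-> sqrt y d/dy, Z |-> u d/du. *)
Definition L_xi (k : 'I_3) (q : 'rV[R]_3) : R :=
  nth 0 [:: L_tau1 (q 0 it) * q 0 ix;
    L_tau1 (q 0 it) * q 0 iy
      + (coef6 c 4 + - coef6 c 3 * q 0 it) * Num.sqrt (q 0 iy);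
    coef6 c 0 * (q 0 it * q 0 it) + 2%:R * coef6 c 2 * q 0 it + - coef6 c 1] k.

Definition L_lambda (q : 'rV[R]_3) : R :=
  2%:R * coef6 c 0 * (q 0 ix + q 0 iy)
  + - (2%:R * coef6 c 3) * Num.sqrt (q 0 iy)
  + - (a + 4%:R^-1) * L_tau1 (q 0 it) + coef6 c 5.

(** Defined on the whole space, so that the rules of calculus apply before the cut-off to the
    quadrant. *)
Definition L_formula : vfield R 3 :=
  fun p => (\row_k L_xi k p.1, L_lambda p.1 * p.2).

Definition L_field : vfield R 3 := on_domain (@quadrant R) L_formula.

Lemma L_fieldE p : quadrant p -> L_field p = L_formula p.
Proof. by move=> Op; rewrite /L_field /on_domain patchT // inE. Qed.

Lemma L_field_out p : ~ quadrant p -> L_field p = 0.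
Proof. by move=> Op; rewrite /L_field /on_domain patchC // inE. Qed.

Lemma open_quadrant : open (@quadrant R).
Proof.
apply: (@open_comp _ _ fst (@positive_xy R)); last exact: open_positive_xy.
by move=> p _; exact: cvg_fst.
Qed.

Lemma L_formula_elementary : elementary_field (@quadrant R) L_formula.
Proof.
have ex k : elementary (@quadrant R) (fun p : base R 3 => p.1 0 k).
  exact/elementary_linear/clinear_x.
have eu : elementary (@quadrant R) (fun p : base R 3 => p.2).
  exact/elementary_linear/clinear_u.
have es : elementary (@quadrant R) (fun p : base R 3 => Num.sqrt (p.1 0 iy)).
  by apply: elementary_sqrt; [exact: clinear_x|move=> p []].
split.
  move=> k; rewrite (_ : xi _ k = fun p => L_xi k p.1); last first.
    by apply/funext => p; rewrite /xi mxE.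
  move: k; apply: ord3P; rewrite /L_xi /L_tau1 /=;
  repeat first [exact: ex | exact: es | exact: elementary_const
    | apply: elementary_add | apply: elementary_mul].
rewrite /phi /L_formula /= /L_lambda /L_tau1.
by repeat first [exact: ex | exact: es | exact: eu | exact: elementary_const
    | apply: elementary_add | apply: elementary_mul].
Qed.

Lemma L_formula_smooth : smooth_on (@quadrant R) L_formula.
Proof. exact: elementary_field_smooth open_quadrant _ L_formula_elementary. Qed.

Lemma L_xi_smooth k : smooth_on (@positive_xy R) (L_xi k).
Proof.
have := @smooth_slice _ _ (@quadrant R) (@positive_xy R) L_formula
  (fun p => p.1 0 k) 0 (@open_positive_xy R) (@xi_linear R 3 k) (@xi_continuous R 3 k)
  (fun q h => h) L_formula_smooth.
by congr (smooth_on _ _); apply/funext => q; rewrite mxE.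
Qed.

Lemma L_lambda_smooth : smooth_on (@positive_xy R) L_lambda.
Proof.
have [lu cu] := @clinear_u R 3.
have := @smooth_slice _ _ (@quadrant R) (@positive_xy R) L_formula
  (fun p => p.2) 1 (@open_positive_xy R) lu cu (fun q h => h) L_formula_smooth.
by congr (smooth_on _ _); apply/funext => q; rewrite /= mulr1.
Qed.

Lemma L_field_in : L a 0 (1 / 4%:R) 0 L_field.
Proof.
have vE (p : base R 3) : positive_xy p.1 ->
    L_field p = (\row_k L_xi k p.1, L_lambda p.1 * p.2).
  by move=> Op; rewrite L_fieldE.
split; last first.
  by exists L_lambda => p Op; rewrite /phi L_fieldE.
split.
  split; last exact: L_field_out.
  apply: (smooth_on_eq open_quadrant) L_formula_smooth => p Op.
  by rewrite L_fieldE.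
move=> z Oz zT Dz.
have [x [y [s [x0 y0 qE]]]] := positive_coord Oz.
have H := @explicit_determining R a (coef6 c 0) (coef6 c 1) (coef6 c 2)
  (coef6 c 3) (coef6 c 4) (coef6 c 5) L_xi L_lambda L_xi_smooth L_lambda_smooth.
have [] := H _ _ _ _ x y s x0 y0.
- by move=> x' y' s' _ _; rewrite /L_xi /L_tau1 /= !ptx !ptt.
- by move=> x' y' s' _ _; rewrite /L_xi /L_tau1 /= !pty !ptt mulNr.
- by move=> x' y' s' _ _; rewrite /L_xi /= !ptt expr2.
- move=> x' y' s' _ _; rewrite /L_lambda /L_tau1 /= !ptx !pty !ptt.
  by rewrite !mulNr.
move=> Tx Ty Txx Tyy D.
have Qq : positive_xy (pt x y s) by exact: positive_pt.
exact: (@symmetry_of_determining R a (1 / 4%:R) L_xi L_lambda L_field (pt x y s)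
  L_xi_smooth L_lambda_smooth vE Qq Tx Ty Txx Tyy z D qE zT Dz).
Qed.

End AffineFields.

(** The determining system fixes the field on the quadrant, and [smooth_vfield] makes it 0
    elsewhere, so the two fields are equal as functions. *)
Lemma L_range (R : realType) (a : R) : a <> 1 / 4%:R -> a <> 3%:R / 4%:R ->
  forall v, L a 0 (1 / 4%:R) 0 v -> exists c, v = L_field a c.
Proof.
move=> ha ha' v [[sv sym] lam].
have symp p : quadrant p -> forall z : jet2 R 3, z.1.1 = p -> z.2^T = z.2 ->
    Delta a 0 (1 / 4%:R) 0 z = 0 -> 'D_(pr2 v z) (Delta a 0 (1 / 4%:R) 0) z = 0.
  by move=> Op z zp; apply: sym; rewrite zp.
have fo p (Op : quadrant p) := sym_first_order Op (symp p Op).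
have [F [L [sF sL vE]]] := symmetry_reduction (@open_positive_xy R)
  (fun p => erefl) sv lam (fun k p Op => let: And4 h _ _ _ := fo p Op in h k).
have DT k q : positive_xy q ->
    'D_(dx0 R k) (xi v it) (q, 0) = 'D_(delta_mx 0 k) (F it) q.
  by move=> Qq; rewrite (derive_xi_red (@open_positive_xy R) vE) // derive_dx0_fst.
have Tx q : positive_xy q -> 'D_(delta_mx 0 ix) (F it) q = 0.
  by move=> Qq; rewrite -DT //; have [] := fo (q, 0) Qq.
have Ty q : positive_xy q -> 'D_(delta_mx 0 iy) (F it) q = 0.
  by move=> Qq; rewrite -DT //; have [] := fo (q, 0) Qq.
have D0 k (f : 'rV[R]_3 -> R) q : (forall q, positive_xy q -> f q = 0) ->
    positive_xy q -> 'D_(delta_mx 0 k) f q = 0.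
  move=> f0 Qq.
  rewrite (@derive_near _ _ _ f (fun=> 0) _ _ _ (@open_positive_xy R) Qq f0).
  exact: derive_cst.
have det q : positive_xy q -> determining_eqs a (1 / 4%:R) F L q.
  move=> Qq.
  apply: (determining_of_symmetry sF sL vE Qq (Tx q Qq) (Ty q Qq)
    (D0 _ _ _ Tx Qq) (D0 _ _ _ Ty Qq)) => z zq.
  by apply: sym; rewrite /quadrant /= zq.
have [c0 [c1 [c2 [c3 [c4 [c5 cE]]]]]] := affine_solution ha ha' sF sL Tx Ty det.
exists (row6 c0 c1 c2 c3 c4 c5).
apply/funext => p; have [Op|Op] := pselect (quadrant p); last first.
  by rewrite L_field_out //; have [_ ->] := sv.
rewrite L_fieldE // vE // /L_formula.
have [x [y [s [x0 y0 qE]]]] := positive_coord Op.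
have [h1 h2 h3 h4] := cE x y s x0 y0.
congr (_, _).
  apply/rowP; apply: ord3P; rewrite !mxE qE ?h1 ?h2 ?h3 /L_xi /L_tau1 /=;
  by rewrite !coef6_row //= ?ptx ?pty ?ptt; ring.
congr (_ * _); rewrite qE h4 /L_lambda /L_tau1 !coef6_row //= ptx pty ptt.
by ring.
Qed.

(** * The algebra M *)

Section Transport.
Variable R : realType.

Lemma coef6_inj (x y : 'rV[R]_6) :
  (forall k, (k < 6)%N -> coef6 x k = coef6 y k) -> x = y.
Proof.
move=> h; apply/rowP => j; have := h j (ltn_ord j); rewrite /coef6.
by rewrite (_ : inord j = j) //; apply: val_inj; rewrite /= inordK.
Qed.

Lemma coef6_lin (x y : 'rV[R]_6) (k : R) j :
  coef6 (k *: x + y) j = k * coef6 x j + coef6 y j.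
Proof. by rewrite /coef6 !mxE. Qed.

Lemma coef6_basis i j : (i < 6)%N -> (j < 6)%N ->
  coef6 (M_basis R i) j = (i == j)%:R.
Proof.
move=> hi hj; rewrite /coef6 /M_basis mxE eqxx /= eq_sym.
by congr (_%:R); rewrite -val_eqE /= !inordK.
Qed.

(** The double sum over the bracket table as six explicit bilinear forms; identities in M then
    become ring identities, one coordinate at a time. *)
Lemma M_bracket_coef (x y : 'rV[R]_6) k : (k < 6)%N ->
  let a := coef6 x in let b := coef6 y in
  coef6 (M_bracket x y) k = nth 0
    [:: 2%:R * (a 2%N * b 0%N - a 0%N * b 2%N);
        2%:R * (a 1%N * b 2%N - a 2%N * b 1%N);
        a 0%N * b 1%N - a 1%N * b 0%N;
        a 0%N * b 4%N - a 4%N * b 0%N + (a 2%N * b 3%N - a 3%N * b 2%N);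
        a 1%N * b 3%N - a 3%N * b 1%N - (a 2%N * b 4%N - a 4%N * b 2%N);
        a 3%N * b 4%N - a 4%N * b 3%N] k.
Proof.
move=> k6 a b.
have coefD (u v : 'rV[R]_6) j : coef6 (u + v) j = coef6 u j + coef6 v j.
  by rewrite /coef6 mxE.
have coefZ (c : R) (u : 'rV[R]_6) j : coef6 (c *: u) j = c * coef6 u j.
  by rewrite /coef6 mxE.
have coefN (u : 'rV[R]_6) j : coef6 (- u) j = - coef6 u j by rewrite /coef6 mxE.
have coef0 j : coef6 (0 : 'rV[R]_6) j = 0 by rewrite /coef6 mxE.
have xE (z : 'rV[R]_6) (i : 'I_6) : z 0 i = coef6 z i.
  by rewrite /coef6; congr (z 0 _); apply: val_inj; rewrite /= inordK.
rewrite /M_bracket !big_ord_recl !big_ord0 !xE /= /bump /= !addn0 !add1n.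
rewrite !(coefD, coefZ, coefN, coef0, coef6_basis) //.
by move: k k6 => [|[|[|[|[|[|//]]]]]] _ /=; rewrite -/a -/b; ring.
Qed.

Ltac M_coef := apply: coef6_inj; move=> [|[|[|[|[|[|//]]]]]] _;
  rewrite ?coef6_lin !M_bracket_coef //= ?coef6_lin ?M_bracket_coef //=; ring.

Lemma M_bracket_linl (k : R) (u v w : 'rV[R]_6) :
  M_bracket (k *: u + v) w = k *: M_bracket u w + M_bracket v w.
Proof. by M_coef. Qed.

Lemma M_bracket_linr (k : R) (u v w : 'rV[R]_6) :
  M_bracket w (k *: u + v) = k *: M_bracket w u + M_bracket w v.
Proof. by M_coef. Qed.

Lemma M_bracket_alt (u : 'rV[R]_6) : M_bracket u u = 0.
Proof.
apply: coef6_inj => k k6; rewrite M_bracket_coef // coef6_0.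
by move: k k6 => [|[|[|[|[|[|//]]]]]] _ /=; ring.
Qed.

Lemma M_jacobi (u v w : 'rV[R]_6) : M_bracket u (M_bracket v w)
  + M_bracket v (M_bracket w u) + M_bracket w (M_bracket u v) = 0.
Proof.
apply: coef6_inj => k k6; rewrite /coef6 !mxE -!/(coef6 _ _).
by move: k k6 => [|[|[|[|[|[|//]]]]]] _; rewrite !M_bracket_coef //=; ring.
Qed.

Variables (V : lmodType R) (Phi : 'rV[R]_6 -> V) (S : set V) (br : V -> V -> V).
Hypothesis Phi_lin : forall (k : R) x y, Phi (k *: x + y) = k *: Phi x + Phi y.
Hypothesis Phi_ker : forall x, Phi x = 0 -> x = 0.
Hypothesis Phi_br : forall x y, br (Phi x) (Phi y) = Phi (M_bracket x y).
Hypothesis S_Phi : forall x, S (Phi x).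
Hypothesis S_range : forall v, S v -> exists x, v = Phi x.

Let Phi0 : Phi 0 = 0.
Proof.
by have := Phi_lin (-1) 0 0; rewrite scaler0 addr0 scaleN1r addNr.
Qed.

Let Phi_inj : injective Phi.
Proof.
move=> x y xy; apply/eqP; rewrite -subr_eq0; apply/eqP/Phi_ker.
by rewrite addrC -scaleN1r Phi_lin xy scaleN1r addNr.
Qed.

(** Every axiom is pulled back along [Phi], so the Jacobi identity is needed in M only and second
    derivatives of fields do not enter. *)
Lemma transport_lie_algebra : lie_algebra_on S br.
Proof.
split.
- by rewrite -Phi0.
- move=> u v /S_range[x ->] /S_range[y ->].
  by rewrite -[Phi x]scale1r -Phi_lin.
- by move=> c u /S_range[x ->]; rewrite -[_ *: _]addr0 -Phi0 -Phi_lin.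
- by move=> u v /S_range[x ->] /S_range[y ->]; rewrite Phi_br.
- move=> c u v w /S_range[x ->] /S_range[y ->] /S_range[z ->].
  by rewrite -Phi_lin !Phi_br M_bracket_linl Phi_lin.
- move=> c u v w /S_range[x ->] /S_range[y ->] /S_range[z ->].
  by rewrite -Phi_lin !Phi_br M_bracket_linr Phi_lin.
- by move=> u /S_range[x ->]; rewrite Phi_br M_bracket_alt.
- move=> u v w /S_range[x ->] /S_range[y ->] /S_range[z ->].
  rewrite !Phi_br -[Phi (M_bracket x _)]scale1r -Phi_lin -[Phi (_ + _)]scale1r.
  by rewrite -Phi_lin !scale1r M_jacobi.
Qed.

Lemma transport_from_M :
  lie_isomorphic [set: 'rV[R]_6] (@M_bracket R) S br.
Proof.
exists Phi; split=> //.
split.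
- by move=> x _ /=.
- by move=> x y _ _; exact: Phi_inj.
- by move=> v /S_range[x ->]; exists x.
Qed.

Lemma transport_to_M :
  lie_isomorphic S br [set: 'rV[R]_6] (@M_bracket R).
Proof.
(* The inverse of [Phi] must be a total function; outside [S] it takes the value 0. *)
have /choice[Psi PsiE] : forall v, exists x, S v -> v = Phi x.
  move=> v; have [/S_range[x ->]|nS] := pselect (S v); first by exists x.
  by exists 0.
have PsiK x : Psi (Phi x) = x by apply: Phi_inj; rewrite -PsiE.
exists Psi; split.
- split.
  + by move=> v _.
  + by move=> u v; rewrite !inE => /S_range[x ->] /S_range[y ->]; rewrite !PsiK => ->.
  + by move=> x _; exists (Phi x).
- move=> c u v /S_range[x ->] /S_range[y ->].
  by rewrite -Phi_lin !PsiK.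
- by move=> u v /S_range[x ->] /S_range[y ->]; rewrite Phi_br !PsiK.
Qed.

End Transport.

(** * Brackets and basis of the symmetry algebra *)

(** On an open set the bracket of the cut-off fields v', w' may be computed from the globally
    defined formulas v, w. *)
Lemma vbracketE (R : realType) n (O : set (base R n)) (v w v' w' : vfield R n)
    p dv dw : open O -> O p ->
  (forall q, O q -> v' q = v q) -> (forall q, O q -> w' q = w q) ->
  is_derive p (v p) w dw -> is_derive p (w p) v dv ->
  vbracket O v' w' p = dw - dv.
Proof.
move=> oO Op vE wE hw hv; rewrite /vbracket /on_domain patchT ?inE //.
rewrite (derive_near _ oO Op vE) (derive_near _ oO Op wE) vE // wE //.
by congr (_ - _); apply: derive_val.
Qed.

Section LFieldAlgebra.
Variables (R : realType) (a : R).

Lemma L_field_lin (k : R) (x y : 'rV[R]_6) :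
  L_field a (k *: x + y) = k *: L_field a x + L_field a y.
Proof.
apply/funext => p; rewrite [RHS]/GRing.add /= [in RHS]/GRing.scale /=.
have [Op|Op] := pselect (quadrant p); last first.
  by rewrite !L_field_out // scaler0 addr0.
rewrite !L_fieldE //; congr (_, _).
  apply/rowP; apply: ord3P; rewrite !mxE /L_xi /L_tau1 /= !coef6_lin; ring.
by rewrite /= /L_lambda /L_tau1 !coef6_lin /GRing.scale /=; ring.
Qed.

Lemma L_field_ker (c : 'rV[R]_6) : L_field a c = 0 -> c = 0.
Proof.
move=> c0.
have H t k : L_xi c k (pt 1 1 t) = 0.
  have : L_field a c (pt 1 1 t, 1) = 0 by rewrite c0.
  rewrite L_fieldE; last exact: positive_pt.
  by move=> /(congr1 (fun p : base R 3 => p.1 0 k)); rewrite !mxE.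
have Hl : L_lambda a c (pt 1 1 0) = 0.
  have : L_field a c (pt 1 1 0, 1) = 0 by rewrite c0.
  rewrite L_fieldE; last exact: positive_pt.
  by move=> /(congr1 (fun p : base R 3 => p.2)); rewrite /= mulr1.
(* The quadratic tau at t = 0, 1, -1 gives the coordinates on E, F, H; eta at t = 0, 1 then gives
   those on X, Y, and lambda the one on Z. *)
have := H 0 it; have := H 1 it; have := H (-1) it; have := H 0 iy.
have := H 1 iy; move: Hl; rewrite /L_lambda /L_xi /L_tau1 /=.
rewrite !ptx !pty !ptt sqrtr1 => e1 e2 e3 e4 e5 e6.
have c10 : coef6 c 1 = 0 by lra.
have c00 : coef6 c 0 = 0 by lra.
have c20 : coef6 c 2 = 0 by lra.
have c40 : coef6 c 4 = 0 by move: e3; rewrite c00 c20; lra.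
have c30 : coef6 c 3 = 0 by move: e2; rewrite c00 c20 c40; lra.
have c50 : coef6 c 5 = 0 by move: e1; rewrite c00 c20 c30; lra.
apply: coef6_inj => k k6; rewrite coef6_0.
by move: k k6 => [|[|[|[|[|[|//]]]]]].
Qed.

Lemma is_derive_base_x n (e p : base R n) k :
  is_derive p e (fun q : base R n => q.1 0 k) (e.1 0 k).
Proof.
exact: (@is_derive_linear _ _ _ (fun q : base R n => q.1 0 k) p e (@xi_linear R n k)).
Qed.

Lemma is_derive_base_sqrt n (e p : base R n) k : 0 < p.1 0 k ->
  is_derive p e (fun q : base R n => Num.sqrt (q.1 0 k))
    (2%:R^-1 * (Num.sqrt (p.1 0 k))^-1 * e.1 0 k).
Proof.
by move=> p0; exact: (is_derive_comp (is_derive_base_x e p k) (is_derive_sqrt p0)).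
Qed.

Definition L_dxi (c : 'rV[R]_6) (p e : base R 3) (k : 'I_3) : R :=
  let t1 := L_tau1 c (p.1 0 it) in
  let g := coef6 c 4 - coef6 c 3 * p.1 0 it in
  let r := Num.sqrt (p.1 0 iy) in
  nth 0 [:: 2%:R * coef6 c 0 * e.1 0 it * p.1 0 ix + t1 * e.1 0 ix;
    2%:R * coef6 c 0 * e.1 0 it * p.1 0 iy + t1 * e.1 0 iy
      - coef6 c 3 * e.1 0 it * r + g * (2%:R^-1 * r^-1 * e.1 0 iy);
    t1 * e.1 0 it] k.

Definition L_dphi (c : 'rV[R]_6) (p e : base R 3) : R :=
  let r := Num.sqrt (p.1 0 iy) in
  (2%:R * coef6 c 0 * (e.1 0 ix + e.1 0 iy)
    - 2%:R * coef6 c 3 * (2%:R^-1 * r^-1 * e.1 0 iy)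
    - (a + 4%:R^-1) * (2%:R * coef6 c 0 * e.1 0 it)) * p.2
  + L_lambda a c p.1 * e.2.

Lemma is_derive_L_formula (c : 'rV[R]_6) (p e : base R 3) : quadrant p ->
  is_derive p e (L_formula a c) ((\row_k L_dxi c p e k, L_dphi c p e) : base R 3).
Proof.
move=> [_ y0]; apply: is_derive_vfield.
  move=> k; rewrite (_ : xi _ k = fun p => L_xi c k p.1); last first.
    by apply/funext => q; rewrite /xi mxE.
  move: k; apply: ord3P; rewrite /L_xi /L_dxi /L_tau1 /=; is_derive_calc;
    try by repeat first [exact: is_derive_base_x | exact: is_derive_base_sqrt
      | is_derive_step].
  - by cbv beta; ring.
  - by cbv beta; ring.
  - by cbv beta; ring.
rewrite /phi /L_formula /= /L_dphi /L_lambda /L_tau1; is_derive_calc.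
  by repeat first [exact: is_derive_base_x | exact: is_derive_base_sqrt
      | exact: is_derive_base_u | is_derive_step].
by cbv beta; ring.
Qed.

(** The images of F and X have to be -v3 and -v4: the bracket of v1 and v3 has time component - 2 t,
    and that of v1 and v5 is -v4. *)
Lemma L_field_bracket (x y : 'rV[R]_6) :
  L_bracket (L_field a x) (L_field a y) = L_field a (M_bracket x y).
Proof.
apply/funext => p; have [Op|Op] := pselect (quadrant p); last first.
  by rewrite L_field_out // /L_bracket /vbracket /on_domain patchC // inE.
rewrite L_fieldE // /L_bracket (vbracketE (@open_quadrant R) Op
  (L_fieldE a x) (L_fieldE a y) (is_derive_L_formula y _ Op)
  (is_derive_L_formula x _ Op)).
have y0 : 0 < p.1 0 iy by case: Op.
have yE : p.1 0 iy = Num.sqrt (p.1 0 iy) ^+ 2 by rewrite sqr_sqrtr // ltW.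
have w0 : Num.sqrt (p.1 0 iy) != 0 by rewrite gt_eqF // sqrtr_gt0.
have Fx (c : 'rV[R]_6) k : (L_formula a c p).1 0 k = L_xi c k p.1 by rewrite mxE.
congr (_, _).
  apply/rowP; apply: ord3P; rewrite !mxE /L_dxi /= !Fx /L_xi /L_tau1 /=
    !M_bracket_coef //=.
  - by ring.
  - by move: w0 yE; move: (Num.sqrt (p.1 0 iy)) => w w0 ->; field.
  - by ring.
rewrite /= /L_dphi !Fx /= /L_lambda /L_xi /L_tau1 /= !M_bracket_coef //=.
by move: w0 yE; move: (Num.sqrt (p.1 0 iy)) => w w0 ->; field.
Qed.

End LFieldAlgebra.

(** * The fields v1, ..., v6 in coordinates *)

Section LBasis.
Variables (R : realType) (a : R).

Lemma mkfield_L (f : R -> R -> R -> R -> R * R * R * R) (c : 'rV[R]_6) :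
  (forall x y t u, 0 < x -> 0 < y ->
    f x y t u = (L_xi c ix (pt x y t), L_xi c iy (pt x y t),
      L_xi c it (pt x y t), L_lambda a c (pt x y t) * u)) ->
  mkfield f = L_field a c.
Proof.
move=> fE; apply/funext => p; have [Op|Op] := pselect (quadrant p); last first.
  by rewrite L_field_out // /mkfield /on_domain patchC // inE.
rewrite L_fieldE // /mkfield /on_domain patchT ?inE //.
have [x0 y0] := Op; by rewrite fE // pt_coord; congr (_, _).
Qed.

Ltac field_of_row :=
  apply: mkfield_L => x y t u _ _;
  rewrite /L_xi /L_lambda /L_tau1 /= !coef6_row //= ptx pty ptt;
  congr (_, _, _, _); by field.

Lemma v1_L : v1 a = L_field a (row6 1 0 0 0 0 0).
Proof. by field_of_row. Qed.

(** The bracket of v1 and v3 is -2 v2 + 2 (a + 1/4) v6, so H corresponds to 2 v2 shifted by a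
    multiple of the central v6, and v2 has a component along Z. *)
Lemma v2_L : @v2 R = L_field a (row6 0 0 2%:R^-1 0 0 (a + 4%:R^-1)).
Proof. by field_of_row. Qed.

Lemma v3_L : @v3 R = L_field a (row6 0 (-1) 0 0 0 0).
Proof. by field_of_row. Qed.

Lemma v4_L : @v4 R = L_field a (row6 0 0 0 (-1) 0 0).
Proof. by field_of_row. Qed.

Lemma v5_L : @v5 R = L_field a (row6 0 0 0 0 1 0).
Proof. by field_of_row. Qed.

Lemma v6_L : @v6 R = L_field a (row6 0 0 0 0 0 1).
Proof. by field_of_row. Qed.

Lemma sum_basis_L (e : 'I_6 -> R) :
  \sum_(i < 6) e i *: tnth [tuple v1 a; @v2 R; @v3 R; @v4 R; @v5 R; @v6 R] i =
  L_field a (row6 (e (inord 0)) (- e (inord 2)) (e (inord 1) / 2%:R)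
    (- e (inord 3)) (e (inord 4)) (e (inord 5) + e (inord 1) * (a + 4%:R^-1))).
Proof.
have eE (i : 'I_6) : e i = e (inord i).
  by congr e; apply: val_inj; rewrite /= inordK.
under eq_bigr => i _ do rewrite (eE i) (tnth_nth 0).
rewrite !big_ord_recl big_ord0 /= /bump /= !add1n addr0.
rewrite v1_L v2_L v3_L v4_L v5_L v6_L.
have L0 : L_field a 0 = 0.
  have := L_field_lin a (-1) 0 0.
  by rewrite scaler0 addr0 scaleN1r addNr.
(* A final summand [L_field a 0] gives the sum the shape k x + y at every level, so that linearity
   folds it from the right. *)
rewrite -[_ *: L_field a (row6 0 0 0 0 0 1)]addr0 -L0 -!L_field_lin.
congr L_field; apply: coef6_inj => k k6; rewrite !coef6_lin !coef6_row //.
rewrite coef6_0.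
by move: k k6 => [|[|[|[|[|[|//]]]]]] _ /=; field.
Qed.

Lemma L_basis : a <> 1 / 4%:R -> a <> 3%:R / 4%:R ->
  basis_of_set (L a 0 (1 / 4%:R) 0)
    [tuple v1 a; @v2 R; @v3 R; @v4 R; @v5 R; @v6 R].
Proof.
move=> ha ha'; split.
- case=> [[|[|[|[|[|[|//]]]]]] i6]; rewrite (tnth_nth 0) /=.
  + by rewrite v1_L; exact: L_field_in.
  + by rewrite v2_L; exact: L_field_in.
  + by rewrite v3_L; exact: L_field_in.
  + by rewrite v4_L; exact: L_field_in.
  + by rewrite v5_L; exact: L_field_in.
  + by rewrite v6_L; exact: L_field_in.
- move=> e; rewrite sum_basis_L => /L_field_ker c0 i.
  have := coef6_0 R 0; have := coef6_0 R 1; have := coef6_0 R 2.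
  have := coef6_0 R 3; have := coef6_0 R 4; have := coef6_0 R 5.
  rewrite -c0 !coef6_row //= => e5 e4 e3 e2 e1 e0.
  have {}e1 : e (inord 2) = 0 by lra.
  have {}e2 : e (inord 1) = 0 by lra.
  have {}e3 : e (inord 3) = 0 by lra.
  rewrite e2 mul0r addr0 in e5.
  have -> : i = inord i by apply: val_inj; rewrite /= inordK.
  by case: i => [[|[|[|[|[|[|//]]]]]] i6].
- move=> v /(L_range ha ha')[c ->].
  (* Inverse of the change of coordinates in [sum_basis_L]; the last entry undoes the component of
     v2 along v6. *)
  exists (fun i : 'I_6 => nth 0 [:: coef6 c 0; 2%:R * coef6 c 2; - coef6 c 1;
    - coef6 c 3; coef6 c 4; coef6 c 5 - 2%:R * coef6 c 2 * (a + 4%:R^-1)] i).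
  rewrite sum_basis_L; congr L_field; apply: coef6_inj => k k6.
  rewrite coef6_row // !inordK //.
  by move: k k6 => [|[|[|[|[|[|//]]]]]] _ /=; field.
Qed.

End LBasis.

(** * The heat equation *)

Section HeatDetermining.
Variable R : realType.
Implicit Types (v : vfield R 2).

Notation ht := heat_t.
Notation hq := heat_q.

Lemma sum2 (f : 'I_2 -> R) : \sum_k f k = f ht + f hq.
Proof.
rewrite !big_ord_recl big_ord0 addr0.
by congr (f _ + f _); apply: val_inj.
Qed.

Lemma ord2P (P : 'I_2 -> Prop) : P ht -> P hq -> forall k, P k.
Proof.
move=> h_t h_q [[|[|//]] lt_k].
- by rewrite (_ : Ordinal _ = ht) //; exact: val_inj.
- by rewrite (_ : Ordinal _ = hq) //; exact: val_inj.
Qed.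

Lemma derive_heat_Delta (w z : jet2 R 2) :
  'D_w (@heat_Delta R) z = w.1.2 0 ht + w.2 hq hq.
Proof.
apply: derive_val; rewrite /heat_Delta.
by repeat first [exact: is_derive_jet2_p | exact: is_derive_jet2_h | is_derive_step].
Qed.

Definition row2 (s t : R) : 'rV[R]_2 := \row_k nth 0 [:: s; t] k.

Lemma row2_t s t : row2 s t 0 ht = s. Proof. by rewrite mxE. Qed.
Lemma row2_q s t : row2 s t 0 hq = t. Proof. by rewrite mxE. Qed.

(** Second derivatives u_tq = m and u_qq = r; u_tt is absent from the condition and set to 0. *)
Definition hess2 (m r : R) : 'M[R]_2 :=
  \matrix_(i, j) (if i == j then (if i == hq then r else 0) else m).

Lemma hess2_tr m r : (hess2 m r)^T = hess2 m r.
Proof. by apply/matrixP; apply: ord2P; apply: ord2P; rewrite !mxE. Qed.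

Lemma hess2_qq m r : hess2 m r hq hq = r. Proof. by rewrite mxE. Qed.
Lemma hess2_qt m r : hess2 m r hq ht = m. Proof. by rewrite mxE. Qed.

Section FirstOrder.
Variable v : vfield R 2.
Hypothesis sym : forall z : jet2 R 2, z.2^T = z.2 -> heat_Delta z = 0 ->
  'D_(pr2 v z) (@heat_Delta R) z = 0.

(** The equation fixes u_t = - r, while u_q = s, u_tq = m and u_qq = r remain free. *)
Let symE p s m r :
  phi1 v ht (p, row2 (- r) s) + phi2 v hq hq (p, row2 (- r) s, hess2 m r) = 0.
Proof.
have D0 : heat_Delta (p, row2 (- r) s, hess2 m r) = 0.
  by rewrite /heat_Delta /= row2_t hess2_qq addNr.
have := sym (z := (p, row2 (- r) s, hess2 m r)) (hess2_tr m r) D0.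
by rewrite derive_heat_Delta /= ![(\row__ _) _ _]mxE ![(\matrix_(_, _) _) _ _]mxE.
Qed.

Let Tq p : 'D_(dx0 R hq) (xi v ht) p = 0 /\ 'D_(du0 R 2) (xi v ht) p = 0.
Proof.
have E s : totalD0 hq (xi v ht) (p, row2 (- 0) s) = 0.
  have := symE p s 0 0; have := symE p s 1 0.
  rewrite !phi2_diag !sum2 !hess2_qq !hess2_qt.
  move: (phi1 _ _ _) ('D_(dx1 R hq) _ _ + _) (totalD0 hq (xi v ht) _)
    (totalD0 hq (xi v hq) _) => A B C D.
  by rewrite !mul0r !mulr0 !addr0 mulr1 => e1 e2; lra.
have := E 0; have := E 1; rewrite /totalD0 /= !row2_q mul0r mul1r addr0.
by move=> e1 e2; split=> //; rewrite -[LHS]add0r -{1}e2.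
Qed.

(** Varying u_qq on the equation also varies u_t. As tau_q = tau_u = 0, phi^q does not see this, so
    two values of u_qq can be compared. *)
Let phi1q_pt p r r' s :
  phi1 v hq (p, row2 r s) = phi1 v hq (p, row2 r' s).
Proof.
have [h1 h2] := Tq p.
by rewrite /phi1 /totalD0 /= !sum2 /= !row2_q !row2_t h1 h2 !mulr0 !addr0 !mul0r.
Qed.

(** With a single space variable no mixed derivative yields xi_u = 0. Instead the coefficient of
    u_qq gives tau_t = 2 (xi_q + u_q xi_u), to be compared at u_q = 0 and 1. *)
Let Xq p : 'D_(du0 R 2) (xi v hq) p = 0 /\
  'D_(dx0 R ht) (xi v ht) p = 2%:R * 'D_(dx0 R hq) (xi v hq) p.
Proof.
have [h1 h2] := Tq p.
have dxE r s : 'D_(dx1 R hq) (phi1 v hq) (p, row2 (- r) s) =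
    'D_(dx1 R hq) (phi1 v hq) (p, row2 0 s).
  rewrite derive_line [RHS]derive_line.
  apply: (congr1 (fun f : R -> R => 'D_(1 : R) f (0 : R))); apply/funext => k.
  have E u : k *: dx1 R hq + (p, row2 u s) = (k *: dx0 R hq + p, row2 u s).
    by congr (_, _); rewrite /= scaler0 add0r.
  by rewrite !E; exact: phi1q_pt.
have duE r s : 'D_(du1 R 2) (phi1 v hq) (p, row2 (- r) s) =
    'D_(du1 R 2) (phi1 v hq) (p, row2 0 s).
  rewrite derive_line [RHS]derive_line.
  apply: (congr1 (fun f : R -> R => 'D_(1 : R) f (0 : R))); apply/funext => k.
  have E u : k *: du1 R 2 + (p, row2 u s) = (k *: du0 R 2 + p, row2 u s).
    by congr (_, _); rewrite /= scaler0 add0r.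
  by rewrite !E; exact: phi1q_pt.
have E s : 'D_(dx0 R ht) (xi v ht) p =
    2%:R * ('D_(dx0 R hq) (xi v hq) p + s * 'D_(du0 R 2) (xi v hq) p).
  have := symE p s 0 0; have := symE p s 0 1.
  rewrite !phi2_diag !sum2 !dxE !duE !hess2_qq !hess2_qt /phi1 !sum2 /totalD0 /=.
  rewrite !row2_q !row2_t h1 h2.
  move: ('D_(dx1 R hq) _ _) ('D_(du1 R 2) _ _) => A B.
  move: ('D_(dx0 R ht) (phi v) p) ('D_(du0 R 2) (phi v) p) => ft fu.
  move: ('D_(dx0 R ht) (xi v ht) p) ('D_(dx0 R ht) (xi v hq) p) => Tt Xt.
  move: ('D_(dx0 R hq) (xi v hq) p) ('D_(du0 R 2) (xi v hq) p) => X Xu.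
  by move=> e1 e2; lra.
have e0 := E 0; have e1 := E 1.
split; last by rewrite e0 mul0r addr0.
by move: e1; rewrite e0; move: ('D_(du0 R 2) _ _) => X e1; lra.
Qed.

Lemma heat_first_order p :
  [/\ forall k, 'D_(du0 R 2) (xi v k) p = 0,
      'D_(dx0 R hq) (xi v ht) p = 0 &
      'D_(dx0 R ht) (xi v ht) p = 2%:R * 'D_(dx0 R hq) (xi v hq) p].
Proof.
have [h1 h2] := Tq p; have [h3 h4] := Xq p.
by split=> //; exact: ord2P.
Qed.

End FirstOrder.

Notation dt f := ('D_(delta_mx 0 ht) f).
Notation dq f := ('D_(delta_mx 0 hq) f).

Record heat_determining (F : 'I_2 -> 'rV[R]_2 -> R) (L : 'rV[R]_2 -> R)
    (q : 'rV[R]_2) : Prop := HeatDetermining {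
  heat_det_h : dt (F ht) q = 2%:R * dq (F hq) q;
  heat_det_p : 2%:R * dq L q = dt (F hq) q + dq (dq (F hq)) q;
  heat_det_u : dt L q + dq (dq L) q = 0 }.

Section Reduced.
Variables (F : 'I_2 -> 'rV[R]_2 -> R) (L : 'rV[R]_2 -> R) (v : vfield R 2).
Hypotheses (sF : forall k, smooth_on setT (F k)).
Hypothesis (sL : smooth_on setT L).
Hypothesis vE : forall p : base R 2, setT p.1 ->
  v p = (\row_k F k p.1, L p.1 * p.2).
Hypothesis Tq : forall q, dq (F ht) q = 0.

Let Tqq q : dq (dq (F ht)) q = 0.
Proof.
rewrite (_ : dq (F ht) = fun=> 0); last by apply/funext => r; exact: Tq.
exact: derive_cst.
Qed.

Lemma heat_symmetry_condition (z : jet2 R 2) :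
  let q := z.1.1.1 in let p := z.1.2 0 hq in let r := z.1.2 0 ht in
  'D_(pr2 v z) (@heat_Delta R) z =
    dt L q * z.1.1.2 + r * L q - (dt (F ht) q * r + dt (F hq) q * p)
    + (dq (dq L) q * z.1.1.2 + 2%:R * p * dq L q - dq (dq (F hq)) q * p
       + z.2 hq hq * L q - 2%:R * (dq (F hq) q * z.2 hq hq)).
Proof.
rewrite /= derive_heat_Delta /= ![(\row__ _) _ _]mxE ![(\matrix_(_, _) _) _ _]mxE.
rewrite (phi1_red openT sL vE) // (phi2_red openT sF sL vE) // !sum2 Tq Tqq.
by rewrite !mul0r !add0r.
Qed.

Lemma heat_determining_of_symmetry q :
  (forall z : jet2 R 2, z.2^T = z.2 -> heat_Delta z = 0 ->
    'D_(pr2 v z) (@heat_Delta R) z = 0) -> heat_determining F L q.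
Proof.
move=> sym.
have E (u s r : R) :
    dt L q * u + - r * L q - (dt (F ht) q * - r + dt (F hq) q * s)
    + (dq (dq L) q * u + 2%:R * s * dq L q - dq (dq (F hq)) q * s
       + r * L q - 2%:R * (dq (F hq) q * r)) = 0.
  have D0 : heat_Delta ((q, u) : base R 2, row2 (- r) s, hess2 0 r) = 0.
    by rewrite /heat_Delta /= row2_t hess2_qq addNr.
  have := sym (((q, u) : base R 2, row2 (- r) s), hess2 0 r) (hess2_tr 0 r) D0.
  by rewrite heat_symmetry_condition /= row2_t row2_q hess2_qq.
suff [e1 [e2 e3]] : dt (F ht) q = 2%:R * dq (F hq) q /\
    2%:R * dq L q = dt (F hq) q + dq (dq (F hq)) q /\ dt L q + dq (dq L) q = 0.
  by split.
have := E 1 0 0; have := E 0 1 0; have := E 0 0 1.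
move: (dt L q) (dq L q) (dq (dq L) q) (dt (F ht) q) (dt (F hq) q) (dq (F hq) q)
  (dq (dq (F hq)) q) (L q) => lt lq lqq tt xt xq xqq l e1 e2 e3.
by split; last split; lra.
Qed.

Lemma heat_symmetry_of_determining (z : jet2 R 2) :
  heat_determining F L z.1.1.1 -> heat_Delta z = 0 ->
  'D_(pr2 v z) (@heat_Delta R) z = 0.
Proof.
move=> [e1 e2 e3]; rewrite /heat_Delta => D0.
have rE : z.1.2 0 ht = - z.2 hq hq by apply/eqP; rewrite -addr_eq0 D0.
rewrite heat_symmetry_condition rE e1.
have -> : dt L z.1.1.1 = - dq (dq L) z.1.1.1.
  by apply/eqP; rewrite -addr_eq0 e3.
have -> : dt (F hq) z.1.1.1 = 2%:R * dq L z.1.1.1 - dq (dq (F hq)) z.1.1.1.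
  by rewrite e2 addrK.
move: (dq L _) (dq (dq L) _) (dq (F hq) _) (dq (dq (F hq)) _) (L _) (z.2 hq hq).
by move: (z.1.2 0 hq) z.1.1.2 => s u lq lqq xq xqq l r; ring.
Qed.

End Reduced.

End HeatDetermining.

(** * Solution of the determining system of the heat equation *)

Section HeatSolution.
Variable R : realType.

Notation ht := heat_t.
Notation hq := heat_q.
Notation dt f := ('D_(delta_mx 0 ht) f).
Notation dq f := ('D_(delta_mx 0 hq) f).

Lemma row2_coord (q : 'rV[R]_2) : row2 (q 0 ht) (q 0 hq) = q.
Proof. by apply/rowP; apply: ord2P; rewrite !mxE. Qed.

Section Partial.
Variables (f : 'rV[R]_2 -> R) (sf : smooth_on setT f).

Lemma is_derive_row2_t (s x : R) :
  is_derive s 1 (fun r => f (row2 r x)) (dt f (row2 s x)).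
Proof.
have E r : r *: delta_mx 0 ht + row2 0 x = row2 r x.
  by apply/rowP; apply: ord2P; rewrite !mxE /= ?mulr1 ?mulr0 ?addr0 ?add0r.
have h := @smooth_on_is_derive _ _ _ _ _ (row2 s x) (delta_mx 0 ht) sf I.
rewrite -[in X in is_derive X]E in h.
move: ((is_derive_line_at _ _ _ _ _).1 h).
by congr (is_derive _ _ _ _); apply/funext => r; rewrite E.
Qed.

Lemma is_derive_row2_q (s x : R) :
  is_derive x 1 (fun r => f (row2 s r)) (dq f (row2 s x)).
Proof.
have E r : r *: delta_mx 0 hq + row2 s 0 = row2 s r.
  by apply/rowP; apply: ord2P; rewrite !mxE /= ?mulr1 ?mulr0 ?addr0 ?add0r.
have h := @smooth_on_is_derive _ _ _ _ _ (row2 s x) (delta_mx 0 hq) sf I.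
rewrite -[in X in is_derive X]E in h.
move: ((is_derive_line_at _ _ _ _ _).1 h).
by congr (is_derive _ _ _ _); apply/funext => r; rewrite E.
Qed.

Lemma derive_row2_t (s x : R) g d : (forall r : R, f (row2 r x) = g r) ->
  is_derive s 1 g d -> dt f (row2 s x) = d.
Proof.
move=> fg dg; apply: is_derive_unique (is_derive_row2_t s x) _.
by rewrite (_ : (fun s => _) = g) //; apply/funext.
Qed.

Lemma derive_row2_q (s x : R) g d : (forall r : R, f (row2 s r) = g r) ->
  is_derive x 1 g d -> dq f (row2 s x) = d.
Proof.
move=> fg dg; apply: is_derive_unique (is_derive_row2_q s x) _.
by rewrite (_ : (fun s => _) = g) //; apply/funext.
Qed.

End Partial.

Variables (F : 'I_2 -> 'rV[R]_2 -> R) (L : 'rV[R]_2 -> R).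
Hypotheses (sF : forall k, smooth_on setT (F k)).
Hypothesis (sL : smooth_on setT L).

Let sD (f : 'rV[R]_2 -> R) e : smooth_on setT f -> smooth_on setT ('D_e f).
Proof. exact: smooth_on_derive. Qed.

Section Solve.
Hypothesis Tq : forall q, dq (F ht) q = 0.
Hypothesis det : forall q, heat_determining F L q.

Let tau (s : R) : R := F ht (row2 s 0).
Let tau1 (s : R) : R := dt (F ht) (row2 s 0).
Let tau2 (s : R) : R := dt (dt (F ht)) (row2 s 0).
Let tau3 (s : R) : R := dt (dt (dt (F ht))) (row2 s 0).

Let is_derive_tau (s : R) : is_derive s 1 tau (tau1 s).
Proof. exact: (is_derive_row2_t (sF ht)). Qed.

Let is_derive_tau1 (s : R) : is_derive s 1 tau1 (tau2 s).
Proof. exact: (is_derive_row2_t (sD _ (sF ht))). Qed.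

Let is_derive_tau2 (s : R) : is_derive s 1 tau2 (tau3 s).
Proof. exact: (is_derive_row2_t (sD _ (sD _ (sF ht)))). Qed.

Let tauE (s x : R) : F ht (row2 s x) = tau s.
Proof.
apply: (@is_derive_0_is_cst _ (fun r => F ht (row2 s r))) => r.
by rewrite -(Tq (row2 s r)); exact: is_derive_row2_q.
Qed.

Let dt_tau (s x : R) : dt (F ht) (row2 s x) = tau1 s.
Proof.
apply: (@derive_row2_t _ (sF ht) s x tau); last exact: is_derive_tau.
by move=> r; exact: tauE.
Qed.

Let G (s : R) : R := F hq (row2 s 0).
Let G1 (s : R) : R := dt (F hq) (row2 s 0).
Let G2 (s : R) : R := dt (dt (F hq)) (row2 s 0).

Let is_derive_G (s : R) : is_derive s 1 G (G1 s).
Proof. exact: (is_derive_row2_t (sF hq)). Qed.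

Let is_derive_G1 (s : R) : is_derive s 1 G1 (G2 s).
Proof. exact: (is_derive_row2_t (sD _ (sF hq))). Qed.

Let dq_xi (s x : R) : dq (F hq) (row2 s x) = tau1 s / 2%:R.
Proof.
have := heat_det_h (det (row2 s x)); rewrite dt_tau => ->.
by rewrite mulrC mulKf.
Qed.

Let dqq_xi (s x : R) : dq (dq (F hq)) (row2 s x) = 0.
Proof.
apply: (@derive_row2_q _ (sD _ (sF hq)) s x (fun=> tau1 s / 2%:R)).
by move=> r; exact: dq_xi.
Qed.

Let xiE (s x : R) : F hq (row2 s x) = tau1 s / 2%:R * x + G s.
Proof.
have : F hq (row2 s x) - tau1 s / 2%:R * x = G s - tau1 s / 2%:R * 0.
  apply: (@is_derive_0_is_cst _ (fun r => F hq (row2 s r) - tau1 s / 2%:R * r)) => r.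
  is_derive_calc.
    by repeat first [exact: (is_derive_row2_q (sF hq)) | exact: is_derive_id
      | is_derive_step].
  by cbv beta; rewrite dq_xi; ring.
by rewrite mulr0 subr0 => <-; rewrite addrC subrK.
Qed.

Let dt_xi (s x : R) : dt (F hq) (row2 s x) = tau2 s / 2%:R * x + G1 s.
Proof.
apply: (@derive_row2_t _ (sF hq) s x (fun r => tau1 r / 2%:R * x + G r)).
  by move=> r; exact: xiE.
is_derive_calc.
  by repeat first [exact: is_derive_tau1 | exact: is_derive_G | is_derive_step].
by cbv beta; ring.
Qed.

Let dq_L (s x : R) : dq L (row2 s x) = tau2 s / 4%:R * x + G1 s / 2%:R.
Proof.
have := heat_det_p (det (row2 s x)); rewrite dt_xi dqq_xi.
move: (dq L _) (tau2 s) (G1 s) => l t k e.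
have two0 : 2%:R != 0 :> R by [].
by apply: (mulfI two0); rewrite e; field.
Qed.

Let dqq_L (s x : R) : dq (dq L) (row2 s x) = tau2 s / 4%:R.
Proof.
apply: (@derive_row2_q _ (sD _ sL) s x
  (fun r => tau2 s / 4%:R * r + G1 s / 2%:R)).
  by move=> r; exact: dq_L.
is_derive_calc; first by repeat first [exact: is_derive_id | is_derive_step].
by cbv beta; ring.
Qed.

Let m (s : R) : R := L (row2 s 0).
Let m1 (s : R) : R := dt L (row2 s 0).

Let is_derive_m (s : R) : is_derive s 1 m (m1 s).
Proof. exact: (is_derive_row2_t sL). Qed.

Let LE (s x : R) :
  L (row2 s x) = tau2 s / 8%:R * (x * x) + G1 s / 2%:R * x + m s.
Proof.
have : L (row2 s x) - (tau2 s / 8%:R * (x * x) + G1 s / 2%:R * x) =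
    m s - (tau2 s / 8%:R * (0 * 0) + G1 s / 2%:R * 0).
  apply: (@is_derive_0_is_cst _ (fun r => L (row2 s r) -
    (tau2 s / 8%:R * (r * r) + G1 s / 2%:R * r))) => r.
  is_derive_calc.
    by repeat first [exact: (is_derive_row2_q sL) | exact: is_derive_id
      | is_derive_step].
  by cbv beta; rewrite dq_L; field.
by rewrite !mulr0 addr0 subr0 => <-; rewrite addrC subrK.
Qed.

Let dt_L (s x : R) :
  dt L (row2 s x) = tau3 s / 8%:R * (x * x) + G2 s / 2%:R * x + m1 s.
Proof.
apply: (@derive_row2_t _ sL s x
  (fun r => tau2 r / 8%:R * (x * x) + G1 r / 2%:R * x + m r)).
  by move=> r; exact: LE.
is_derive_calc.
  by repeat first [exact: is_derive_tau2 | exact: is_derive_G1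
    | exact: is_derive_m | is_derive_step].
by cbv beta; ring.
Qed.

Let constants (s : R) : [/\ tau3 s = 0, G2 s = 0 & m1 s = - (tau2 s / 4%:R)].
Proof.
have e x := heat_det_u (det (row2 s x)).
have := e 0; have := e 1; have := e (-1); rewrite !dt_L !dqq_L.
move: (tau3 s) (G2 s) (m1 s) (tau2 s) => t3 g2 mm t2 e1 e2 e3.
have t0 : t3 = 0 by lra.
have g0 : g2 = 0 by lra.
by split=> //; lra.
Qed.

Lemma heat_affine_solution : exists c0 c1 c2 c3 c4 c5 : R, forall s x : R,
  let t1 := 2%:R * c0 * s + 2%:R * c2 in
  [/\ F ht (row2 s x) = c0 * (s * s) + 2%:R * c2 * s - c1,
      F hq (row2 s x) = t1 / 2%:R * x + (c4 - c3 * s) &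
      L (row2 s x) = c0 / 4%:R * (x * x) - c3 / 2%:R * x - t1 / 4%:R
        + c5 / 2%:R].
Proof.
have t2E s : tau2 s = tau2 0.
  by apply: is_derive_0_is_cst => r; have [<- _ _] := constants r.
have g1E s : G1 s = G1 0.
  by apply: is_derive_0_is_cst => r; have [_ <- _] := constants r.
have t1E s : tau1 s = tau2 0 * s + tau1 0.
  have : tau1 s - tau2 0 * s = tau1 0 - tau2 0 * 0.
    apply: (@is_derive_0_is_cst _ (fun r => tau1 r - tau2 0 * r)) => r.
    is_derive_calc.
      by repeat first [exact: is_derive_tau1 | exact: is_derive_id | is_derive_step].
    by cbv beta; rewrite t2E; ring.
  by rewrite mulr0 subr0 => <-; rewrite addrC subrK.
have gE s : G s = G1 0 * s + G 0.
  have : G s - G1 0 * s = G 0 - G1 0 * 0.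
    apply: (@is_derive_0_is_cst _ (fun r => G r - G1 0 * r)) => r.
    is_derive_calc.
      by repeat first [exact: is_derive_G | exact: is_derive_id | is_derive_step].
    by cbv beta; rewrite g1E; ring.
  by rewrite mulr0 subr0 => <-; rewrite addrC subrK.
have tE s : tau s = tau2 0 / 2%:R * (s * s) + tau1 0 * s + tau 0.
  have : tau s - (tau2 0 / 2%:R * (s * s) + tau1 0 * s) =
      tau 0 - (tau2 0 / 2%:R * (0 * 0) + tau1 0 * 0).
    apply: (@is_derive_0_is_cst _
      (fun r => tau r - (tau2 0 / 2%:R * (r * r) + tau1 0 * r))) => r.
    is_derive_calc.
      by repeat first [exact: is_derive_tau | exact: is_derive_id | is_derive_step].
    by cbv beta; rewrite t1E; field.
  by rewrite !mulr0 addr0 subr0 => <-; rewrite addrC subrK.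
have mE s : m s = m 0 + tau1 0 / 4%:R - tau1 s / 4%:R.
  have : m s + tau1 s / 4%:R = m 0 + tau1 0 / 4%:R.
    apply: (@is_derive_0_is_cst _ (fun r => m r + tau1 r / 4%:R)) => r.
    is_derive_calc.
      by repeat first [exact: is_derive_m | exact: is_derive_tau1 | is_derive_step].
    by cbv beta; have [_ _ ->] := constants r; ring.
  by move=> <-; rewrite addrK.
(* Again the coordinates on E, F, H, X, Y, Z. The last is doubled: for Y = d/dq and X = - t d/dq -
   (q/2) u d/du the bracket of X and Y is (1/2) u d/du, the image of Z. *)
exists (tau2 0 / 2%:R), (- tau 0), (tau1 0 / 2%:R), (- G1 0), (G 0),
  (2%:R * m 0 + tau1 0 / 2%:R) => s x /=.
rewrite xiE LE tauE (tE s) (mE s) (gE s) (g1E s) (t2E s) (t1E s).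
move: (tau 0) (tau1 0) (tau2 0) (G 0) (G1 0) (m 0) => k1 k2 k3 k4 k5 k6.
by split; field.
Qed.

End Solve.

Section Explicit.
Variables c0 c1 c2 c3 c4 c5 : R.
Let t1 (s : R) : R := 2%:R * c0 * s + 2%:R * c2.

Hypothesis tauE : forall s x : R,
  F ht (row2 s x) = c0 * (s * s) + 2%:R * c2 * s - c1.
Hypothesis xiE : forall s x : R,
  F hq (row2 s x) = t1 s / 2%:R * x + (c4 - c3 * s).
Hypothesis LE : forall s x : R,
  L (row2 s x) = c0 / 4%:R * (x * x) - c3 / 2%:R * x - t1 s / 4%:R + c5 / 2%:R.

Lemma heat_explicit_tau (s x : R) : dq (F ht) (row2 s x) = 0.
Proof.
by apply: (@derive_row2_q _ (sF ht) s x (fun=> c0 * (s * s) + 2%:R * c2 * s - c1)).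
Qed.

Let is_derive_t1 (r : R) : is_derive r 1 t1 (2%:R * c0).
Proof.
is_derive_calc; first by repeat first [exact: is_derive_id | is_derive_step].
by cbv beta; ring.
Qed.

Let dt_tau (s x : R) : dt (F ht) (row2 s x) = t1 s.
Proof.
apply: (@derive_row2_t _ (sF ht) s x
  (fun r => c0 * (r * r) + 2%:R * c2 * r - c1)).
  by move=> r; exact: tauE.
is_derive_calc; first by repeat first [exact: is_derive_id | is_derive_step].
by cbv beta; rewrite /t1; ring.
Qed.

Let dq_xi (s x : R) : dq (F hq) (row2 s x) = t1 s / 2%:R.
Proof.
apply: (@derive_row2_q _ (sF hq) s x (fun r => t1 s / 2%:R * r + (c4 - c3 * s))).
  by move=> r; exact: xiE.
is_derive_calc; first by repeat first [exact: is_derive_id | is_derive_step].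
by cbv beta; ring.
Qed.

Let dqq_xi (s x : R) : dq (dq (F hq)) (row2 s x) = 0.
Proof.
apply: (@derive_row2_q _ (sD _ (sF hq)) s x (fun=> t1 s / 2%:R)).
by move=> r; exact: dq_xi.
Qed.

Let dt_xi (s x : R) : dt (F hq) (row2 s x) = c0 * x - c3.
Proof.
apply: (@derive_row2_t _ (sF hq) s x (fun r => t1 r / 2%:R * x + (c4 - c3 * r))).
  by move=> r; exact: xiE.
is_derive_calc.
  by repeat first [exact: is_derive_t1 | exact: is_derive_id | is_derive_step].
by cbv beta; field.
Qed.

Let dq_L (s x : R) : dq L (row2 s x) = c0 / 2%:R * x - c3 / 2%:R.
Proof.
apply: (@derive_row2_q _ sL s x (fun r => c0 / 4%:R * (r * r) - c3 / 2%:R * r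
  - t1 s / 4%:R + c5 / 2%:R)).
  by move=> r; exact: LE.
is_derive_calc; first by repeat first [exact: is_derive_id | is_derive_step].
by cbv beta; field.
Qed.

Let dqq_L (s x : R) : dq (dq L) (row2 s x) = c0 / 2%:R.
Proof.
apply: (@derive_row2_q _ (sD _ sL) s x (fun r => c0 / 2%:R * r - c3 / 2%:R)).
  by move=> r; exact: dq_L.
is_derive_calc; first by repeat first [exact: is_derive_id | is_derive_step].
by cbv beta; ring.
Qed.

Let dt_L (s x : R) : dt L (row2 s x) = - (c0 / 2%:R).
Proof.
apply: (@derive_row2_t _ sL s x (fun r => c0 / 4%:R * (x * x) - c3 / 2%:R * x
  - t1 r / 4%:R + c5 / 2%:R)).
  by move=> r; exact: LE.
is_derive_calc; first by repeat first [exact: is_derive_t1 | is_derive_step].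
by cbv beta; field.
Qed.

Lemma heat_explicit_determining (s x : R) : heat_determining F L (row2 s x).
Proof.
split.
- by rewrite dt_tau dq_xi; field.
- by rewrite dq_L dt_xi dqq_xi; field.
- by rewrite dt_L dqq_L; ring.
Qed.

End Explicit.

End HeatSolution.

(** * The symmetry fields of the heat equation *)

Section HeatField.
Variables (R : realType) (c : 'rV[R]_6).

Notation ht := heat_t.
Notation hq := heat_q.

(** With [heat_lambda] this encodes E |-> t^2 d/dt + t q d/dq + (q^2/4 - t/2) u d/du, F |-> - d/dt,
    H |-> 2 t d/dt + q d/dq - (1/2) u d/du, X |-> - t d/dq - (q/2) u d/du, Y |-> d/dq, Z |-> (1/2) u
    d/du. *)
Definition heat_xi (k : 'I_2) (q : 'rV[R]_2) : R :=
  nth 0 [:: coef6 c 0 * (q 0 ht * q 0 ht) + 2%:R * coef6 c 2 * q 0 ht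
      + - coef6 c 1;
    L_tau1 c (q 0 ht) * 2%:R^-1 * q 0 hq
      + (coef6 c 4 + - coef6 c 3 * q 0 ht)] k.

Definition heat_lambda (q : 'rV[R]_2) : R :=
  coef6 c 0 / 4%:R * (q 0 hq * q 0 hq) + - (coef6 c 3 / 2%:R) * q 0 hq
  + - 4%:R^-1 * L_tau1 c (q 0 ht) + coef6 c 5 / 2%:R.

Definition heat_field : vfield R 2 :=
  fun p => (\row_k heat_xi k p.1, heat_lambda p.1 * p.2).

Lemma heat_field_elementary : elementary_field setT heat_field.
Proof.
have ex k : elementary setT (fun p : base R 2 => p.1 0 k).
  exact/elementary_linear/clinear_x.
have eu : elementary setT (fun p : base R 2 => p.2).
  exact/elementary_linear/clinear_u.
split.
  move=> k; rewrite (_ : xi _ k = fun p => heat_xi k p.1); last first.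
    by apply/funext => p; rewrite /xi mxE.
  move: k; apply: ord2P; rewrite /heat_xi /L_tau1 /=;
  repeat first [exact: ex | exact: elementary_const
    | apply: elementary_add | apply: elementary_mul].
rewrite /phi /heat_field /= /heat_lambda /L_tau1.
by repeat first [exact: ex | exact: eu | exact: elementary_const
    | apply: elementary_add | apply: elementary_mul].
Qed.

Lemma heat_field_smooth : smooth_on setT heat_field.
Proof. exact: elementary_field_smooth openT _ heat_field_elementary. Qed.

Lemma heat_xi_smooth k : smooth_on setT (heat_xi k).
Proof.
have := @smooth_slice _ _ setT setT heat_field
  (fun p => p.1 0 k) 0 openT (@xi_linear R 2 k) (@xi_continuous R 2 k)
  (fun q h => h) heat_field_smooth.
by congr (smooth_on _ _); apply/funext => q; rewrite mxE.
Qed.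

Lemma heat_lambda_smooth : smooth_on setT heat_lambda.
Proof.
have [lu cu] := @clinear_u R 2.
have := @smooth_slice _ _ setT setT heat_field
  (fun p => p.2) 1 openT lu cu (fun q h => h) heat_field_smooth.
by congr (smooth_on _ _); apply/funext => q; rewrite /= mulr1.
Qed.

Lemma heat_field_in : H00 heat_field.
Proof.
split; last by exists heat_lambda.
split; first by split=> [|p []//]; exact: heat_field_smooth.
move=> z _ zT Dz.
have t_eq s x : heat_xi ht (row2 s x) =
    coef6 c 0 * (s * s) + 2%:R * coef6 c 2 * s - coef6 c 1.
  by rewrite /heat_xi /= row2_t.
have q_eq s x : heat_xi hq (row2 s x) =
    (2%:R * coef6 c 0 * s + 2%:R * coef6 c 2) / 2%:R * x
    + (coef6 c 4 - coef6 c 3 * s).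
  by rewrite /heat_xi /L_tau1 /= row2_t row2_q mulNr.
have l_eq s x : heat_lambda (row2 s x) =
    coef6 c 0 / 4%:R * (x * x) - coef6 c 3 / 2%:R * x
    - (2%:R * coef6 c 0 * s + 2%:R * coef6 c 2) / 4%:R + coef6 c 5 / 2%:R.
  by rewrite /heat_lambda /L_tau1 row2_t row2_q; ring.
apply: (heat_symmetry_of_determining heat_xi_smooth heat_lambda_smooth) => //.
- by move=> q; rewrite -(row2_coord q); exact: (heat_explicit_tau heat_xi_smooth t_eq).
- rewrite -(row2_coord z.1.1.1).
  exact: (heat_explicit_determining heat_xi_smooth heat_lambda_smooth t_eq q_eq l_eq).
Qed.

End HeatField.

(** * The symmetry algebra of the heat equation as an image of M *)

Section HeatAlgebra.
Variable R : realType.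

Notation ht := heat_t.
Notation hq := heat_q.

Lemma heat_range (v : vfield R 2) : H00 v -> exists c, v = heat_field c.
Proof.
move=> [[sv sym] lam].
have fo p := heat_first_order (fun z => sym z I) p.
have [F [L [sF sL vE]]] := symmetry_reduction openT (fun p => erefl) sv lam
  (fun k p _ => let: And3 h _ _ := fo p in h k).
have Tq q : 'D_(delta_mx 0 hq) (F ht) q = 0.
  have [_ <- _] := fo (q, 0).
  by rewrite (derive_xi_red openT vE) // derive_dx0_fst.
have det q : heat_determining F L q.
  by apply: (heat_determining_of_symmetry sF sL vE Tq) => z; exact: sym.
have [c0 [c1 [c2 [c3 [c4 [c5 cE]]]]]] := heat_affine_solution sF sL Tq det.
exists (row6 c0 c1 c2 c3 c4 c5).
apply/funext => p; rewrite vE // /heat_field.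
have [h1 h2 h3] := cE (p.1 0 ht) (p.1 0 hq); rewrite row2_coord in h1 h2 h3.
congr (_, _).
  apply/rowP; apply: ord2P; rewrite !mxE ?h1 ?h2 /heat_xi /L_tau1 /=;
  by rewrite !coef6_row //=; ring.
by congr (_ * _); rewrite h3 /heat_lambda /L_tau1 !coef6_row //=; ring.
Qed.

Lemma heat_field_lin (k : R) (x y : 'rV[R]_6) :
  heat_field (k *: x + y) = k *: heat_field x + heat_field y.
Proof.
apply/funext => p; rewrite [RHS]/GRing.add /= [in RHS]/GRing.scale /=.
congr (_, _).
  by apply/rowP; apply: ord2P; rewrite !mxE /heat_xi /L_tau1 /= !coef6_lin; ring.
by rewrite /= /heat_lambda /L_tau1 !coef6_lin /GRing.scale /=; ring.
Qed.

Lemma heat_field_ker (c : 'rV[R]_6) : heat_field c = 0 -> c = 0.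
Proof.
move=> c0.
have H s k : heat_xi c k (row2 s 0) = 0.
  have : heat_field c (row2 s 0, 1) = 0 by rewrite c0.
  by move=> /(congr1 (fun p : base R 2 => p.1 0 k)); rewrite !mxE.
have Hl : heat_lambda c (row2 0 0) = 0.
  have : heat_field c (row2 0 0, 1) = 0 by rewrite c0.
  by move=> /(congr1 (fun p : base R 2 => p.2)); rewrite /= mulr1.
have := H 0 ht; have := H 1 ht; have := H (-1) ht; have := H 0 hq.
have := H 1 hq; move: Hl; rewrite /heat_lambda /heat_xi /L_tau1 /=.
rewrite !row2_t !row2_q => e1 e2 e3 e4 e5 e6.
have c10 : coef6 c 1 = 0 by lra.
have c00 : coef6 c 0 = 0 by lra.
have c20 : coef6 c 2 = 0 by lra.
have c40 : coef6 c 4 = 0 by move: e3; rewrite c00 c20; lra.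
have c30 : coef6 c 3 = 0 by move: e2; rewrite c00 c20 c40; lra.
have c50 : coef6 c 5 = 0 by move: e1; rewrite c00 c20 c30; lra.
apply: coef6_inj => k k6; rewrite coef6_0.
by move: k k6 => [|[|[|[|[|[|//]]]]]].
Qed.

Definition heat_dxi (c : 'rV[R]_6) (p e : base R 2) (k : 'I_2) : R :=
  let t1 := L_tau1 c (p.1 0 ht) in
  nth 0 [:: t1 * e.1 0 ht;
    coef6 c 0 * e.1 0 ht * p.1 0 hq + t1 / 2%:R * e.1 0 hq
      - coef6 c 3 * e.1 0 ht] k.

Definition heat_dphi (c : 'rV[R]_6) (p e : base R 2) : R :=
  (coef6 c 0 / 2%:R * p.1 0 hq * e.1 0 hq - coef6 c 3 / 2%:R * e.1 0 hq
    - coef6 c 0 / 2%:R * e.1 0 ht) * p.2 + heat_lambda c p.1 * e.2.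

Lemma is_derive_heat_field (c : 'rV[R]_6) (p e : base R 2) :
  is_derive p e (heat_field c) ((\row_k heat_dxi c p e k, heat_dphi c p e) : base R 2).
Proof.
apply: is_derive_vfield.
  move=> k; rewrite (_ : xi _ k = fun p => heat_xi c k p.1); last first.
    by apply/funext => q; rewrite /xi mxE.
  move: k; apply: ord2P; rewrite /heat_xi /heat_dxi /L_tau1 /=; is_derive_calc;
    try by repeat first [exact: is_derive_base_x | is_derive_step].
  - by cbv beta; ring.
  - by cbv beta; field.
rewrite /phi /heat_field /= /heat_dphi /heat_lambda /L_tau1; is_derive_calc.
  by repeat first [exact: is_derive_base_x | exact: is_derive_base_u
    | is_derive_step].
by cbv beta; field.
Qed.

Lemma heat_field_bracket (x y : 'rV[R]_6) :
  H00_bracket (heat_field x) (heat_field y) = heat_field (M_bracket x y).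
Proof.
apply/funext => p.
rewrite /H00_bracket (@vbracketE R 2 setT (heat_field x) (heat_field y) _ _ p _ _
  openT I (fun _ _ => erefl) (fun _ _ => erefl) (is_derive_heat_field y p _)
  (is_derive_heat_field x p _)).
have Fx (c : 'rV[R]_6) k : (heat_field c p).1 0 k = heat_xi c k p.1 by rewrite mxE.
congr (_, _).
  by apply/rowP; apply: ord2P; rewrite !mxE /heat_dxi /= !Fx /heat_xi /L_tau1 /=
    !M_bracket_coef //=; field.
by rewrite /= /heat_dphi !Fx /= /heat_lambda /heat_xi /L_tau1 /= !M_bracket_coef //=;
  field.
Qed.

End HeatAlgebra.

(* The case a = 3/4 has to be excluded: there the equation has the further
   symmetry sqrt x d/dx - u / (2 sqrt x) d/du, and the algebra has dimension 9. *)
Theorem mainTheorem16 (R : realType) (a b d e : R)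
    (ha : a <> 1 / 4%:R) (ha' : a <> 3%:R / 4%:R)
    (hd : d = 1 / 4%:R) (hb : b = 0) (he : e = 0) :
  [/\ lie_algebra_on (L a b d e) (@L_bracket R),
      basis_of_set (L a b d e)
        [tuple v1 a; @v2 R; @v3 R; @v4 R; @v5 R; @v6 R],
      lie_isomorphic (L a b d e) (@L_bracket R)
        [set: 'rV[R]_6] (@M_bracket R)
    & lie_isomorphic [set: 'rV[R]_6] (@M_bracket R)
        (@H00 R) (@H00_bracket R)].
Proof.
subst b d e; split.
- exact: (transport_lie_algebra (@L_field_lin R a) (@L_field_bracket R a)
    (@L_field_in R a) (L_range ha ha')).
- exact: L_basis.
- exact: transport_to_M (@L_field_lin R a) (@L_field_ker R a)
    (@L_field_bracket R a) (@L_field_in R a) (L_range ha ha').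
- exact: transport_from_M (@heat_field_lin R) (@heat_field_ker R)
    (@heat_field_bracket R) (@heat_field_in R) (@heat_range R).
Qed.
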